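(* There is a universal constant $C>0$ such that the following holds for every integer $n\ge 2$. Let $\mathcal{L}\subset\mathbf{S}^2_n$ be a set of $n$ points chosen uniformly and independently at random from $\mathbf{S}^2_n$, let $U(x)=\sum_{z\in\mathcal{L}}\log|x-z|$ for $x\in\mathbf{S}^2_n$, and let $N\in\mathbf{N}\cup\{\infty\}$ denote the number of local maxima of $U$ on $\mathbf{S}^2_n$. Then $$\frac{n}{C\log n}\le \mathbf{E}[N]\le \frac{Cn}{\log n}.$$
   Context: For a positive integer $n$, $\mathbf{S}^2_n\subset\mathbf{R}^3$ is the sphere centered at the origin with surface area $n$ (radius $\sqrt{n/(4\pi)}$). $|\cdot|$ is the Euclidean norm in $\mathbf{R}^3$. *)

(* Defs.v *)
From HB Require Import structures.
From mathcomp Require Export all_boot all_order all_algebra.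
From mathcomp Require Export all_classical all_reals all_analysis.

Set Implicit Arguments.
Unset Strict Implicit.
Unset Printing Implicit Defensive.

Export Order.TTheory GRing.Theory Num.Theory.
Export numFieldNormedType.Exports.

Local Open Scope classical_set_scope.
Local Open Scope ring_scope.

(* Euclidean 3-space as an iterated product, with the product topology and the
   product (that is, Borel) sigma-algebra.  The library norm on a product is the
   sup norm, whence [enorm]. *)
Notation R3 R := (R * R * R)%type (only parsing).

Section Sphere.
Variable R : realType.

Definition enorm (x : R3 R) : R :=
  Num.sqrt (x.1.1 ^+ 2 + x.1.2 ^+ 2 + x.2 ^+ 2).

Definition sphere_radius (n : nat) : R := Num.sqrt (n%:R / (4 * pi)).

Definition sphere (n : nat) : set (R3 R) :=
  [set x | enorm x = sphere_radius n].

(* Spherical coordinates: t is the colatitude, p the longitude. *)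
Definition spherical (r t p : R) : R3 R :=
  (r * sin t * cos p, r * sin t * sin p, r * cos t).

(* Surface area of the part of A lying on the sphere of radius r centered at the
   origin; r ^+ 2 * sin t is the area element of [spherical r]. *)
Definition surface_area (r : R) (A : set (R3 R)) : \bar R :=
  (\int[lebesgue_measure]_(t in `[0%R, pi%R])
     \int[lebesgue_measure]_(p in `[0%R, (2 * pi)%R])
       (r ^+ 2 * sin t * \1_A (spherical r t p))%:E)%E.

(* The whole sphere [sphere n] has area n, hence the normalization. *)
Definition uniform_sphere (n : nat) (A : set (R3 R)) : \bar R :=
  (surface_area (sphere_radius n) A * (n%:R^-1)%:E)%E.

(* The logarithm [lne] is extended-real valued: lne 0 = -oo, whereas the
   real-valued [ln] has ln 0 = 0, which would turn each point z i into a spurious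
   local maximum of the potential. *)
Definition potential (n : nat) (z : 'I_n -> R3 R) (x : R3 R) : \bar R :=
  (\sum_(i < n) lne (enorm (x - z i)%R)%:E)%E.

Definition local_max_on (S : set (R3 R)) (f : R3 R -> \bar R) (x : R3 R) :
    Prop :=
  S x /\ \forall y \near within S (nbhs x), (f y <= f x)%E.

(* [counting] takes the value +oo on infinite sets. *)
Definition num_local_maxima (n : nat) (z : 'I_n -> R3 R) : \bar R :=
  counting [set x | local_max_on (sphere n) (potential z) x].

End Sphere.

Section RandomVariables.
Context d d' (T : measurableType d) (T' : measurableType d') (R : realType).
Variable P : probability T R.

Definition has_law (X : {RV P >-> T'}) (mu : set T' -> \bar R) : Prop :=
  forall A : set T', measurable A -> distribution P X A = mu A.

(* Taking A i = setT for some of the indices gives the product rule for every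
   subfamily. *)
Definition mutually_independent (n : nat) (X : 'I_n -> {RV P >-> T'}) : Prop :=
  forall A : 'I_n -> set T', (forall i, measurable (A i)) ->
    P (\bigcap_i (X i @^-1` A i)) = (\prod_(i < n) P (X i @^-1` A i))%E.

End RandomVariables.

(* Main.v *)
(* Write W_i(y) for the image of the i-th point under the stereographic projection from y
   (with y at infinity), seen as a complex number.  The density of the uniform law becomes a
   multiple of 1 / (1 + |w|^2)^2.  At y the gradient of U is a multiple of sum_i W_i, the
   traceless part of its Hessian is a multiple of sum_i W_i^2, and its Laplacian is a constant
   of order n away from the points.

   Upper bound.  At a local maximum sum_i W_i = 0 and |sum_i W_i^2| <= n, so that the gradient
   is small on a cap around it: for small h, each local maximum contributes area of order h to
   the set of those y at which |sum_i W_i|^2 <= 9 n^2 h.  Since |W_i|^2 just fails to be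
   integrable, sum_i W_i spreads over an area of order n ln n; writing the law of W_i as a
   mixture of Gaussians shows that the probability that |sum_i W_i| <= r is at most
   C r^2 / (n ln n).  Integrate over y and let h tend to 0.

   Lower bound.  If |sum_i W_i|^2 <= n / 16, |sum_i W_i^2| <= n / 6 and
   sum_i |W_i|^3 <= n^(3/2) / 60, and no point is close to y, then U is larger at y than on the
   circle formed by the points whose stereographic image has modulus sqrt n, so there is a
   local maximum in a cap of normalized area 1 / (n + 1) around y.  These conditions hold with
   probability at least c / ln n: truncated moments confine the sum over half of the points to
   O(ln n) cells of side sqrt n / 8, and by independence and symmetry the sums over the two
   halves fall in opposite cells with probability at least c / ln n. *)

Require Import Defs.
From HB Require Import structures.
From mathcomp Require Import measurable_realfun ring lra.

Set Implicit Arguments.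
Unset Strict Implicit.
Unset Printing Implicit Defensive.

Local Open Scope classical_set_scope.
Local Open Scope ring_scope.

(** * Changes of variables *)

(** Counting maxima by area avoids any study of critical points: the caps around finitely many
    maxima are disjoint once [h] is small, whether or not the maxima are isolated or nondegenerate.
    How small [h] must be depends on the configuration, hence a lower limit and Fatou's lemma. In
    the Gaussian mixture, W has variance proportional to [1 / s] with [s] exponential, so variances
    add along the sum; writing the inverse of the total variance as an integral of exponentials
    turns the bound into powers of one function [psi]. Near 0, [psi l] falls below 1 by at least a
    constant times [l ln (1 / l)], and this is the source of [n ln n]. For the lower bound, a
    typical sum of W has size [sqrt (n ln n)], too large by a factor [sqrt (ln n)], and the sum of
    W^2 fluctuates on the scale [n] of its own threshold. Excluding a cap of measure [K / n] with a
    large constant [K] brings the second sum below its threshold and costs only a constant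
    probability [exp (- K)]. The first sum is left to the collision of cells. *)

Section Density.
Local Open Scope ereal_scope.
Context d (T : measurableType d) (R : realType) (m : {measure set T -> \bar R}).
Variable g : T -> R.
Hypotheses (mg : measurable_fun setT g) (g0 : forall x, (0 <= g x)%R).

(** The two properties of [g] are arguments so that the measure structure declared below can be
    attached to this constant. *)
Definition density of measurable_fun setT g & (forall x, (0 <= g x)%R) :
  set T -> \bar R := fun A => \int[m]_(x in A) (g x)%:E.

Local Notation nu := (density mg g0).

Let density0 : nu set0 = 0.
Proof. by rewrite /density integral_set0. Qed.

Let density_ge0 A : 0 <= nu A.
Proof. by apply: integral_ge0 => x _; rewrite lee_fin. Qed.

Let density_sigma_additive : semi_sigma_additive nu.
Proof.
move=> /= F mF tF mUF; rewrite /density; apply: cvg_toP.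
  apply: ereal_nondecreasing_is_cvgn => n k nk.
  apply: lee_sum_nneg_natr => // i _ _.
  by apply: integral_ge0 => /= x _; rewrite lee_fin.
rewrite ge0_integral_bigcup//=; last 2 first.
- by apply: measurable_funTS; exact/measurable_EFinP.
- by move=> x _; rewrite lee_fin.
Qed.

HB.instance Definition _ := isMeasure.Build _ _ _ nu
  density0 density_ge0 density_sigma_additive.

Import HBNNSimple.

Let integral_density_nnsfun (f : {nnsfun T >-> R}) :
  \int[nu]_x (f x)%:E = \int[m]_x ((f x)%:E * (g x)%:E).
Proof.
under [LHS]eq_integral do rewrite fimfunE -fsumEFin//.
rewrite [LHS]ge0_integral_fsum//; last 2 first.
  - by move=> r; exact/measurable_EFinP/measurableT_comp.
  - by move=> n x _; rewrite EFinM nnfun_muleindic_ge0.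
under [RHS]eq_integral.
  move=> x xD; rewrite fimfunE -fsumEFin// muleC ge0_mule_fsumr; last first.
    by move=> r; rewrite EFinM nnfun_muleindic_ge0.
  over.
rewrite [RHS]ge0_integral_fsum//; last 2 first.
  - move=> r; apply: emeasurable_funM; first exact/measurable_EFinP.
    by apply/measurable_EFinP; exact: measurable_funM.
  - move=> n x _; rewrite mule_ge0//; last by rewrite EFinM nnfun_muleindic_ge0.
    by rewrite lee_fin.
apply: eq_fsbigr => r _; rewrite integralZl_indic_nnsfun//= integral_indic// setIT.
rewrite /= /density.
have [r0|r0] := ltP r 0%R.
  rewrite (_ : f @^-1` [set r] = set0); last first.
    by apply/seteqP; split => // x/= fxr; move: r0; rewrite -fxr ltNge fun_ge0.
  rewrite integral_set0 mule0 integral0_eq// => x _.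
  by rewrite indic0 mulr0 mule0.
under [RHS]eq_integral do rewrite EFinM muleCA.
rewrite [RHS]ge0_integralZl//; last 2 first.
  - apply: emeasurable_funM; first exact/measurable_EFinP.
    exact/measurable_EFinP.
  - by move=> x _; rewrite -EFinM lee_fin mulr_ge0.
congr (_ * _); rewrite [LHS]integral_mkcond; apply: eq_integral => x _.
by rewrite patchE indicE; case: ifPn => _; rewrite ?mule1 ?mule0.
Qed.

Lemma ge0_integral_density (f : T -> \bar R) : measurable_fun setT f ->
  (forall x, 0 <= f x) -> \int[nu]_x f x = \int[m]_x (f x * (g x)%:E).
Proof.
move=> mf f0.
pose f_ := nnsfun_approx measurableT mf.
transitivity (lim (\int[nu]_x (f_ n x)%:E @[n --> \oo])).
  rewrite -monotone_convergence//=.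
  - apply: eq_integral => ? /[!inE] xD; apply/esym/cvg_lim => //=.
    exact: cvg_nnsfun_approx.
  - by move=> n; exact/measurable_EFinP/measurable_funTS.
  - by move=> n ? _; rewrite lee_fin.
  - by move=> ? _ ? ? mn; rewrite lee_fin; exact/lefP/nd_nnsfun_approx.
under eq_fun do rewrite integral_density_nnsfun.
rewrite -monotone_convergence//=.
- apply: eq_integral => x _; apply/cvg_lim => //.
  apply: cvgeZr => //; exact: cvg_nnsfun_approx.
- by move=> n; apply: emeasurable_funM; exact/measurable_EFinP.
- by move=> n ? _; rewrite -EFinM lee_fin mulr_ge0.
- move=> x _ a b ab; rewrite lee_wpmul2r// ?lee_fin//.
  exact/lefP/nd_nnsfun_approx.
Qed.

End Density.

(** * One-dimensional substitution for nonnegative measurable functions *)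

Section Substitution.
Context {R : realType}.
Local Notation mu := (@lebesgue_measure R).
Local Open Scope ereal_scope.

(** The preimage of a half-open interval under an increasing map on a segment is an interval whose
    left end may or may not belong to it; this treats both cases at once. *)
Lemma lebesgue_measure_between (a b : R) (X : set R) : (a <= b)%R ->
  measurable X -> `]a, b] `<=` X -> X `<=` `[a, b] -> mu X = (b - a)%:E.
Proof.
move=> ab mX abX Xab.
have muab b0 b1 : mu [set` Interval (BSide b0 a) (BSide b1 b)] = (b - a)%:E.
  rewrite lebesgue_measure_itv/= lte_fin -EFinD; case: ifPn => //.
  rewrite -leNgt => ba; have -> : b = a by lra.
  by rewrite subrr.
apply/eqP; rewrite eq_le; apply/andP; split.
  have : mu X <= mu `[a, b]%classic by apply: le_measure; rewrite ?inE.
  by move/le_trans; apply; rewrite muab.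
have : mu `]a, b]%classic <= mu X by apply: le_measure; rewrite ?inE.
by apply: le_trans; rewrite muab.
Qed.

Lemma ge0_integral_between (a b : R) (X : set R) (f : R -> \bar R) :
  measurable X -> measurable_fun setT f -> (forall u, 0 <= f u) ->
  `]a, b] `<=` X -> X `<=` `[a, b] ->
  \int[mu]_(u in X) f u = \int[mu]_(u in `[a, b]) f u.
Proof.
move=> mX mf f0 abX Xab; apply/eqP; rewrite eq_le; apply/andP; split.
  by apply: ge0_subset_integral => //; exact: measurable_funTS.
rewrite -integral_itv_obnd_cbnd; last exact: measurable_funTS.
by apply: ge0_subset_integral => //; exact: measurable_funTS.
Qed.

Variables (F F' : R -> R).
Hypotheses (dF : forall u, is_derive (u : R) 1%R F (F' u)) (cF' : continuous F').

Let cF : continuous F.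
Proof.
by move=> u; apply: differentiable_continuous; apply/derivable1_diffP; have [] := dF u.
Qed.

Lemma integral_derivative (s t : R) : (s <= t)%R ->
  \int[mu]_(u in `[s, t]) (F' u)%:E = (F t - F s)%:E.
Proof.
rewrite le_eqVlt => /predU1P[->|st]; first by rewrite set_itv1 integral_set1 subrr.
rewrite (@continuous_FTC2 _ F' F)//.
- exact: continuous_subspaceT.
- split => [u _||]; first by have [] := dF u.
  + exact/cvg_at_right_filter/cF.
  + exact/cvg_at_left_filter/cF.
- by move=> u _; rewrite derive1E; have [_] := dF u.
Qed.

(** The image under [F] of the measure with density [F'] on [[x, y]] is Lebesgue measure on
    [[F x, F y]]. By uniqueness of measures it suffices to compare half-open intervals, where the
    fundamental theorem of calculus applies; [f] need then only be measurable. *)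
Lemma ge0_substitution_segment (x y : R) (f : R -> \bar R) : (x <= y)%R ->
  {in `[x, y], forall u, (0 <= F' u)%R} ->
  {in `[x, y] &, {homo F : u v / (u < v)%R}} ->
  measurable_fun setT f -> (forall u, 0 <= f u) ->
  \int[mu]_(u in `[F x, F y]) f u =
  \int[mu]_(u in `[x, y]) (f (F u) * (F' u)%:E).
Proof.
move=> xy F'0 Flt mf f0.
have Fle : {in `[x, y] &, {mono F : u v / (u <= v)%R}} by exact: le_mono_in.
have mF : measurable_fun setT F by exact: continuous_measurable_fun.
pose g := (fun u => F' u * \1_(`[x, y]%classic) u)%R.
have mg : measurable_fun setT g.
  by apply: measurable_funM; [exact: continuous_measurable_fun|exact: measurable_indic].
have g0 u : (0 <= g u)%R.
  rewrite /g indicE; have [/[!inE] uxy|_] := boolP (u \in _); last by rewrite mulr0.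
  by rewrite mulr1 F'0.
have FxFy : (F x <= F y)%R by rewrite Fle ?in_itv/= ?lexx ?xy//; lra.
have mT : measurable_fun setT (F : R -> measurableTypeR R) by [].
pose m2 := pushforward (density mu mg g0) (F : R -> measurableTypeR R).
have mFx : measurable (`[F x, F y]%classic : set R) by [].
have mh : measurable_fun setT (\1_(`[F x, F y]%classic) : R -> R).
  exact: measurable_indic.
have h0 (u : R) : (0 <= \1_(`[F x, F y]%classic) u :> R)%R by [].
pose m1 := density mu mh h0.
have m1E A : measurable A -> m1 A = mu (A `&` `[F x, F y]%classic).
  by move=> mA; rewrite /m1 /density integral_indic// setIC.
have m12 A : measurable A -> m1 A = m2 A.
  have unq := @measure_unique _ R (measurableTypeR R) (@ocitv R) (fun n => `](- (n%:R))%R, n%:R%R]%classic).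
  apply: (unq _ _ _ _ m1 m2) => //.
  - exact: ocitvI.

  - by move=> n; exact: is_ocitv.
  - apply/seteqP; split => // u _; exists (Num.truncn `|u|%R).+1 => //=.
    rewrite in_itv/=; have := truncnS_gt `|u|%R.
    by rewrite ltr_norml => /andP[-> /ltW].
  - move=> _ [[a b] _ <-]; apply: etrans (m1E _ _) _ => //=; rewrite /m2/pushforward/density/=.
    rewrite [RHS]integral_mkcond.
    (* Truncated to [[F x, F y]], the endpoints [a] and [b] become values of [F], so that the
       intermediate value theorem provides [s] and [t]. *)
    pose clip (c : R) := Num.max (F x) (Num.min c (F y)).
    have clipP c : exists2 s, s \in `[x, y] & F s = clip c.
      have [||s sxy Fs] := @IVT R F x y (clip c) xy.
      + exact: continuous_subspaceT.
      + rewrite (min_idPl FxFy) (max_idPr FxFy) /clip le_max lexx/=.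
        by rewrite ge_max FxFy ge_min lexx orbT.
      + by exists s.
    have [s sxy Fs] := clipP a; have [t txy Ft] := clipP b.
    have [ab|ba] := ltP a b; last first.
      rewrite set_itv_ge ?bnd_simp -?leNgt// set0I measure0.
      by rewrite preimage_set0 integral0_eq// => u _; rewrite patch_set0.
    have st : (s <= t)%R.
      rewrite -Fle// Fs Ft /clip ge_max le_max lexx/= le_max; apply/orP; right.
      by rewrite le_min ge_min (ltW ab)/= ge_min lexx orbT.
    rewrite (@lebesgue_measure_between (F s) (F t)); last first.
    + rewrite Fs Ft /clip => u/=; rewrite !in_itv/= => -[/andP[au ub] /andP[xu uy]].
      by rewrite ge_max xu ge_min (ltW au)/= le_max le_min ub uy orbT.
    + rewrite Fs Ft /clip => u/=; rewrite !in_itv/= gt_max le_max gt_min.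
      case/andP => /andP[xu /orP[au|yu]].
        by case/orP => [?|]; [exfalso; lra|rewrite le_min au (ltW xu) => /andP[-> ->]].
      by case/orP => [?|]; [exfalso; lra|rewrite le_min => /andP[? ?]; exfalso; lra].
    + exact: measurableI.
    + by rewrite Fle.
    rewrite -integral_derivative//.
    have sx : (x <= s <= y)%R by rewrite in_itv/= in sxy.
    have tx : (x <= t <= y)%R by rewrite in_itv/= in txy.
    transitivity (\int[mu]_(u in F @^-1` `]a, b] `&` `[x, y]) (g u)%:E); last first.
      rewrite [LHS]integral_mkcond; apply: eq_integral => u _.
      rewrite !patchE in_setI /g indicE.
      by do 2!case: (_ \in _); rewrite ?mulr1 ?mulr0.
    rewrite [RHS](@ge0_integral_between s t)//.
    + apply: eq_integral => u /[!inE]/= ust; rewrite /g indicE mem_set/= ?mulr1//.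
      move: ust; rewrite !in_itv/= => /andP[? ?]; lra.
    + apply: measurableI => //; rewrite -[X in measurable X]setTI; exact: mF.
    + by apply/measurable_EFinP.
    + move=> u/=; rewrite !in_itv/= => /andP[su ut].
      have uxy : u \in `[x, y] by rewrite in_itv/=; lra.
      split; last by lra.
      have : (F s < F u)%R by rewrite (leW_mono_in Fle).
      have : (F u <= F t)%R by rewrite Fle.
      rewrite Fs Ft /clip le_max le_min gt_max gt_min.
      have : (F x <= F u)%R by rewrite Fle ?in_itv/= ?lexx ?xy//; lra.
      have : (F u <= F y)%R by rewrite Fle ?in_itv/= ?lexx ?xy//; lra.
      move=> ? ? /orP[?|/andP[-> ?]]; last by move=> /andP[? /orP[->//|?]]; exfalso; lra.
      by move=> /andP[? /orP[|]]; [move=> ?|]; exfalso; lra.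
    + move=> u/=; rewrite !in_itv/= => -[/andP[au ub] uxy].
      have uxy' : u \in `[x, y] by rewrite in_itv/=.
      have Fxu : (F x <= F u)%R by rewrite Fle ?in_itv/= ?lexx ?xy//; lra.
      have Fuy : (F u <= F y)%R by rewrite Fle ?in_itv/= ?lexx ?xy//; lra.
      rewrite -(Fle s u)// -(Fle u t)// Fs Ft /clip ge_max Fxu ge_min (ltW au)/= le_max le_min ub Fuy orbT//.
  - move=> n; apply: (@le_lt_trans _ _ (mu (`](- (n%:R))%R, n%:R%R] `&` `[F x, F y]%classic))).
      by rewrite -m1E.
    apply: (@le_lt_trans _ _ (mu `[F x, F y]%classic)).
      by apply: le_measure; rewrite ?inE//; exact: measurableI.
    by rewrite lebesgue_measure_itv/=; case: ifP => // _; rewrite ltry.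
transitivity (\int[m1]_(u in setT) f u).
  rewrite /m1 ge0_integral_density// [LHS]integral_mkcond; apply: eq_integral => u _.
  by rewrite patchE indicE; case: (_ \in _); rewrite ?mule1 ?mule0.
transitivity (\int[m2]_(u in setT) f u).
  by apply: eq_measure_integral => A mA _; exact: m12.
rewrite /m2 ge0_integral_pushforward//.
rewrite preimage_setT ge0_integral_density//.
  rewrite [RHS]integral_mkcond; apply: eq_integral => u _ /=.
  by rewrite /g patchE indicE; case: ifPn; rewrite ?mulr1 ?mulr0 ?mule0.
exact: measurableT_comp.
by move=> u /=.
Qed.

End Substitution.

Section Substitutions.
Context {R : realType}.
Local Notation mu := (@lebesgue_measure R).

(** Increasing segments exhaust unbounded or open domains; both sides converge by monotonicity. *)
Lemma ge0_substitution_exhaust (F F' : R -> R) (x y : nat -> R)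
    (f : R -> \bar R) :
  (forall u : R, is_derive u 1 F (F' u)) -> continuous F' ->
  {homo x : m n / (m <= n)%N >-> n <= m} -> {homo y : m n / (m <= n)%N >-> m <= n} ->
  (forall n, x n <= y n) ->
  (forall n, {in `[x n, y n], forall u, 0 <= F' u}) ->
  (forall n, {in `[x n, y n] &, {homo F : u v / u < v}}) ->
  measurable_fun setT f -> (forall u, 0 <= f u)%E ->
  (\int[mu]_(u in \bigcup_n `[F (x n), F (y n)]%classic) f u =
  \int[mu]_(u in \bigcup_n `[x n, y n]%classic) (f (F u) * (F' u)%:E))%E.
Proof.
move=> dF cF' xd yi xy F'0 Flt mf f0.
have cF : continuous F.
  by move=> u; apply: differentiable_continuous; apply/derivable1_diffP; have [] := dF u.
have mF : measurable_fun setT F by exact: continuous_measurable_fun.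
have mF' : measurable_fun setT F' by exact: continuous_measurable_fun.
have Fle n : {in `[x n, y n] &, {mono F : u v / u <= v}} by apply: le_mono_in; exact: Flt.
have cvgL : (\int[mu]_(u in `[F (x n), F (y n)]) f u @[n --> \oo] -->
    \int[mu]_(u in \bigcup_n `[F (x n), F (y n)]%classic) f u)%E.
  apply: ge0_nondecreasing_set_cvg_integral => //.
  - move=> m n mn; apply/subsetPset => u /=; rewrite !in_itv/= => /andP[xu uy].
    have [xm ym] : x m \in `[x n, y n] /\ y m \in `[x n, y n].
      by rewrite !in_itv/=; have := xd _ _ mn; have := yi _ _ mn; have := xy m; lra.
    have [xn yn] : x n \in `[x n, y n] /\ y n \in `[x n, y n].
      by rewrite !in_itv/=; have := xy n; lra.
    apply/andP; split.
      by apply: le_trans xu; rewrite (Fle n)// xd.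
    by apply: le_trans uy _; rewrite (Fle n)// yi.
  - by move=> i; exact: measurable_funTS.
have cvgR : (\int[mu]_(u in `[x n, y n]) (f (F u) * (F' u)%:E) @[n --> \oo] -->
    \int[mu]_(u in \bigcup_n `[x n, y n]%classic) (f (F u) * (F' u)%:E))%E.
  apply: ge0_nondecreasing_set_cvg_integral => //.
  - move=> m n mn; apply/subsetPset => u /=; rewrite !in_itv/= => /andP[xu uy].
    by have := xd _ _ mn; have := yi _ _ mn; lra.
  - move=> i; apply: measurable_funTS; apply: emeasurable_funM.
      exact: measurableT_comp.
    exact/measurable_EFinP.
  - by move=> i u /= uxy; rewrite mule_ge0// lee_fin (F'0 i).
have e n : (\int[mu]_(u in `[F (x n), F (y n)]) f u =
    \int[mu]_(u in `[x n, y n]) (f (F u) * (F' u)%:E))%E.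
  by apply: (ge0_substitution_segment dF).
move: cvgL; rewrite (funext e) => cvgL.
by apply: cvg_unique cvgL cvgR; exact: ereal_hausdorff.
Qed.

Lemma bigcup_itvNnn : \bigcup_n `[(- (n%:R : R))%R, n%:R%R]%classic = [set: R].
Proof.
apply/seteqP; split => // u _; exists (Num.truncn `|u|).+1 => //=.
by rewrite in_itv/= -ler_norml ltW// truncnS_gt.
Qed.

Let Nnn_homo : {homo (fun n => - (n%:R) : R) : m n / (m <= n)%N >-> n <= m}.
Proof. by move=> m n mn; rewrite lerN2 ler_nat. Qed.

Let nn_homo : {homo (fun n => n%:R : R) : m n / (m <= n)%N >-> m <= n}.
Proof. by move=> m n mn; rewrite ler_nat. Qed.

Let Nnn_le n : - (n%:R) <= n%:R :> R.
Proof. by have : 0 <= n%:R :> R by []; lra. Qed.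

Lemma ge0_integral_affine (k l : R) (f : R -> \bar R) : 0 < k ->
  measurable_fun setT f -> (forall u, 0 <= f u)%E ->
  (\int[mu]_u f u = \int[mu]_u (f (k * u + l)%R * k%:E))%E.
Proof.
move=> k0 mf f0; rewrite -bigcup_itvNnn.
have dF (u : R) : is_derive u 1 (fun u => k * u + l) k.
  by apply: is_derive_eq; rewrite /GRing.scale/=; ring.
rewrite -(ge0_substitution_exhaust (x := fun n => - n%:R) (y := fun n => n%:R) (f := f) dF)//.
- congr (\int[_]_(_ in _) _)%E; rewrite bigcup_itvNnn.
  apply/seteqP; split => // u _.
  exists (Num.truncn (`|(u - l) / k|)).+1 => //=.
  set n := _.+1; have : `|(u - l) / k| < n%:R by exact: truncnS_gt.
  rewrite ltr_norml ltr_pdivlMr// ltr_pdivrMr// in_itv/= => /andP[? ?].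
  by apply/andP; split; lra.
- by move=> u; exact: cst_continuous.
- by move=> n u _; exact: ltW.
- by move=> n u v _ _ uv; rewrite ltrD2r ltr_pM2l.
Qed.

Lemma ge0_integral_opp (f : R -> \bar R) :
  measurable_fun setT f -> (forall u, 0 <= f u)%E ->
  (\int[mu]_u f u = \int[mu]_u (f (- u)%R))%E.
Proof.
move=> mf f0.
transitivity (\int[pushforward mu (-%R : _ -> measurableTypeR R)]_u f u)%E.
  by apply: eq_measure_integral => A mA _; apply/esym; exact: lebesgue_measureN.
by rewrite ge0_integral_pushforward// preimage_setT.
Qed.

Lemma ge0_integral_atan (g : R -> \bar R) :
  measurable_fun setT g -> (forall u, 0 <= g u)%E ->
  (\int[mu]_(p in `](- (pi / 2))%R, (pi / 2)%R[) g p =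
   \int[mu]_m (g (atan m) * ((1 + m ^+ 2)^-1)%:E))%E.
Proof.
move=> mg g0; rewrite -bigcup_itvNnn.
rewrite -(ge0_substitution_exhaust (x := fun n => - n%:R) (y := fun n => n%:R)
  (f := g) (@is_derive1_atan R))//.
- congr (\int[_]_(_ in _) _)%E; apply/seteqP; split => u/=; rewrite in_itv/=.
    move=> /andP[u1 u2].
    have up : u \in `](- (pi / 2)), (pi / 2)[ by rewrite in_itv/= u1.
    exists (Num.truncn `|tan u|).+1 => //=; set n := _.+1.
    rewrite in_itv/= -(tanK up).
    have : `|tan u| < n%:R by exact: truncnS_gt.
    rewrite ltr_norml => /andP[? ?].
    by apply/andP; split; apply/ltW; exact: lt_atan.
  move=> [n _]/=; rewrite in_itv/= => /andP[u1 u2]; apply/andP; split.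
    by apply: lt_le_trans u1; exact: atan_gtNpi2.
  by apply: le_lt_trans u2 _; exact: atan_ltpi2.
- move=> u; apply: cvgV.
    by rewrite gt_eqF// ltr_pwDl// sqr_ge0.
  by apply: cvgD; [exact: cvg_cst|exact: exprn_continuous].
- by move=> n u _; rewrite invr_ge0 addr_ge0// sqr_ge0.
- by move=> n u v _ _ uv; exact: lt_atan.
Qed.

Lemma measurable_inv : measurable_fun [set: R] (@GRing.inv R).
Proof.
rewrite -(setUv [set (0:R)]); apply/measurable_funU => //.
  exact: measurableC.
split; first exact: measurable_fun_set1.
apply: open_continuous_measurable_fun; first exact/closed_openC/closed_eq.
by move=> x /[!inE]/= /eqP x0; exact: inv_continuous.
Qed.

Lemma measurable_sqrt : measurable_fun [set: R] (@Num.sqrt R).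
Proof. by apply: continuous_measurable_fun; exact: sqrt_continuous. Qed.

Lemma ge0_integral_cos (f : R -> \bar R) :
  measurable_fun setT f -> (forall u, 0 <= f u)%E ->
  (\int[mu]_(c in `[(-1)%R, 1%R]) f c =
   \int[mu]_(t in `[0%R, pi]) (f (cos t) * (sin t)%:E))%E.
Proof.
move=> mf f0.
have dF (u : R) : is_derive u 1 (fun t => - cos t) (sin u).
  by apply: is_derive_eq; rewrite opprK.
have mfN : measurable_fun setT (fun u : R => f (- u)) by exact: measurableT_comp.
transitivity (\int[mu]_(c in `[(- cos 0)%R, (- cos pi)%R]) f (- c)%R)%E.
  rewrite cos0 cospi opprK integral_mkcond [RHS]integral_mkcond ge0_integral_opp.
  - apply: eq_integral => u _; rewrite !patchE !mem_setE !in_itv/=.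
    by congr (if _ then _ else _); apply/idP/idP => ?; lra.
  - by apply/(measurable_restrictT f) => //; exact: measurable_funTS.
  - by move=> u; rewrite patchE; case: ifP.
rewrite (ge0_substitution_segment dF (@continuous_sin R) (x := 0) (y := pi) (f := fun u => f (- u)))//.
- by apply: eq_integral => u _; rewrite opprK.

- exact: pi_ge0.
- by move=> u; rewrite in_itv/= => ?; exact: sin_ge0_pi.
- by move=> u v u0 v0 uv; rewrite ltrN2 ltr_cos.
Qed.

(** This is [ge0_integral_cos] applied to [h] divided by the sine. The endpoints, where the sine
    vanishes, are removed as null sets. *)
Lemma ge0_integral_arccos (h : R -> \bar R) :
  measurable_fun setT h -> (forall u, 0 <= h u)%E ->
  (\int[mu]_(t in `[0%R, pi]) h (cos t) =
   \int[mu]_(c in `[(-1)%R, 1%R]) (h c * ((Num.sqrt (1 - c ^+ 2))^-1)%:E))%E.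
Proof.
move=> mh h0.
have mcos : measurable_fun setT (@cos R) by apply: continuous_measurable_fun; exact: continuous_cos.
have msin : measurable_fun setT (@sin R) by apply: continuous_measurable_fun; exact: continuous_sin.
have mw : measurable_fun setT (fun c : R => (Num.sqrt (1 - c ^+ 2))^-1).
  apply: measurableT_comp measurable_inv _; apply: measurableT_comp measurable_sqrt _.
  by apply: measurable_funB => //; exact: measurable_funX.
rewrite ge0_integral_cos; last 2 first.
- by apply: emeasurable_funM => //; exact/measurable_EFinP.
- by move=> u; rewrite mule_ge0// lee_fin.
rewrite [LHS]integral_itv_bndoo; last first.
  by apply: measurable_funTS; apply: (measurableT_comp mh).
rewrite [RHS]integral_itv_bndoo; last first.
- apply: measurable_funTS; apply: emeasurable_funM.
    apply: emeasurable_funM; first exact: (measurableT_comp mh).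
    by apply/measurable_EFinP; exact: (measurableT_comp mw).
  exact/measurable_EFinP.

apply: eq_integral => t /[!inE]/=; rewrite in_itv/= => t0.
have s0 := sin_gt0_pi t0.
by rewrite -muleA -EFinM -sin2cos2 sqrtr_sqr gtr0_norm// mulVf ?mule1// gt_eqF.
Qed.

(** Here [c] is the height of a point of the unit sphere whose stereographic image has squared
    modulus [k * x ^+ 2]. It is used with [k = 1 + m ^+ 2], where [x] is the abscissa of the image
    on the line of slope [m]; the excluded height 1 corresponds to infinity. *)
Lemma ge0_integral_radial (k : R) (g : R -> \bar R) : 0 < k ->
  measurable_fun setT g -> (forall u, 0 <= g u)%E ->
  (\int[mu]_(c in `[(-1)%R, 1%R[) g c =
   \int[mu]_(x in `[0%R, +oo[)
     (g (1 - 2 / (1 + k * x ^+ 2))%R * (4 * k * x / (1 + k * x ^+ 2) ^+ 2)%:E))%E.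
Proof.
move=> k0 mg g0.
have q0 (x : R) : 0 < 1 + k * x ^+ 2.
  by rewrite ltr_pwDl// mulr_ge0 ?sqr_ge0// ltW.
have -> : `[0%R, +oo[%classic = \bigcup_n `[(0:R), (n%:R : R)]%classic.
  apply/seteqP; split => u/=; rewrite in_itv/= ?andbT.
    move=> u0; exists (Num.truncn u).+1 => //=; rewrite in_itv/= u0 ltW//.
    exact: truncnS_gt.
  by move=> [n _]/=; rewrite in_itv/= => /andP[].
have dF (u : R) : is_derive u 1 (fun x => 1 - 2 / (1 + k * x ^+ 2))
    (4 * k * u / (1 + k * u ^+ 2) ^+ 2).
  have q1 : 1 + k * u ^+ 2 != 0 by rewrite gt_eqF.
  have d1 := @is_deriveV R (fun x => 1 + k * x ^+ 2) u 1 _ q1 _.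
  by apply: is_derive_eq; rewrite /GRing.scale/=; field.
rewrite -(ge0_substitution_exhaust (x := fun=> 0) (y := fun n => n%:R) (f := g) dF)//.
- congr (\int[_]_(_ in _) _)%E; apply/seteqP; split => u/=; rewrite in_itv/=.
    move=> /andP[u1 u2].
    have u0 : 0 < 1 - u by lra.
    pose n := (Num.truncn (2 / (1 - u) / k + 1)).+1; exists n => //=.
    have n1 : 2 / (1 - u) / k + 1 < n%:R by exact: truncnS_gt.
    have n2 : (1 : R) <= n%:R by rewrite ler1n.
    have n3 : n%:R <= n%:R ^+ 2 :> R by rewrite expr2 ler_peMr.
    rewrite in_itv/= expr0n mulr0 addr0 divr1; apply/andP; split; first lra.
    have : 2 / (1 - u) / k <= n%:R ^+ 2 by lra.
    rewrite ler_pdivrMr// ler_pdivrMr// => n4.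
    have : 2 / (1 + k * n%:R ^+ 2) <= 1 - u.
      by rewrite ler_pdivrMr//; nra.
    lra.
  move=> [n _]/=; rewrite in_itv/= expr0n mulr0 addr0 divr1 => /andP[u1 u2]; apply/andP; split; first lra.
  have : 0 < 2 / (1 + k * n%:R ^+ 2) by rewrite divr_gt0.
  lra.
- have cq : continuous (fun x : R => 1 + k * x ^+ 2).
    move=> u; apply: cvgD; first exact: cvg_cst.
    by apply: cvgM; [exact: cvg_cst|exact: exprn_continuous].
  move=> u; apply: cvgM; first by apply: cvgM; [exact: cvg_cst|exact: cvg_id].
  apply: cvgV; first by rewrite expf_neq0// gt_eqF.
  by apply: (@continuous_comp _ _ _ (fun x : R => 1 + k * x ^+ 2) (fun x => x ^+ 2)); [exact: cq|exact: exprn_continuous].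
- move=> n u; rewrite in_itv/= => /andP[u0 _].
  by rewrite divr_ge0// ?mulr_ge0// ?sqr_ge0// ltW.
- move=> n u v; rewrite !in_itv/= => /andP[u0 _] /andP[v0 _] uv.
  rewrite ltrD2l ltrN2 ltr_pM2l// ltf_pV2 ?posrE// ltrD2l ltr_pM2l//.
  by rewrite ltr_pXn2r.
Qed.

End Substitutions.

(** * Integrals over a circle *)

Section Circle.
Context {R : realType}.
Local Notation mu := (@lebesgue_measure R).

Lemma measurable_cos : measurable_fun setT (@cos R).
Proof. by apply: continuous_measurable_fun; exact: continuous_cos. Qed.

Lemma measurable_sin : measurable_fun setT (@sin R).
Proof. by apply: continuous_measurable_fun; exact: continuous_sin. Qed.

Lemma ge0_integral_shift (a b l : R) (f : R -> \bar R) : a <= b ->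
  measurable_fun setT f -> (forall u, 0 <= f u)%E ->
  (\int[mu]_(u in `[a, b]) f (u + l)%R =
   \int[mu]_(u in `[(a + l)%R, (b + l)%R]) f u)%E.
Proof.
move=> ab mf f0.
have dF (u : R) : is_derive u 1 (fun u => u + l) ((fun=> 1) u).
  by apply: is_derive_eq; rewrite addr0.
have c1 : continuous (fun _ : R => 1 : R) by move=> u; exact: cst_continuous.
rewrite (ge0_substitution_segment dF c1 (x := a) (y := b) (f := f))//.
- by apply: eq_integral => u _; rewrite mule1.
- by move=> u v _ _ uv; rewrite ltrD2r.
Qed.

Lemma ge0_integral_reflect (a b l : R) (f : R -> \bar R) :
  measurable_fun setT f -> (forall u, 0 <= f u)%E ->
  (\int[mu]_(u in `[a, b]) f u =
   \int[mu]_(u in `[(l - b)%R, (l - a)%R]) f (l - u)%R)%E.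
Proof.
move=> mf f0; pose g := (f \_ `[a, b]).
have mg : measurable_fun setT g.
  by apply/(measurable_restrictT f) => //; exact: measurable_funTS.
have g0 u : (0 <= g u)%E by rewrite /g patchE; case: ifP.
rewrite integral_mkcond (ge0_integral_opp mg g0).
rewrite (ge0_integral_affine (k := 1) (- l) (f := fun u => g (- u)))//; last first.
  exact: measurableT_comp.
rewrite [RHS]integral_mkcond; apply: eq_integral => u _.
rewrite mule1 /g !patchE !mem_setE !in_itv/= mul1r opprD opprK (addrC _ l).
by congr (if _ then _ else _); apply/idP/idP => ?; lra.
Qed.

Lemma ge0_integral_itv_split (a b c : R) (f : R -> \bar R) :
  a <= b -> b <= c -> measurable_fun setT f -> (forall u, 0 <= f u)%E ->
  (\int[mu]_(u in `[a, c]) f u =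
   \int[mu]_(u in `[a, b]) f u + \int[mu]_(u in `[b, c]) f u)%E.
Proof.
move=> ab bc mf f0.
rewrite -(integral_itv_obnd_cbnd (r := b) (b := BRight c)); last exact: measurable_funTS.
rewrite -ge0_integral_setU//.
- by rewrite -(@itv_bndbnd_setU _ _ _ (BRight b))// bnd_simp.
- exact: measurable_funTS.
- apply/disj_setPS => u/= []; rewrite !in_itv/= => ? ?; lra.
Qed.

Lemma ge0_integral_periodic (g : R -> \bar R) (l : R) : `|l| <= 2 * pi ->
  measurable_fun setT g -> (forall u, 0 <= g u)%E ->
  (forall p, g (p + 2 * pi) = g p) ->
  (\int[mu]_(p in `[0%R, (2 * pi)%R]) g (p + l)%R =
   \int[mu]_(p in `[0%R, (2 * pi)%R]) g p)%E.
Proof.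
have pi0 := pi_gt0 R.
wlog l0 : g l / 0 <= l.
  move=> h l2 mg g0 gp; have [l0|l0] := leP 0 l; first exact: h.
  have := h (fun p => g (p + l)) (- l).
  rewrite oppr_ge0 normrN => /(_ (ltW l0) l2) <-//.
  - by apply: eq_integral => u _; rewrite addrNK.
  - by apply: (measurableT_comp mg); exact: measurable_funD.
  - by move=> p; rewrite addrAC gp.
rewrite ger0_norm// => l2 mg g0 gp.
rewrite (ge0_integral_shift l (f := g))//; last lra.
rewrite (@ge0_integral_itv_split _ (2 * pi))//; [|lra|lra].
rewrite [in RHS](@ge0_integral_itv_split _ l)// addeC; congr (_ + _)%E; last by rewrite add0r.
rewrite -{1}[2 * pi](add0r) [X in `[_, X]]addrC -(ge0_integral_shift (2 * pi) (f := g))//.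
by apply: eq_integral => u _; rewrite gp.
Qed.

(** Arc length per unit of abscissa on the unit circle. Outside [[-1, 1]] the square root is 0 and
    so is its inverse, which lets integrals run over the whole line. *)
Definition arc_weight (u : R) : R := (Num.sqrt (1 - u ^+ 2))^-1.

Lemma measurable_arc_weight : measurable_fun setT arc_weight.
Proof.
apply: measurableT_comp measurable_inv _; apply: measurableT_comp measurable_sqrt _.
by apply: measurable_funB => //; exact: measurable_funX.
Qed.

Lemma arc_weight_ge0 u : 0 <= arc_weight u.
Proof. by rewrite invr_ge0 sqrtr_ge0. Qed.

Lemma arc_weight_eq0 u : u \notin `[(-1)%R, 1%R] -> arc_weight u = 0.
Proof.
rewrite in_itv/= => u1; rewrite /arc_weight ler0_sqrtr ?invr0// subr_le0.
rewrite -[leLHS](expr1n _ 2) -(ger0_norm (@ler01 R)) -[u ^+ 2]real_normK ?num_real//.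
rewrite (ger0_norm (@ler01 R)) lerXn2r ?nnegrE//.
by rewrite leNgt ltr_norml; apply: contra u1 => /andP[? ?]; apply/andP; split; lra.
Qed.

Lemma ge0_integral_circle (g : R -> R -> \bar R) :
  measurable_fun setT (fun z : R * R => g z.1 z.2) ->
  (forall a b, 0 <= g a b)%E ->
  (\int[mu]_(p in `[0%R, (2 * pi)%R]) g (cos p) (sin p) =
   \int[mu]_u ((g u (Num.sqrt (1 - u ^+ 2)) + g u (- Num.sqrt (1 - u ^+ 2))%R)
     * (arc_weight u)%:E))%E.
Proof.
move=> mg g0; have pi0 := pi_gt0 R.
have mG (a b : R -> R) : measurable_fun setT a -> measurable_fun setT b ->
    measurable_fun setT (fun u => g (a u) (b u)).
  by move=> ma mb; apply: (measurableT_comp (f := fun z : R * R => g z.1 z.2) mg (g := fun u => (a u, b u))); exact/measurable_fun_pair.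
have msq : measurable_fun setT (fun u : R => Num.sqrt (1 - u ^+ 2)).
  apply: measurableT_comp measurable_sqrt _.
  by apply: measurable_funB => //; exact: measurable_funX.
have mid : measurable_fun setT (fun u : R => u) by exact: measurable_id.
pose h1 u := g u (Num.sqrt (1 - u ^+ 2)).
pose h2 u := g u (- Num.sqrt (1 - u ^+ 2)).
have mh1 : measurable_fun setT h1 by exact: mG.
have mh2 : measurable_fun setT h2 by apply: mG => //; exact: measurableT_comp.
have sE t : t \in `[0, pi] -> Num.sqrt (1 - cos t ^+ 2) = sin t.
  by rewrite in_itv/= => t0; rewrite -sin2cos2 sqrtr_sqr ger0_norm// sin_ge0_pi.
rewrite (@ge0_integral_itv_split _ pi)//; [|lra|lra|]; last first.
  exact: mG measurable_cos measurable_sin.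
have -> : (\int[mu]_(u in `[0%R, pi]) g (cos u) (sin u) =
    \int[mu]_(u in `[0%R, pi]) h1 (cos u))%E.
  by apply: eq_integral => u /[!inE]/= u0; rewrite /h1 sE.
rewrite (@ge0_integral_reflect pi (2 * pi) (2 * pi)); last 2 first.
- exact: mG measurable_cos measurable_sin.
- by [].
rewrite subrr (_ : 2 * pi - pi = pi); last by lra.
have -> : (\int[mu]_(u in `[0%R, pi]) g (cos (2 * pi - u)) (sin (2 * pi - u)) =
    \int[mu]_(u in `[0%R, pi]) h2 (cos u))%E.
  apply: eq_integral => u /[!inE]/= u0; rewrite /h2 sE//.
  by rewrite mulr_natl addrC cosD2pi sinD2pi cosN sinN.
rewrite !ge0_integral_arccos//; last 2 first.
- by move=> u; exact: g0.
- by move=> u; exact: g0.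
have mw : measurable_fun setT (fun u => (arc_weight u)%:E).
  by apply/measurable_EFinP; exact: measurable_arc_weight.
rewrite -ge0_integralD//; last 4 first.
- by move=> u _; rewrite mule_ge0 ?g0// lee_fin arc_weight_ge0.
- by apply: measurable_funTS; exact: emeasurable_funM.
- by move=> u _; rewrite mule_ge0 ?g0// lee_fin arc_weight_ge0.
- by apply: measurable_funTS; exact: emeasurable_funM.
rewrite integral_mkcond; apply: eq_integral => u _; rewrite patchE mem_setE.
case: ifPn => [_|/arc_weight_eq0 ->]; last by rewrite mule0.
by rewrite ge0_muleDl// g0.
Qed.

End Circle.

(** * The uniform measure on the sphere *)

Section UniformSphere.
Context {R : realType}.
Local Notation mu := (@lebesgue_measure R).
Implicit Types (f : R3 R -> \bar R) (u : R * R) (x y : R3 R).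

Lemma two_pi_gt0 : 0 < 2 * pi :> R.
Proof. by rewrite mulr_gt0// pi_gt0. Qed.

Lemma ltrN11 : -1 < 1 :> R.
Proof. by []. Qed.

(** By Archimedes' theorem the height and the longitude of a uniform point of the unit sphere are
    independent and uniform: [kappa] is their joint law and [sigma] its image on the sphere. *)
Definition kappa : probability _ R :=
  (uniform_prob ltrN11 \x uniform_prob two_pi_gt0)%E.

Definition sph u : R3 R :=
  (Num.sqrt (1 - u.1 ^+ 2) * cos u.2, Num.sqrt (1 - u.1 ^+ 2) * sin u.2, u.1).

Lemma measurable_sqrt1B d (T : measurableType d) (h : T -> R) :
  measurable_fun setT h -> measurable_fun setT (fun t => Num.sqrt (1 - h t ^+ 2)).
Proof.
move=> mh; apply: measurableT_comp measurable_sqrt _.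
by apply: measurable_funB => //; exact: measurable_funX.
Qed.

Lemma measurable_R3 d (T : measurableType d) (a b c : T -> R) :
  measurable_fun setT a -> measurable_fun setT b -> measurable_fun setT c ->
  measurable_fun setT (fun t => (a t, b t, c t) : R3 R).
Proof.
move=> ma mb mc; apply: (measurable_fun_pair (f := fun t => (a t, b t)) (g := c)) => //.
exact: measurable_fun_pair.
Qed.

Lemma measurable_sph : measurable_fun setT sph.
Proof.
apply: measurable_R3 => //.
- apply: measurable_funM; first exact: measurable_sqrt1B.
  exact: measurableT_comp measurable_cos _.
- apply: measurable_funM; first exact: measurable_sqrt1B.
  exact: measurableT_comp measurable_sin _.
Qed.

Definition sph_of (u : measurableTypeR R * measurableTypeR R) : R3 R := sph u.

Let measurable_sph_of : measurable_fun setT sph_of.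
Proof. exact: measurable_sph. Qed.

HB.instance Definition _ := isMeasurableFun.Build _ _ _ _ sph_of measurable_sph_of.

Definition sigma : probability (R3 R) R := distribution kappa sph_of.

Lemma measurable_integral_itv (a b : R) (F : R * R -> \bar R) :
  measurable_fun setT F -> (forall z, 0 <= F z)%E ->
  measurable_fun setT (fun c => \int[mu]_(p in `[a, b]) F (c, p))%E.
Proof.
move=> mF F0.
have mFp : measurable_fun setT (fun z : R * R => (F z * (\1_(`[a, b]%classic) z.2)%:E)%E).
  apply: emeasurable_funM => //; apply/measurable_EFinP.
  by apply: measurableT_comp => //; exact: measurable_indic.
have := measurable_fun_fubini_tonelli_F (m2 := mu) _ mFp.
rewrite /fubini_F/= => h; apply: eq_measurable_fun (h _).
  move=> c _; rewrite [RHS]integral_mkcond; apply: eq_integral => p _.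
  by rewrite patchE indicE; case: ifP; rewrite ?mule1 ?mule0.
by move=> z; rewrite mule_ge0// lee_fin.
Qed.

Lemma integral_sigma f : measurable_fun setT f -> (forall x, 0 <= f x)%E ->
  (\int[sigma]_x f x = ((4 * pi)^-1)%:E *
    \int[mu]_(c in `[(-1)%R, 1%R]) \int[mu]_(p in `[0%R, (2 * pi)%R]) f (sph (c, p)))%E.
Proof.
move=> mf f0; rewrite (ge0_integral_distribution sph_of)//.
have mfs : measurable_fun setT (f \o sph) by exact: measurableT_comp mf measurable_sph.
rewrite (fubini_tonelli1 (m1 := uniform_prob ltrN11) (m2 := uniform_prob two_pi_gt0))//; last first.
  by move=> x; exact: f0.
rewrite /fubini_F integral_uniform; last 2 first.
- apply: (measurable_fun_fubini_tonelli_F (m2 := uniform_prob two_pi_gt0)) => //.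
  by move=> x; exact: f0.
- by move=> x; apply: integral_ge0 => y _; exact: f0.
rewrite (_ : (4 * pi)^-1 = (1 - -1)^-1 * (2 * pi)^-1); last first.
  by move: (pi : R) (pi_gt0 R) => q q0; field; rewrite gt_eqF.
rewrite EFinM -muleA; congr (_ * _)%E.
rewrite -ge0_integralZl//; last 3 first.
- apply: measurable_funTS; apply: (measurable_integral_itv 0 (2 * pi) (F := f \o sph)) => // z.
  exact: f0.
- by move=> c _; apply: integral_ge0.
- by rewrite lee_fin invr_ge0 ltW// two_pi_gt0.
apply: eq_integral => c _; rewrite integral_uniform ?subr0//.
- by apply: (measurableT_comp mfs) => //; exact: measurable_fun_pair.
- by move=> p; exact: f0.
Qed.

Definition rotZ (b : R) x : R3 R :=
  (cos b * x.1.1 - sin b * x.1.2, sin b * x.1.1 + cos b * x.1.2, x.2).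

Lemma measurable_rotZ d (T : measurableType d) (b : T -> R) (h : T -> R3 R) :
  measurable_fun setT b -> measurable_fun setT h ->
  measurable_fun setT (fun t => rotZ (b t) (h t)).
Proof.
move=> mb mh.
have mc : measurable_fun setT (fun t => cos (b t)) by exact: measurableT_comp measurable_cos _.
have ms : measurable_fun setT (fun t => sin (b t)) by exact: measurableT_comp measurable_sin _.
have m1 : measurable_fun setT (fun t => (h t).1) by exact: measurableT_comp measurable_fst mh.
have m11 : measurable_fun setT (fun t => (h t).1.1) by exact: measurableT_comp measurable_fst m1.
have m12 : measurable_fun setT (fun t => (h t).1.2) by exact: measurableT_comp measurable_snd m1.
have m2 : measurable_fun setT (fun t => (h t).2) by exact: measurableT_comp measurable_snd mh.
apply: measurable_R3 => //.
- by apply: measurable_funB; exact: measurable_funM.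
- by apply: measurable_funD; exact: measurable_funM.
Qed.

Lemma rotZ_sph b u : rotZ b (sph u) = sph (u.1, u.2 + b).
Proof.
by rewrite /rotZ /sph/= cosD sinD; congr (_, _, _); ring.
Qed.

Lemma integral_sigma_rotZ b f : `|b| <= 2 * pi ->
  measurable_fun setT f -> (forall x, 0 <= f x)%E ->
  (\int[sigma]_x f (rotZ b x) = \int[sigma]_x f x)%E.
Proof.
move=> b2 mf f0; pose g x := f (rotZ b x).
have mg : measurable_fun setT g by apply: measurableT_comp mf _; exact: measurable_rotZ.
have g0 x : (0 <= g x)%E by exact: f0.
rewrite (integral_sigma mg g0) (integral_sigma mf f0) {mg g0}/g.
apply: (congr1 (mule _)); apply: eq_integral => c _.
under eq_integral do rewrite rotZ_sph/=.
apply: (ge0_integral_periodic (g := fun p => f (sph (c, p)))) => //.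
- apply: measurableT_comp mf _; apply: measurableT_comp measurable_sph _.
  exact: measurable_fun_pair.
- by move=> p; rewrite /sph/= mulr_natl cosD2pi sinD2pi.
Qed.

Definition swap23 x : R3 R := (x.1.1, x.2, x.1.2).

Lemma measurable_swap23 : measurable_fun setT swap23.
Proof.
by apply: measurable_R3 => //; apply: measurableT_comp.
Qed.

(** The slice is parametrized by its second coordinate, which a quarter turn of the longitude makes
    a cosine. The resulting weight is symmetric in [c] and [y], as the exchange of these coordinates
    requires. *)
Lemma integral_sph_slice f (c : R) : -1 < c < 1 ->
  measurable_fun setT f -> (forall x, 0 <= f x)%E ->
  (\int[mu]_(p in `[0%R, (2 * pi)%R]) f (sph (c, p)) =
   \int[mu]_y
     ((f (Num.sqrt (1 - c ^+ 2 - y ^+ 2), y, c) +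
       f ((- Num.sqrt (1 - c ^+ 2 - y ^+ 2))%R, y, c)) *
      ((Num.sqrt (1 - c ^+ 2 - y ^+ 2))^-1)%:E))%E.
Proof.
move=> c1 mf f0.
have mfs : measurable_fun setT (f \o sph) by exact: measurableT_comp mf measurable_sph.
have s0 : 0 < Num.sqrt (1 - c ^+ 2) by rewrite sqrtr_gt0; nra.
have sE (y : R) : Num.sqrt (1 - c ^+ 2) * Num.sqrt (1 - ((Num.sqrt (1 - c ^+ 2))^-1 * y + 0) ^+ 2) =
    Num.sqrt (1 - c ^+ 2 - y ^+ 2).
  have c0'' : 0 < 1 - c ^+ 2 by rewrite -sqrtr_gt0.
  have c0 := ltW c0''; have c0' : 1 - c ^+ 2 != 0 by rewrite gt_eqF.
  rewrite -sqrtrM//; congr Num.sqrt.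
  by rewrite addr0 exprMn exprVn sqr_sqrtr//; field.
set s := Num.sqrt _ in s0 sE *.
pose g a b := f (s * - b, s * a, c).
have mg : measurable_fun setT (fun z : R * R => g z.1 z.2).
  apply: measurableT_comp mf _; apply: measurable_R3 => //.
    by apply: measurable_funM => //; exact: measurableT_comp.
  exact: measurable_funM.
have pi0 := pi_gt0 R.
rewrite -(ge0_integral_periodic (g := fun p => f (sph (c, p))) (l := pi / 2))//; last 3 first.
- by rewrite ger0_norm; lra.
- by apply: (measurableT_comp mfs) => //; exact: measurable_fun_pair.
- by move=> p; rewrite /sph/= mulr_natl cosD2pi sinD2pi.
transitivity (\int[mu]_(p in `[0%R, (2 * pi)%R]) g (cos p) (sin p))%E.
  by apply: eq_integral => p _; rewrite /g /sph/= cosDpihalf sinDpihalf.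
rewrite ge0_integral_circle//; last by move=> a b; exact: f0.
have mG (a b : R -> R) : measurable_fun setT a -> measurable_fun setT b ->
    measurable_fun setT (fun v : R => g (a v) (b v)).
  move=> ma mb; apply: (measurableT_comp (f := fun z : R * R => g z.1 z.2) mg (g := fun v : R => (a v, b v))).
  exact/measurable_fun_pair.
have mid : measurable_fun setT (fun v : R => v) by exact: measurable_id.
have msq := measurable_sqrt1B mid.
rewrite (ge0_integral_affine (k := s^-1) 0); last 3 first.
- by rewrite invr_gt0.
- apply: emeasurable_funM; last by apply/measurable_EFinP; exact: measurable_arc_weight.
  by apply: emeasurable_funD; apply: mG => //; exact: measurableT_comp.
- by move=> u; rewrite mule_ge0 ?adde_ge0 ?f0// lee_fin arc_weight_ge0.
apply: eq_integral => y _; rewrite /g /arc_weight -muleA -EFinM -invfM (mulrC _ s).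
have e1 : s * (s^-1 * y + 0) = y by rewrite addr0 mulrA mulfV ?mul1r// gt_eqF.
by rewrite addeC !mulrN opprK sE e1.
Qed.

(* Outside the disk [y ^+ 2 + c ^+ 2 < 1] the weight is [0^-1 = 0]. *)
Lemma integral_sigma_graph f : measurable_fun setT f -> (forall x, 0 <= f x)%E ->
  (\int[sigma]_x f x = ((4 * pi)^-1)%:E *
    \int[mu]_c \int[mu]_y
     ((f (Num.sqrt (1 - c ^+ 2 - y ^+ 2), y, c) +
       f ((- Num.sqrt (1 - c ^+ 2 - y ^+ 2))%R, y, c)) *
      ((Num.sqrt (1 - c ^+ 2 - y ^+ 2))^-1)%:E))%E.
Proof.
move=> mf f0; rewrite (integral_sigma mf f0); apply: (congr1 (mule _)).
set J := fun c => (\int[mu]_y _)%E; rewrite -/J.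
have J0 c : c \notin `](-1)%R, 1%R[ -> J c = 0.
  rewrite in_itv/= => c1; rewrite /J integral0_eq// => y _.
  rewrite (ler0_sqrtr (a := 1 - c ^+ 2 - y ^+ 2)) ?invr0 ?mule0//.
  have : 0 <= y ^+ 2 by rewrite sqr_ge0.
  suff : 1 <= c ^+ 2 by lra.
  by move: c1; rewrite negb_and -!leNgt => /orP[] ?; nra.
have mfs : measurable_fun setT (f \o sph) by exact: measurableT_comp mf measurable_sph.
have mI : measurable_fun setT (fun c => \int[mu]_(p in `[0%R, (2 * pi)%R]) f (sph (c, p)))%E.
  by apply: (measurable_integral_itv 0 (2 * pi) (F := f \o sph)) => // z; exact: f0.
rewrite integral_itv_bndoo; last exact: measurable_funTS.
rewrite [LHS]integral_mkcond; apply: eq_integral => c _; rewrite patchE mem_setE.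
case: ifPn => [|/J0 Jc]; last by rewrite -[RHS]/(J c) Jc.
by rewrite in_itv/= => c1; exact: integral_sph_slice.
Qed.

(** The weight of the graph formula is unchanged when [c] and [y] are exchanged, so the invariance
    is Tonelli's theorem. It supplies the rotations that do not fix the vertical axis. *)
Lemma integral_sigma_swap23 f : measurable_fun setT f -> (forall x, 0 <= f x)%E ->
  (\int[sigma]_x f (swap23 x) = \int[sigma]_x f x)%E.
Proof.
move=> mf f0; pose g x := f (swap23 x).
have mg : measurable_fun setT g by exact: measurableT_comp mf measurable_swap23.
have g0 x : (0 <= g x)%E by exact: f0.
rewrite (integral_sigma_graph mg g0) (integral_sigma_graph mf f0) {mg g0}/g.
apply: (congr1 (mule _)).
pose F (z : R * R) := ((f (Num.sqrt (1 - z.1 ^+ 2 - z.2 ^+ 2), z.2, z.1) +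
       f ((- Num.sqrt (1 - z.1 ^+ 2 - z.2 ^+ 2))%R, z.2, z.1)) *
      ((Num.sqrt (1 - z.1 ^+ 2 - z.2 ^+ 2))^-1)%:E)%E.
have mq : measurable_fun setT (fun z : R * R => Num.sqrt (1 - z.1 ^+ 2 - z.2 ^+ 2)).
  apply: measurableT_comp measurable_sqrt _.
  by do 2?apply: measurable_funB => //; exact: measurable_funX.
have mF : measurable_fun setT F.
  apply: emeasurable_funM; last by apply/measurable_EFinP; exact: measurableT_comp measurable_inv mq.
  apply: emeasurable_funD; apply: measurableT_comp mf _; apply: measurable_R3 => //.
  exact: measurableT_comp.
have F0 z : (0 <= F z)%E by rewrite mule_ge0 ?adde_ge0// lee_fin invr_ge0 sqrtr_ge0.
have := fubini_tonelli (m1 := mu) (m2 := mu) _ mF F0; rewrite /fubini_F /fubini_G => ->.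
apply: eq_integral => y _; apply: eq_integral => c _; rewrite /F /swap23/=.
by rewrite (_ : 1 - y ^+ 2 - c ^+ 2 = 1 - c ^+ 2 - y ^+ 2)//; ring.
Qed.

Definition tilt (c : R) x : R3 R :=
  (c * x.1.1 - Num.sqrt (1 - c ^+ 2) * x.2, x.1.2, Num.sqrt (1 - c ^+ 2) * x.1.1 + c * x.2).

Lemma measurable_tilt d (T : measurableType d) (b : T -> R) (h : T -> R3 R) :
  measurable_fun setT b -> measurable_fun setT h ->
  measurable_fun setT (fun t => tilt (b t) (h t)).
Proof.
move=> mb mh.
have ms := measurable_sqrt1B mb.
have m1 : measurable_fun setT (fun t => (h t).1) by exact: measurableT_comp measurable_fst mh.
have m11 : measurable_fun setT (fun t => (h t).1.1) by exact: measurableT_comp measurable_fst m1.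
have m12 : measurable_fun setT (fun t => (h t).1.2) by exact: measurableT_comp measurable_snd m1.
have m2 : measurable_fun setT (fun t => (h t).2) by exact: measurableT_comp measurable_snd mh.
apply: measurable_R3 => //.
- by apply: measurable_funB; exact: measurable_funM.
- by apply: measurable_funD; exact: measurable_funM.
Qed.

Lemma tiltE c x : -1 <= c <= 1 -> tilt c x = swap23 (rotZ (acos c) (swap23 x)).
Proof.
by move=> c1; rewrite /tilt /swap23 /rotZ/= acosK// sin_acos.
Qed.

(* The coordinates of [x] in the orthonormal frame (d/dt, d/dp, normal) at [sph u]. *)
Definition frame u x : R3 R := tilt u.1 (rotZ (- u.2) x).

Lemma measurable_frame d (T : measurableType d) (b : T -> R * R) (h : T -> R3 R) :
  measurable_fun setT b -> measurable_fun setT h ->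
  measurable_fun setT (fun t => frame (b t) (h t)).
Proof.
move=> mb mh; apply: measurable_tilt; first exact: measurableT_comp measurable_fst mb.
apply: measurable_rotZ => //; apply: measurableT_comp => //.
exact: measurableT_comp measurable_snd mb.
Qed.

(** [frame u] is a rotation about the vertical axis followed by one about the second axis, and
    [swap23] conjugates the latter to a rotation about the vertical axis. *)
Lemma integral_sigma_frame u f : -1 <= u.1 <= 1 -> 0 <= u.2 <= 2 * pi ->
  measurable_fun setT f -> (forall x, 0 <= f x)%E ->
  (\int[sigma]_x f (frame u x) = \int[sigma]_x f x)%E.
Proof.
move=> u1 u2 mf f0; pose g x := f (tilt u.1 x).
have mg : measurable_fun setT g by apply: measurableT_comp mf _; exact: measurable_tilt.
rewrite (integral_sigma_rotZ (b := - u.2) (f := g))//; last 2 first.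
- by rewrite normrN ger0_norm; case/andP: u2.
- by move=> x; exact: f0.
rewrite /g; under eq_integral do rewrite tiltE//.
pose h x := f (swap23 (rotZ (acos u.1) x)).
have mh1 : measurable_fun setT (fun x => f (swap23 x)) by exact: measurableT_comp mf measurable_swap23.
have mh : measurable_fun setT h by apply: (measurableT_comp mh1); exact: measurable_rotZ.
rewrite (integral_sigma_swap23 (f := h))// /h.
rewrite (integral_sigma_rotZ (b := acos u.1) (f := fun x => f (swap23 x)))//.
  exact: integral_sigma_swap23.
rewrite ger0_norm ?acos_ge0//; have := acos_lepi u1; have := pi_gt0 R; lra.
by move=> x; exact: f0.
Qed.

Definition dot x y : R := x.1.1 * y.1.1 + x.1.2 * y.1.2 + x.2 * y.2.

Lemma sqrt1B_sqr (c : R) : -1 <= c <= 1 -> Num.sqrt (1 - c ^+ 2) ^+ 2 = 1 - c ^+ 2.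
Proof. by move=> c1; rewrite sqr_sqrtr//; nra. Qed.

Lemma dot_rotZ b x y : dot (rotZ b x) (rotZ b y) = dot x y.
Proof.
have := cos2Dsin2 b; rewrite /dot /rotZ/=; set c := cos b; set s := sin b => h.
transitivity ((c ^+ 2 + s ^+ 2) * (x.1.1 * y.1.1 + x.1.2 * y.1.2) + x.2 * y.2); first by ring.
by rewrite h mul1r.
Qed.

Lemma dot_frame u x y : -1 <= u.1 <= 1 -> dot (frame u x) (frame u y) = dot x y.
Proof.
move=> u1; rewrite -(dot_rotZ (- u.2) x y) /frame.
move: (rotZ _ x) (rotZ _ y) => {}x {}y.
have := sqrt1B_sqr u1; rewrite /dot /tilt/=; set s := Num.sqrt _ => h.
transitivity ((u.1 ^+ 2 + s ^+ 2) * (x.1.1 * y.1.1 + x.2 * y.2) + x.1.2 * y.1.2); first by ring.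
by rewrite h; ring.
Qed.

Lemma frame_sph u : -1 <= u.1 <= 1 -> frame u (sph u) = (0, 0, 1).
Proof.
move=> u1; rewrite /frame rotZ_sph subrr /sph/= cos0 sin0 !mulr0 !mulr1.
have := sqrt1B_sqr u1; rewrite /tilt/=; set s := Num.sqrt _ => h.
congr (_, _, _); first by ring.
by rewrite -!expr2 h; ring.
Qed.

Lemma dot_sph u : -1 <= u.1 <= 1 -> dot (sph u) (sph u) = 1.
Proof.
by move=> u1; rewrite -(dot_frame _ _ u1) frame_sph// /dot/= !mul0r !add0r mul1r.
Qed.

Lemma polar_angle (a b : R) : a ^+ 2 + b ^+ 2 = 1 ->
  exists2 p, 0 <= p <= 2 * pi & a = cos p /\ b = sin p.
Proof.
move=> ab; have a1 : -1 <= a <= 1 by nra.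
have [p0 ppi] := (acos_ge0 a1, acos_lepi a1); have pi0 := pi_gt0 R.
have sb : Num.sqrt (1 - a ^+ 2) = `|b| by rewrite -sqrtr_sqr; congr Num.sqrt; lra.
have [b0|b0] := leP 0 b.
  exists (acos a); first lra.
  by rewrite acosK// sin_acos// sb ger0_norm.
exists (2 * pi - acos a); first lra.
rewrite mulr_natl addrC cosD2pi sinD2pi cosN sinN acosK// sin_acos// sb.
by rewrite ltr0_norm// opprK.
Qed.

Lemma sph_surj y : dot y y = 1 ->
  exists u, [/\ -1 <= u.1 <= 1, 0 <= u.2 <= 2 * pi & y = sph u].
Proof.
case: y => -[a b] c; rewrite /dot/= => abc.
have c1 : -1 <= c <= 1 by nra.
have s2 := sqrt1B_sqr c1; set s := Num.sqrt _ in s2 *.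
have [s0|s0] := eqVneq s 0.
  have [a0 b0] : a = 0 /\ b = 0.
    by rewrite s0 expr0n/= in s2; split; nra.
  exists (c, 0); split => //=; first by rewrite lexx/= mulr_ge0// pi_ge0.
  by rewrite /sph/= -/s s0 !mul0r a0 b0.
have [|p p2 [pa pb]] := @polar_angle (a / s) (b / s).
  rewrite !expr_div_n -mulrDl s2 (_ : a ^+ 2 + b ^+ 2 = 1 - c ^+ 2) ?divff//; last lra.
  by rewrite -s2 expf_neq0.
exists (c, p); split => //; rewrite /sph/= -/s -pa -pb.
by congr (_, _, _); field.
Qed.

End UniformSphere.

(** * Gaussian mixtures in the stereographic plane *)

Section TonelliIn.
Context d1 d2 (T1 : measurableType d1) (T2 : measurableType d2) (R : realType).
Variables (m1 : {sigma_finite_measure set T1 -> \bar R})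
  (m2 : {sigma_finite_measure set T2 -> \bar R}).
Variables (D : set T1) (E : set T2) (F : T1 -> T2 -> \bar R).
Hypotheses (mD : measurable D) (mE : measurable E).
Hypothesis mF : measurable_fun setT (fun z : T1 * T2 => F z.1 z.2).
Hypothesis F0 : forall x y, (0 <= F x y)%E.

Let mFx x : measurable_fun setT (F x).
Proof.
apply: (measurableT_comp (f := fun z : T1 * T2 => F z.1 z.2) mF (g := fun y => (x, y))).
exact: measurable_fun_pair.
Qed.

Let mFE : measurable_fun setT (fun z : T1 * T2 => (F z.1 z.2 * (\1_E z.2)%:E)%E).
Proof.
apply: emeasurable_funM => //; apply/measurable_EFinP.
by apply: measurableT_comp => //; exact: measurable_indic.
Qed.

Let restrE x : (\int[m2]_(y in E) F x y = \int[m2]_y (F x y * (\1_E y)%:E))%E.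
Proof.
rewrite integral_mkcond; apply: eq_integral => p _.
by rewrite patchE indicE; case: ifP; rewrite ?mule1 ?mule0.
Qed.

Lemma measurable_integral_in : measurable_fun setT (fun x => \int[m2]_(y in E) F x y)%E.
Proof.
have := measurable_fun_fubini_tonelli_F (m2 := m2) _ mFE.
rewrite /fubini_F/= => h; apply: eq_measurable_fun (h _) => [x _|z].
  by rewrite restrE.
by rewrite mule_ge0// lee_fin.
Qed.

Lemma tonelli_in :
  (\int[m1]_(x in D) \int[m2]_(y in E) F x y =
   \int[m2]_(y in E) \int[m1]_(x in D) F x y)%E.
Proof.
pose G (z : T1 * T2) := (F z.1 z.2 * (\1_E z.2)%:E * (\1_D z.1)%:E)%E.
have mG : measurable_fun setT G.
  apply: emeasurable_funM => //; apply/measurable_EFinP.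
  by apply: measurableT_comp => //; exact: measurable_indic.
have G0 z : (0 <= G z)%E by rewrite /G !mule_ge0// lee_fin.
have := fubini_tonelli (m1 := m1) (m2 := m2) _ mG G0; rewrite /fubini_F /fubini_G /G /= => e.
transitivity (\int[m1]_x \int[m2]_y (F x y * (\1_E y)%:E * (\1_D x)%:E))%E.
  rewrite integral_mkcond; apply: eq_integral => x _; rewrite patchE indicE.
  case: ifPn => _; last by rewrite integral0_eq// => y _; rewrite mule0.
  by rewrite restrE; apply: eq_integral => y _; rewrite mule1.
rewrite e [RHS]integral_mkcond; apply: eq_integral => y _; rewrite patchE indicE.
case: ifPn => _; last by rewrite integral0_eq// => x _; rewrite mule0 mul0e.
rewrite [RHS]integral_mkcond; apply: eq_integral => x _; rewrite patchE indicE mule1.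
by case: ifPn => _; rewrite ?mule1 ?mule0.
Qed.

End TonelliIn.

Lemma measurable_expR_comp d (T : measurableType d) (R : realType) (h : T -> R) :
  measurable_fun setT h -> measurable_fun setT (fun t => expR (h t)).
Proof. by move=> mh; exact: measurableT_comp (@measurable_expR R) mh. Qed.

Lemma measurable_inv_comp d (T : measurableType d) (R : realType) (h : T -> R) :
  measurable_fun setT h -> measurable_fun setT (fun t => (h t)^-1).
Proof. by move=> mh; exact: measurableT_comp (@measurable_inv R) mh. Qed.

Lemma measurable_sqrt_comp d (T : measurableType d) (R : realType) (h : T -> R) :
  measurable_fun setT h -> measurable_fun setT (fun t => Num.sqrt (h t)).
Proof. by move=> mh; exact: measurableT_comp (@measurable_sqrt R) mh. Qed.

Lemma measurable_fst_comp d d1 d2 (T : measurableType d) (T1 : measurableType d1)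
    (T2 : measurableType d2) (h : T -> T1 * T2) :
  measurable_fun setT h -> measurable_fun setT (fun t => (h t).1).
Proof. by move=> mh; exact: measurableT_comp measurable_fst mh. Qed.

Lemma measurable_snd_comp d d1 d2 (T : measurableType d) (T1 : measurableType d1)
    (T2 : measurableType d2) (h : T -> T1 * T2) :
  measurable_fun setT h -> measurable_fun setT (fun t => (h t).2).
Proof. by move=> mh; exact: measurableT_comp measurable_snd mh. Qed.

Lemma measurable_normr_comp d (T : measurableType d) (R : realType) (h : T -> R) :
  measurable_fun setT h -> measurable_fun setT (fun t => `|h t|).
Proof. by move=> mh; exact: (measurableT_comp (@normr_measurable R setT)). Qed.

Ltac meas1 :=
  lazymatch goal with
  | |- measurable_fun _ (fun _ => ?c) => exact: measurable_cst
  | |- measurable_fun _ (fun t => t) => exact: measurable_id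
  | |- measurable_fun _ (fun t => (@?a t, @?b t)) => apply: (measurable_fun_pair (f := a) (g := b))
  | |- measurable_fun _ (fun t => @GRing.inv _ (@?a t)) => apply: (measurable_inv_comp (h := a))
  | |- measurable_fun _ (fun t => @GRing.opp _ (@?a t)) => apply: (measurable_funN (f := a))
  | |- measurable_fun _ (fun t => @GRing.add _ (@?a t) (@GRing.opp _ (@?b t))) =>
      apply: (measurable_funB (f := a) (g := b))
  | |- measurable_fun _ (fun t => @GRing.add _ (@?a t) (@?b t)) => apply: (measurable_funD (f := a) (g := b))
  | |- measurable_fun _ (fun t => @GRing.mul _ (@?a t) (@?b t)) => apply: (measurable_funM (f := a) (g := b))
  | |- measurable_fun _ (fun t => @GRing.exp _ (@?a t) _) => apply: (measurable_funX (f := a))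
  | |- measurable_fun _ (fun t => expR (@?a t)) => apply: (measurable_expR_comp (h := a))
  | |- measurable_fun _ (fun t => `|@?a t|) => apply: (measurable_normr_comp (h := a))
  | |- measurable_fun _ (fun t => Num.sqrt (@?a t)) => apply: (measurable_sqrt_comp (h := a))
  | |- measurable_fun _ (fun t => EFin (@?a t)) => apply/(measurable_EFinP _ a)
  | |- measurable_fun _ (fun t => mule (@?a t) (@?b t)) => apply: (emeasurable_funM (f := a) (g := b))
  | |- measurable_fun _ (fun t => fst (@?a t)) => apply: (measurable_fst_comp (h := a))
  | |- measurable_fun _ (fun t => snd (@?a t)) => apply: (measurable_snd_comp (h := a))
  end.
Ltac meas := repeat first [assumption | progress meas1].

(** * The uniform law in the stereographic plane *)

Section Planar.
Context {R : realType}.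
Local Notation mu := (@lebesgue_measure R).

Lemma sqrt1D_gt0 (m : R) : 0 < Num.sqrt (1 + m ^+ 2).
Proof. by rewrite sqrtr_gt0 ltr_pwDl// sqr_ge0. Qed.

Lemma sin_atan (m : R) : sin (atan m) = m / Num.sqrt (1 + m ^+ 2).
Proof.
have := atanK m; rewrite /tan cos_atan => {2}<-.
by rewrite mulfVK// invr_eq0 gt_eqF// sqrt1D_gt0.
Qed.

(** The line of slope [m] through the origin meets the unit circle in two antipodal points. With
    slopes in place of angles, the passage to Cartesian coordinates takes only one-dimensional
    substitutions. *)
Lemma ge0_integral_half_circles (g : R -> R -> \bar R) :
  measurable_fun setT (fun z : R * R => g z.1 z.2) ->
  (forall a b, 0 <= g a b)%E ->
  (\int[mu]_(p in `[0%R, (2 * pi)%R]) g (cos p) (sin p) =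
   \int[mu]_m ((g ((Num.sqrt (1 + m ^+ 2))^-1)%R (m / Num.sqrt (1 + m ^+ 2))%R +
       g (- (Num.sqrt (1 + m ^+ 2))^-1)%R (- (m / Num.sqrt (1 + m ^+ 2)))%R)
     * ((1 + m ^+ 2)^-1)%:E))%E.
Proof.
move=> mg g0; have pi0 := pi_gt0 R.
pose G p := g (cos p) (sin p).
have mG : measurable_fun setT G.
  apply: (measurableT_comp (f := fun z : R * R => g z.1 z.2) mg (g := fun p => (cos p, sin p))).
  by apply: measurable_fun_pair; [exact: measurable_cos|exact: measurable_sin].
have G0 p : (0 <= G p)%E by exact: g0.
have mGD l : measurable_fun setT (fun p : R => G (p + l)).
  by apply: (measurableT_comp mG); exact: measurable_funD.
rewrite -(ge0_integral_periodic (g := G) (l := - (pi / 2)))//; last 2 first.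
- by rewrite normrN ger0_norm; lra.
- by move=> p; rewrite /G mulr_natl cosD2pi sinD2pi.
rewrite (@ge0_integral_itv_split _ _ pi)//; [|lra|lra].
rewrite (ge0_integral_shift (- (pi / 2)) (f := G))//; last lra.
have -> : (\int[mu]_(u in `[pi, (2 * pi)%R]) G (u - pi / 2)%R =
    \int[mu]_(u in `[0%R, pi]) G (u + pi / 2)%R)%E.
  rewrite [RHS](ge0_integral_shift (pi / 2) (f := G))//; last lra.
  rewrite (ge0_integral_shift (- (pi / 2)) (f := G))//; last lra.
  rewrite (_ : pi - pi / 2 = 0 + pi / 2 :> R); last lra.
  by rewrite (_ : 2 * pi - pi / 2 = pi + pi / 2 :> R); last lra.
have -> : (\int[mu]_(u in `[0%R, pi]) G (u + pi / 2)%R =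
    \int[mu]_(u in `[(- (pi / 2))%R, (pi / 2)%R]) G (u + pi)%R)%E.
  transitivity (\int[mu]_(u in `[0%R, pi]) G (u + - (pi / 2) + pi)%R)%E.
    by apply: eq_integral => u _; congr G; lra.
  rewrite (ge0_integral_shift (- (pi / 2)) (f := fun u => G (u + pi)))//; last lra.
  rewrite (_ : 0 - pi / 2 = - (pi / 2) :> R); last lra.
  by rewrite (_ : pi - pi / 2 = pi / 2 :> R); last lra.
rewrite (_ : 0 + - (pi / 2) = - (pi / 2)); last lra.
rewrite (_ : pi + - (pi / 2) = pi / 2 :> R); last lra.
rewrite -ge0_integralD//; [|exact: measurable_funTS|by apply: measurable_funTS; exact: mGD].
rewrite integral_itv_bndoo; last by apply: measurable_funTS; exact: emeasurable_funD.
rewrite ge0_integral_atan; last 2 first.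
- by apply: emeasurable_funD => //; exact: mGD.
- by move=> u; rewrite adde_ge0.
apply: eq_integral => m _; rewrite /G cosDpi sinDpi cos_atan sin_atan.
by [].
Qed.

Lemma radial_weight_ge0 (x a : R) : 0 <= 4 * `|x| / a ^+ 2.
Proof. by rewrite divr_ge0 ?sqr_ge0// mulr_ge0. Qed.

Lemma stereo_radius (m x : R) : 0 < x ->
  let c := 1 - 2 / (1 + (1 + m ^+ 2) * x ^+ 2) in
  Num.sqrt (1 - c ^+ 2) / (1 - c) = Num.sqrt (1 + m ^+ 2) * x.
Proof.
move=> x0 /=; have s0 := sqrt1D_gt0 m.
have k0 : 0 < 1 + m ^+ 2 by rewrite ltr_pwDl// sqr_ge0.
have s2 : Num.sqrt (1 + m ^+ 2) ^+ 2 = 1 + m ^+ 2 by rewrite sqr_sqrtr// ltW.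
move: (Num.sqrt (1 + m ^+ 2)) s0 s2 => s s0 s2; rewrite -{}s2 in k0 *.
have q0 : 0 < 1 + s ^+ 2 * x ^+ 2 by rewrite ltr_pwDl// mulr_ge0 ?sqr_ge0.
have q1 := gt_eqF q0.
have -> : 1 - (1 - 2 / (1 + s ^+ 2 * x ^+ 2)) ^+ 2 = (2 * s * x / (1 + s ^+ 2 * x ^+ 2)) ^+ 2.
  by field; apply: lt0r_neq0; nra.
rewrite sqrtr_sqr ger0_norm; last by rewrite divr_ge0// ?mulr_ge0// ltW.
have -> : 1 - (1 - 2 / (1 + s ^+ 2 * x ^+ 2)) = 2 / (1 + s ^+ 2 * x ^+ 2) by ring.
by field; apply: lt0r_neq0; nra.
Qed.

(** Projection from the north pole. The pole itself goes to the origin, since division by 0 gives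
    0. *)
Definition stereo (x : R3 R) : R * R := (x.1.1 / (1 - x.2), x.1.2 / (1 - x.2)).

Lemma measurable_stereo : measurable_fun setT stereo.
Proof. by apply: measurable_fun_pair; meas. Qed.

(** Three one-dimensional substitutions: the longitude becomes a slope [m]; for fixed [m] the height
    becomes the abscissa [x]; for fixed [x] the slope becomes the ordinate [x * m]. The function
    [f2] folds the half-plane of negative abscissae onto the other one. *)
Lemma integral_sigma_stereo (f : R -> R -> \bar R) :
  measurable_fun setT (fun z : R * R => f z.1 z.2) -> (forall a b, 0 <= f a b)%E ->
  (\int[sigma]_x f (stereo x).1 (stereo x).2 =
   \int[mu]_a \int[mu]_b (f a b * ((pi * (1 + a ^+ 2 + b ^+ 2) ^+ 2)^-1)%:E))%E.
Proof.
move=> mf f0; have pi0 := pi_gt0 R.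
have mfc d (T : measurableType d) (a b : T -> R) : measurable_fun setT a ->
    measurable_fun setT b -> measurable_fun setT (fun t => f (a t) (b t)).
  move=> ma mb; apply: (measurableT_comp (f := fun z : R * R => f z.1 z.2) mf (g := fun t => (a t, b t))).
  exact: measurable_fun_pair.
pose f2 a b := (f a b + f (- a)%R (- b)%R)%E.
have f20 a b : (0 <= f2 a b)%E by rewrite adde_ge0.
have mf2 d (T : measurableType d) (a b : T -> R) : measurable_fun setT a ->
    measurable_fun setT b -> measurable_fun setT (fun t => f2 (a t) (b t)).
  move=> ma mb; apply: emeasurable_funD; apply: mfc => //; exact: measurableT_comp.
pose rho (c : R) := Num.sqrt (1 - c ^+ 2) / (1 - c).
have mrho : measurable_fun setT rho by rewrite /rho; meas.
have ms := @measurable_stereo.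
rewrite (integral_sigma (f := fun x => f (stereo x).1 (stereo x).2))//; last first.
  by apply: mfc; meas.
have -> : (\int[mu]_(c in `[(-1)%R, 1%R])
     \int[mu]_(p in `[0%R, (2 * pi)%R]) f (stereo (sph (c, p))).1 (stereo (sph (c, p))).2 =
   \int[mu]_(c in `[(-1)%R, 1%R[) \int[mu]_m
      (f2 (rho c / Num.sqrt (1 + m ^+ 2))%R (rho c * (m / Num.sqrt (1 + m ^+ 2)))%R *
       ((1 + m ^+ 2)^-1)%:E))%E.
  transitivity (\int[mu]_(c in `[(-1)%R, 1%R]) \int[mu]_m
      (f2 (rho c / Num.sqrt (1 + m ^+ 2))%R (rho c * (m / Num.sqrt (1 + m ^+ 2)))%R *
       ((1 + m ^+ 2)^-1)%:E))%E.
    apply: eq_integral => c _.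
    transitivity (\int[mu]_(p in `[0%R, (2 * pi)%R]) f (rho c * cos p)%R (rho c * sin p)%R)%E.
      by apply: eq_integral => p _; rewrite /stereo /sph/= /rho ![_ * _ / _]mulrAC.
    rewrite (ge0_integral_half_circles (g := fun a b => f (rho c * a) (rho c * b)))//; last first.
      by apply: mfc; meas.
    by apply: eq_integral => m _; rewrite /f2 !mulrN.
  apply/esym; rewrite integral_itv_bndo_bndc//.
  apply: measurable_funTS.
  apply: (measurable_integral_in mu (F := fun c m =>
      (f2 (rho c / Num.sqrt (1 + m ^+ 2))%R (rho c * (m / Num.sqrt (1 + m ^+ 2)))%R *
       ((1 + m ^+ 2)^-1)%:E)%E)) => //.
    apply: emeasurable_funM; last by meas.
    by apply: mf2; meas; apply: (measurableT_comp mrho); meas.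
  by move=> c m; rewrite mule_ge0// lee_fin invr_ge0 addr_ge0// sqr_ge0.
rewrite tonelli_in//; last 2 first.
- apply: emeasurable_funM; last by meas.
  by apply: mf2; meas; apply: (measurableT_comp mrho); meas.
- by move=> c m; rewrite mule_ge0// lee_fin invr_ge0 addr_ge0// sqr_ge0.
(* Writing [|x|] for the positive abscissa keeps the weight nonnegative on the whole line, as
   [tonelli_in] demands. *)
have -> : (\int[mu]_m \int[mu]_(c in `[(-1)%R, 1%R[)
      (f2 (rho c / Num.sqrt (1 + m ^+ 2))%R (rho c * (m / Num.sqrt (1 + m ^+ 2)))%R *
       ((1 + m ^+ 2)^-1)%:E) =
   \int[mu]_m \int[mu]_(x in `]0%R, +oo[)
      (f2 x (x * m)%R * (4 * `|x| / (1 + x ^+ 2 + (x * m) ^+ 2) ^+ 2)%:E))%E.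
  apply: eq_integral => m _.
  have k0 : 0 < 1 + m ^+ 2 by rewrite ltr_pwDl// sqr_ge0.
  rewrite (ge0_integral_radial k0); last 2 first.
  - apply: emeasurable_funM; last by meas.
    by apply: mf2; meas.
  - by move=> c; rewrite mule_ge0// lee_fin invr_ge0 ltW.
  rewrite -(integral_itv_obnd_cbnd (b := +oo%O)); last first.
    apply: measurable_funTS; apply: emeasurable_funM; last by meas.
    apply: emeasurable_funM; last by meas.
    by apply: mf2; meas; apply: (measurableT_comp mrho); meas.
  apply: eq_integral => x /[!inE]/=; rewrite in_itv/= andbT => x0.
  have q0 : 0 < 1 + (1 + m ^+ 2) * x ^+ 2 by rewrite ltr_pwDl// mulr_ge0 ?sqr_ge0// ltW.
  have s0 := sqrt1D_gt0 m.
  have s2 : Num.sqrt (1 + m ^+ 2) ^+ 2 = 1 + m ^+ 2 by rewrite sqr_sqrtr// ltW.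
  have rhoE : rho (1 - 2 / (1 + (1 + m ^+ 2) * x ^+ 2)) = Num.sqrt (1 + m ^+ 2) * x.
    exact: stereo_radius.
  rewrite rhoE -muleA -EFinM (gtr0_norm x0).
  congr (f2 _ _ * _%:E)%E.
  - by field; rewrite gt_eqF.
  - by field; rewrite gt_eqF.
  - by field; rewrite !gt_eqF//; nra.
rewrite -tonelli_in//; last 2 first.
- apply: emeasurable_funM; first by apply: mf2; meas.
  meas; apply: measurableT_comp => //; meas.
- by move=> x m; rewrite mule_ge0// lee_fin radial_weight_ge0.
pose w (a b : R) := (pi * (1 + a ^+ 2 + b ^+ 2) ^+ 2)^-1.
have w0 a b : 0 <= w a b by rewrite invr_ge0 mulr_ge0 ?sqr_ge0// ltW.
have mw : measurable_fun setT (fun z : R * R => w z.1 z.2) by rewrite /w; meas.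
have mwx x : measurable_fun setT (w x) by rewrite /w; meas.
pose A x := (\int[mu]_y (f x y * (w x y)%:E))%E.
have A0 x : (0 <= A x)%E by apply: integral_ge0 => y _; rewrite mule_ge0// lee_fin.
have mA : measurable_fun setT A.
  apply: (measurable_integral_in mu (F := fun x y => (f x y * (w x y)%:E)%E)) => //.
    by apply: emeasurable_funM => //; exact/measurable_EFinP.
  by move=> x y; rewrite mule_ge0// lee_fin.
have mAN : measurable_fun setT (fun x : R => A (- x)) by apply: measurableT_comp.
have ANE (x : R) : A (- x) = (\int[mu]_y (f (- x)%R (- y)%R * (w x y)%:E))%E.
  rewrite /A ge0_integral_opp; last 2 first.
  - by apply: emeasurable_funM; [apply: mfc; meas|exact/measurable_EFinP].
  - by move=> y; rewrite mule_ge0// lee_fin.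
  by apply: eq_integral => y _; rewrite /w !sqrrN.
have mN : measurable_fun setT (fun t : R => - t) by meas.
have mfw (a b : R -> R) x : measurable_fun setT a -> measurable_fun setT b ->
    measurable_fun setT (fun y : R => (f (a y) (b y) * (w x y)%:E)%E).
  by move=> ma mb; apply: emeasurable_funM; [exact: mfc|apply/measurable_EFinP; exact: mwx].
have key (x : R) : 0 < x -> (((4 * pi)^-1)%:E * \int[mu]_y
     (f2 x (x * y)%R * (4 * `|x| / (1 + x ^+ 2 + (x * y) ^+ 2) ^+ 2)%:E) = A x + A (- x)%R)%E.
  move=> x0.
  rewrite ANE /A -ge0_integralD//; last 4 first.
  - by move=> y _; rewrite mule_ge0// lee_fin.
  - exact: (mfw (fun=> x) (fun y => y)).
  - by move=> y _; rewrite mule_ge0// lee_fin.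
  - exact: (mfw (fun=> - x) (fun y => - y)).
  rewrite [RHS](ge0_integral_affine (k := x) 0)//; last 2 first.
  - apply: emeasurable_funD; first exact: (mfw (fun=> x) (fun y => y)).
    exact: (mfw (fun=> - x) (fun y => - y)).
  - by move=> y; rewrite adde_ge0// mule_ge0// lee_fin.
  rewrite -ge0_integralZl//; last 3 first.
  - apply: emeasurable_funM; first by apply: mf2; meas.
    by meas.
  - by move=> m _; rewrite mule_ge0// lee_fin radial_weight_ge0.
  - by rewrite lee_fin invr_ge0 mulr_ge0// ltW.
  apply: eq_integral => m _; rewrite addr0 -ge0_muleDl// -/(f2 x (x * m)).
  rewrite muleCA -muleA -!EFinM; congr (_ * _%:E)%E.
  rewrite /w (gtr0_norm x0); move: (pi : R) pi0 => q q0.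
  have q1 : 0 < 1 + x ^+ 2 + (x * m) ^+ 2.
    by rewrite -addrA ltr_pwDl// addr_ge0// sqr_ge0.
  by field; rewrite !gt_eqF.
transitivity (\int[mu]_(x in `]0%R, +oo[) (A x + A (- x)%R))%E.
  rewrite -ge0_integralZl//; last 3 first.
  - apply: measurable_funTS; apply: measurable_integral_in => //.
      apply: emeasurable_funM; first by apply: mf2; meas.
      by meas; apply: measurableT_comp => //; meas.
    by move=> x m; rewrite mule_ge0// lee_fin radial_weight_ge0.
  - move=> x _; apply: integral_ge0 => m _.
    by rewrite mule_ge0// lee_fin radial_weight_ge0.
  - by rewrite lee_fin invr_ge0 mulr_ge0// ltW.
  apply: eq_integral => x /[!inE]/=; rewrite in_itv/= andbT => x0.
  exact: key.
have mo : measurable_fun (`]0%R, +oo[%classic : set R) A by exact: measurable_funTS.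
rewrite ge0_integralD//; last exact: measurable_funTS.
rewrite [X in (_ + X)%E](integral_itv_obnd_cbnd (b := +oo%O)); last exact: measurable_funTS.
rewrite (ge0_integration_by_substitution0 mAN)//.
under [X in (_ + X)%E]eq_integral do rewrite opprK.
rewrite addeC -ge0_integral_setU//.
- rewrite -/A (_ : (`]-oo, 0%R] `|` `]0%R, +oo[)%classic = setT)//.
  by rewrite -(@itv_bndbnd_setU _ _ _ (BRight (0 : R)))//; apply/seteqP; split.
- exact: measurable_funTS.
- by apply/disj_setPS => u/= []; rewrite !in_itv/= andbT => ? ?; lra.
Qed.

End Planar.

(** * The projected point as a mixture of Gaussians *)

Section GaussMixture.
Context {R : realType}.
Local Notation mu := (@lebesgue_measure R).

Lemma integral_gauss_affine (k l : R) : 0 < k ->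
  (\int[mu]_x (expR (- (k * (x + l) ^+ 2)))%:E = (Num.sqrt (pi / k))%:E)%E.
Proof.
move=> k0; have sk0 : 0 < Num.sqrt k by rewrite sqrtr_gt0.
have := @integralT_gauss R.
rewrite (ge0_integral_affine (k := Num.sqrt k) (Num.sqrt k * l))//; last 2 first.
- by apply/measurable_EFinP; exact: measurable_gauss_fun.
- by move=> u; rewrite lee_fin gauss_fun_ge0.
rewrite ge0_integralZr; first last.
- by rewrite lee_fin ltW.
- by move=> u _; rewrite lee_fin gauss_fun_ge0.
- by apply/measurable_EFinP; apply: (measurableT_comp (@measurable_gauss_fun R)); meas.
- by [].
move=> e; have -> : (\int[mu]_x (expR (- (k * (x + l) ^+ 2)))%:E =
    \int[mu]_u (gauss_fun (Num.sqrt k * u + Num.sqrt k * l))%:E)%E.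
  apply: eq_integral => x _; rewrite /gauss_fun -mulrDr exprMn sqr_sqrtr// ltW//.
rewrite sqrtrM ?pi_ge0// sqrtrV ?(ltW k0)// EFinM -e -muleA -EFinM mulfV ?mule1//.
by rewrite gt_eqF.
Qed.

Lemma integral_gauss_conv (s b v : R) : 0 < s -> 0 < b ->
  (\int[mu]_x (expR (- (s * x ^+ 2)) * expR (- ((v + x) ^+ 2 / b)))%:E =
   (Num.sqrt (pi * b / (1 + s * b)) * expR (- (v ^+ 2 * s / (1 + s * b))))%:E)%E.
Proof.
move=> s0 b0; have q0 : 0 < 1 + s * b by rewrite ltr_pwDl// mulr_ge0// ltW.
have -> : pi * b / (1 + s * b) = pi / ((1 + s * b) / b) :> R.
  by move: (pi : R) => q; field; rewrite !gt_eqF.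
have k0 : 0 < (1 + s * b) / b by rewrite divr_gt0.
rewrite EFinM -(integral_gauss_affine (v / (1 + s * b)) k0) -ge0_integralZr; first last.
- by rewrite lee_fin expR_ge0.
- by move=> x _; rewrite lee_fin expR_ge0.
- by meas.
- by [].
apply: eq_integral => x _; rewrite -EFinM -!expRD; congr (expR _)%:E.
by field; rewrite !gt_eqF.
Qed.

(** Density of the centred isotropic Gaussian law of the plane with variance [b / 2] in each
    coordinate. *)
Definition gauss2 (b v1 v2 : R) : R := expR (- ((v1 ^+ 2 + v2 ^+ 2) / b)) / (pi * b).

Lemma gauss2_ge0 b v1 v2 : 0 < b -> 0 <= gauss2 b v1 v2.
Proof. by move=> b0; rewrite divr_ge0 ?expR_ge0// mulr_ge0 ?pi_ge0// ltW. Qed.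

Lemma gauss2_le b v1 v2 : 0 < b -> gauss2 b v1 v2 <= (pi * b)^-1.
Proof.
move=> b0; rewrite /gauss2 ler_piMl//; first by rewrite invr_ge0 mulr_ge0 ?pi_ge0// ltW.
by rewrite -expR0 ler_expR oppr_le0 divr_ge0 ?addr_ge0 ?sqr_ge0// ltW.
Qed.

Lemma measurable_gauss2 d (T : measurableType d) (b v1 v2 : T -> R) :
  measurable_fun setT b -> measurable_fun setT v1 -> measurable_fun setT v2 ->
  measurable_fun setT (fun t => gauss2 (b t) (v1 t) (v2 t)).
Proof. by move=> mb m1 m2; rewrite /gauss2; meas. Qed.

(** The first factor is [pi / s] times the Gaussian density of parameter [s^-1], and parameters add
    under convolution. *)
Lemma integral_gauss2_conv (s b v1 v2 : R) : 0 < s -> 0 < b ->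
  (\int[mu]_x \int[mu]_y
     (expR (- (s * (x ^+ 2 + y ^+ 2))) * gauss2 b (v1 + x) (v2 + y))%:E =
   (pi / s * gauss2 (b + s^-1) v1 v2)%:E)%E.
Proof.
move=> s0 b0; have q0 : 0 < 1 + s * b by rewrite ltr_pwDl// mulr_ge0// ltW.
have pi0 := pi_gt0 R.
pose e (v x : R) := expR (- (s * x ^+ 2)) * expR (- ((v + x) ^+ 2 / b)).
have e0 v x : 0 <= e v x by rewrite mulr_ge0 ?expR_ge0.
have me v : measurable_fun setT (e v) by rewrite /e; meas.
transitivity (\int[mu]_x \int[mu]_y (((pi * b)^-1 * e v1 x)%:E * (e v2 y)%:E))%E.
  apply: eq_integral => x _; apply: eq_integral => y _; rewrite -EFinM; congr EFin.
  rewrite /e /gauss2 mulrA -expRD mulrC -!mulrA; congr (_ * _).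
  by rewrite -!expRD; congr expR; field; rewrite gt_eqF.
have c0 : 0 <= (pi * b)^-1 by rewrite invr_ge0 mulr_ge0// ltW.
have mE v : measurable_fun setT (fun x : R => (e v x)%:E) by apply/measurable_EFinP.
have mE1 : measurable_fun setT (fun x : R => ((pi * b)^-1 * e v1 x)%:E).
  by apply/measurable_EFinP; exact: measurable_funM.
transitivity (\int[mu]_x (((pi * b)^-1 * e v1 x)%:E * \int[mu]_y (e v2 y)%:E))%E.
  apply: eq_integral => x _; rewrite ge0_integralZl //.
  - exact: mE.
  - by move=> y _; rewrite lee_fin.
  - by rewrite lee_fin mulr_ge0.
have ic v : (\int[mu]_x (e v x)%:E = (Num.sqrt (pi * b / (1 + s * b)) *
    expR (- (v ^+ 2 * s / (1 + s * b))))%:E)%E := integral_gauss_conv v s0 b0.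
rewrite (ic v2) ge0_integralZr; first last.
- by rewrite lee_fin mulr_ge0 ?expR_ge0// sqrtr_ge0.
- by move=> x _; rewrite lee_fin mulr_ge0.
- exact: mE1.
- by [].
transitivity ((((pi * b)^-1)%:E * \int[mu]_x (e v1 x)%:E) *
    (Num.sqrt (pi * b / (1 + s * b)) * expR (- (v2 ^+ 2 * s / (1 + s * b))))%:E)%E.
  congr (_ * _)%E; rewrite -ge0_integralZl //; first exact: mE.
  by move=> x _; rewrite lee_fin.
rewrite (ic v1) -!EFinM; congr EFin.
set S := Num.sqrt _; have S2 : S ^+ 2 = pi * b / (1 + s * b).
  by rewrite sqr_sqrtr// divr_ge0 ?mulr_ge0// ltW.
have e3 (c A B : R) : c * (S * A) * (S * B) = c * S ^+ 2 * (A * B) by ring.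
rewrite e3 S2 {e3}.
rewrite -expRD /gauss2.
have -> : - (v1 ^+ 2 * s / (1 + s * b)) + - (v2 ^+ 2 * s / (1 + s * b)) =
    - ((v1 ^+ 2 + v2 ^+ 2) / (b + s^-1)).
  by field; rewrite !gt_eqF//; nra.
move: (pi : R) pi0 => p p0; move: (expR _) => E.
by field; rewrite !gt_eqF//; nra.
Qed.

(** With [q = 1 + |w|^2] this writes the stereographic density, up to the factor [pi^-1], as an
    integral of Gaussian functions of [w]. *)
Lemma integral_gamma2 (q : R) : 0 < q ->
  (\int[mu]_(s in `]0%R, +oo[) (s * expR (- (s * q)))%:E = ((q ^+ 2)^-1)%:E)%E.
Proof.
move=> q0.
rewrite (@integral_itv_obnd_cbnd _ 0 +oo%O); last by apply: measurable_funTS; meas.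
pose F (s : R) := - ((s / q + q ^- 2) * expR (- (s * q))).
have dF (s : R) : is_derive s 1 F (s * expR (- (s * q))).
  rewrite /F; apply: is_derive_eq; rewrite /GRing.scale/= ; field; exact: lt0r_neq0.
rewrite (@ge0_continuous_FTC2y R (fun s => s * expR (- (s * q))) F 0 0).
- by rewrite -[LHS]/((0 - F 0)%:E) /F !mul0r !add0r oppr0 expR0 mulr1 opprK.
- by move=> s s0; rewrite mulr_ge0// expR_ge0.
- have ce : continuous (fun s : R => expR (- (s * q))).
    move=> s; apply: (@continuous_comp R R R (fun s => - (s * q)) expR); last exact: continuous_expR.
    by apply: cvgN; apply: cvgM; [exact: cvg_id|exact: cvg_cst].
  by apply: continuous_subspaceT => s; apply: cvgM; [exact: cvg_id|exact: ce].
- apply/cvgr0Pnorm_le => e e0; near=> s.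
  have s0 : 0 < s by near: s; exact: nbhs_pinfty_gt.
  have s1 : 4 / (q ^+ 3 * e) <= s by near: s; apply: nbhs_pinfty_ge; rewrite num_real.
  (* A quadratic minorant of the exponential beats the linear factor of [F]. *)
  have h : (1 + s * q / 2) ^+ 2 <= expR (s * q).
    have -> : expR (s * q) = expR (s * q / 2) ^+ 2.
      by rewrite -expRM_natl; congr expR; field.
    rewrite lerXn2r ?nnegrE ?expR_ge0 ?expR_ge1Dx// addr_ge0// divr_ge0// mulr_ge0// ltW//.
  rewrite /F normrN ger0_norm; last first.
    by rewrite mulr_ge0 ?expR_ge0// addr_ge0 ?divr_ge0 ?invr_ge0 ?exprn_ge0// ltW.
  rewrite expRN ler_pdivrMr ?expR_gt0//; apply: le_trans (ler_wpM2l (ltW e0) h).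
  move: s1; rewrite ler_pdivrMr ?mulr_gt0 ?exprn_gt0// => s1.
  rewrite -(ler_pM2r (x := q ^+ 3)) ?exprn_gt0//.
  have -> : (s / q + q ^- 2) * q ^+ 3 = s * q ^+ 2 + q by field; exact: lt0r_neq0.
  have sq : 0 < s * q by rewrite mulr_gt0.
  nra.
- by move=> s _; have [] := dF s.
- apply/cvg_at_right_filter; apply: differentiable_continuous.
  by apply/derivable1_diffP; have [] := dF 0.
- by move=> s _; rewrite derive1E; have [_] := dF s.
Unshelve. all: by end_near. Qed.

(** Given an exponential variable [s] of rate 1, the projected point is Gaussian of parameter
    [s^-1]; adding it raises [b] to [b + s^-1]. *)
Lemma integral_sigma_gauss2 (b v1 v2 : R) : 0 < b ->
  (\int[sigma]_x (gauss2 b (v1 + (stereo x).1) (v2 + (stereo x).2))%:E =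
   \int[mu]_(s in `]0%R, +oo[) (expR (- s) * gauss2 (b + s^-1) v1 v2)%:E)%E.
Proof.
move=> b0; have pi0 := pi_gt0 R.
have mg d (T : measurableType d) (h1 h2 : T -> R) : measurable_fun setT h1 ->
    measurable_fun setT h2 -> measurable_fun setT (fun t => gauss2 b (v1 + h1 t) (v2 + h2 t)).
  by move=> m1 m2; apply: measurable_gauss2; meas.
rewrite (integral_sigma_stereo (f := fun x y => (gauss2 b (v1 + x) (v2 + y))%:E)); last 2 first.
- by apply/measurable_EFinP; apply: mg; meas.
- by move=> x y; rewrite lee_fin gauss2_ge0.
pose F (x y s : R) := gauss2 b (v1 + x) (v2 + y) * (pi^-1 * (`|s| * expR (- (s * (1 + x ^+ 2 + y ^+ 2))))).
have F0 x y s : 0 <= F x y s by rewrite mulr_ge0 ?gauss2_ge0// mulr_ge0 ?invr_ge0 ?mulr_ge0 ?expR_ge0// ltW.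
have mF d (T : measurableType d) (h1 h2 h3 : T -> R) : measurable_fun setT h1 ->
    measurable_fun setT h2 -> measurable_fun setT h3 ->
    measurable_fun setT (fun t => F (h1 t) (h2 t) (h3 t)).
  move=> m1 m2 m3; rewrite /F; apply: measurable_funM; first exact: mg.
  by meas.
transitivity (\int[mu]_x \int[mu]_y \int[mu]_(s in `]0%R, +oo[) (F x y s)%:E)%E.
  apply: eq_integral => x _; apply: eq_integral => y _.
  have q0 : 0 < 1 + x ^+ 2 + y ^+ 2 by rewrite -addrA ltr_pwDl// addr_ge0 ?sqr_ge0.
  rewrite (_ : ((pi * (1 + x ^+ 2 + y ^+ 2) ^+ 2)^-1)%:E =
    (pi^-1)%:E * (((1 + x ^+ 2 + y ^+ 2) ^+ 2)^-1)%:E)%E; last by rewrite invfM EFinM.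
  rewrite -(integral_gamma2 q0) -!ge0_integralZl//.
  - apply: eq_integral => s /[!inE]/=; rewrite in_itv/= andbT => s0.
    by rewrite /F gtr0_norm// -!EFinM.
  - by apply: measurable_funTS; meas.
  - by move=> s /=; rewrite in_itv/= andbT => s0; rewrite -EFinM lee_fin mulr_ge0 ?invr_ge0 ?mulr_ge0 ?expR_ge0// ltW.
  - by rewrite lee_fin gauss2_ge0.
  - by apply: measurable_funTS; meas.
  - by move=> s /=; rewrite in_itv/= andbT => s0; rewrite lee_fin mulr_ge0 ?expR_ge0// ltW.
  - by rewrite lee_fin invr_ge0 ltW.
under eq_integral => x _.
  rewrite (@tonelli_in _ _ _ _ _ mu mu setT (`]0%R, +oo[%classic : set R) (fun y s => (F x y s)%:E))//; last 2 first.
  - by apply/measurable_EFinP; apply: (mF _ _ (fun=> x)); meas.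
  - by move=> y s; rewrite lee_fin.
  over.
rewrite (@tonelli_in _ _ _ _ _ mu mu setT (`]0%R, +oo[%classic : set R) (fun x s => \int[mu]_y (F x y s)%:E)%E)//; last 2 first.
- apply: (@measurable_integral_in _ _ _ _ _ mu setT (fun (z : R * R) y => (F z.1 y z.2)%:E)) => //.
  - by apply/measurable_EFinP; apply: mF; meas.
  - by move=> z y; rewrite lee_fin.
- by move=> x y; apply: integral_ge0 => z _; rewrite lee_fin.
apply: eq_integral => s /[!inE]/=; rewrite in_itv/= andbT => s0.
have c0 : 0 <= pi^-1 * s * expR (- s).
  by rewrite !mulr_ge0 ?invr_ge0 ?expR_ge0// ltW.
transitivity (\int[mu]_x \int[mu]_y ((pi^-1 * s * expR (- s))%:E *
    (expR (- (s * (x ^+ 2 + y ^+ 2))) * gauss2 b (v1 + x) (v2 + y))%:E))%E.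
  apply: eq_integral => x _; apply: eq_integral => y _; rewrite -EFinM; congr EFin.
  rewrite /F (gtr0_norm s0) (_ : - (s * (1 + x ^+ 2 + y ^+ 2)) = - s + - (s * (x ^+ 2 + y ^+ 2))).
    by rewrite expRD; ring.
  by ring.
have mk : measurable_fun setT (fun z : R * R => expR (- (s * (z.1 ^+ 2 + z.2 ^+ 2))) * gauss2 b (v1 + z.1) (v2 + z.2)).
  by apply: measurable_funM; [meas|apply: mg; meas].
have k0 (x y : R) : 0 <= expR (- (s * (x ^+ 2 + y ^+ 2))) * gauss2 b (v1 + x) (v2 + y).
  by rewrite mulr_ge0 ?expR_ge0 ?gauss2_ge0.
under eq_integral => x _.
  rewrite ge0_integralZl//; last 2 first.
  - apply/measurable_EFinP; apply: (measurableT_comp mk (g := fun y => (x, y))); meas.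
  - by move=> y _; rewrite lee_fin.
  over.
rewrite ge0_integralZl//; last 2 first.
- apply: (@measurable_integral_in _ _ _ _ _ mu setT (fun x y : R => (expR (- (s * (x ^+ 2 + y ^+ 2))) * gauss2 b (v1 + x) (v2 + y))%:E)) => //.
  by apply/measurable_EFinP.
- by move=> x _; apply: integral_ge0 => y _; rewrite lee_fin.
rewrite integral_gauss2_conv// -EFinM; congr EFin.
move: (pi : R) pi0 (gauss2 _ _ _) => p p0 g; field.
by rewrite !gt_eqF.
Qed.

End GaussMixture.

(** * The law [uniform_sphere] as a rescaling of [sigma] *)

Section Law.
Context {R : realType}.
Local Notation mu := (@lebesgue_measure R).

Definition scale (r : R) (x : R3 R) : R3 R := (r * x.1.1, r * x.1.2, r * x.2).

Lemma measurable_scale r : measurable_fun setT (scale r).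
Proof. by apply: measurable_R3; meas. Qed.

Lemma sphere_radius_gt0 n : (0 < n)%N -> 0 < @sphere_radius R n.
Proof. by move=> n0; rewrite sqrtr_gt0 divr_gt0 ?ltr0n// mulr_gt0// pi_gt0. Qed.

(** The substitution [c = cos t] passes from colatitude to height, and the squared radius
    [n / (4 * pi)] divided by [n] is the normalizing factor of [sigma]. *)
Lemma uniform_sphereE n (A : set (R3 R)) : (0 < n)%N -> measurable A ->
  @uniform_sphere R n A = sigma (scale (@sphere_radius R n) @^-1` A).
Proof.
move=> n0 mA; have pi0 := pi_gt0 R; set r := @sphere_radius R n.
have n0' : 0 < n%:R :> R by rewrite ltr0n.
have r2 : r ^+ 2 = n%:R / (4 * pi) by rewrite sqr_sqrtr// divr_ge0// mulr_ge0// ltW.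
have mB : measurable (scale r @^-1` A).
  by rewrite -[X in measurable X]setTI; exact: measurable_scale.
rewrite -[X in sigma X]setIT -integral_indic//.
pose I (c : R) := (\int[mu]_(p in `[0%R, (2 * pi)%R]) (\1_A (scale r (sph (c, p))))%:E)%E.
have mind : measurable_fun setT (fun u : R * R => (\1_A (scale r (sph u)))%:E : \bar R).
  apply/measurable_EFinP; apply: (measurableT_comp (measurable_indic mA)).
  exact: measurableT_comp (measurable_scale r) measurable_sph.
have mI : measurable_fun setT I.
  apply: (@measurable_integral_in _ _ _ _ _ mu _ (fun c p => (\1_A (scale r (sph (c, p))))%:E)) => //.
have I0 c : (0 <= I c)%E by apply: integral_ge0 => p _; rewrite lee_fin.
rewrite (integral_sigma (f := fun x => (\1_(scale r @^-1` A) x)%:E))//; last first.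
- exact/measurable_EFinP/measurable_indic.
rewrite -[X in (_ = _ * X)%E]/(\int[mu]_(c in `[(-1)%R, 1%R]) I c)%E.
rewrite (ge0_integral_cos mI I0) /uniform_sphere /surface_area -/r.
transitivity (((r ^+ 2)%:E * \int[mu]_(t in `[0%R, pi]) (I (cos t) * (sin t)%:E)) * (n%:R^-1)%:E)%E; last first.
  rewrite muleAC -EFinM r2; congr (_%:E * _)%E.
  by move: (pi : R) pi0 => p p0; field; rewrite !gt_eqF.
congr (_ * _)%E; rewrite -ge0_integralZl//; last 3 first.
- apply: measurable_funTS; apply: emeasurable_funM.
    by apply: (measurableT_comp mI); exact: measurable_cos.
  by apply/measurable_EFinP; exact: measurable_sin.
- by move=> t /=; rewrite in_itv/= => t0; rewrite mule_ge0// lee_fin sin_ge0_pi.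
- by rewrite lee_fin sqr_ge0.
apply: eq_integral => t /[!inE]/=; rewrite in_itv/= => t0.
have s0 := sin_ge0_pi t0.
rewrite (muleC (I _)) muleA -EFinM /I.
rewrite -[RHS]ge0_integralZl; first last.
- by rewrite lee_fin mulr_ge0// sqr_ge0.
- by move=> p _; rewrite lee_fin.
- by apply: measurable_funTS; apply: (measurableT_comp mind (g := fun p => (cos t, p))); exact: measurable_fun_pair.
- by [].
apply: eq_integral => p _; rewrite -EFinM /sph/= -sin2cos2 sqrtr_sqr ger0_norm//.
by rewrite /scale /spherical/= !mulrA.
Qed.

End Law.

(** * Independence *)

Section IndependentPair.
Local Open Scope ereal_scope.
Context d d1 d2 (T : measurableType d) (T1 : measurableType d1)
  (T2 : measurableType d2) (R : realType) (P : probability T R).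
Variables (Y : T -> T1) (Z : T -> T2).
Hypotheses (mY : measurable_fun setT Y) (mZ : measurable_fun setT Z).
Hypothesis YZ : forall A B, measurable A -> measurable B ->
  P (Y @^-1` A `&` Z @^-1` B) = P (Y @^-1` A) * P (Z @^-1` B).

(** Independence makes the joint law a product measure, to which Tonelli's theorem applies. *)
Lemma ge0_integral_indep (f : T1 * T2 -> \bar R) :
  measurable_fun setT f -> (forall x, 0 <= f x) ->
  \int[P]_w f (Y w, Z w) = \int[P]_w' \int[P]_w f (Y w, Z w').
Proof.
move=> mf f0.
pose Y' : {mfun T >-> T1} := HB.pack Y (isMeasurableFun.Build _ _ T T1 Y mY).
pose Z' : {mfun T >-> T2} := HB.pack Z (isMeasurableFun.Build _ _ T T2 Z mZ).
have mYZ : measurable_fun setT (fun w => (Y w, Z w)) by exact: measurable_fun_pair.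
pose V : {mfun T >-> (T1 * T2)%type} :=
  HB.pack (fun w => (Y w, Z w)) (isMeasurableFun.Build _ _ T (T1 * T2)%type _ mYZ).
pose m1 := distribution P Y'; pose m2 := distribution P Z'.
transitivity (\int[distribution P V]_z f z).
  by rewrite (ge0_integral_distribution V).
transitivity (\int[m1 \x m2]_z f z).
  apply: eq_measure_integral => A mA _; apply/esym.
  by apply: (product_measure_unique (m1 := m1) (m2 := m2)) => // B C mB mC; exact: YZ.
rewrite (fubini_tonelli2 (m1 := m1) (m2 := m2))// /fubini_G.
rewrite (ge0_integral_distribution Z').
- apply: eq_integral => w' _ /=; rewrite (ge0_integral_distribution Y')//.
  by apply: (measurableT_comp mf); exact: measurable_fun_pair.
- exact: (measurable_fun_fubini_tonelli_G (m1 := m1)).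
- by move=> y; exact: integral_ge0.
Qed.

End IndependentPair.

(** * Independence of disjoint groups of coordinates *)

Section IndependentFamily.
Local Open Scope ereal_scope.
Context d d' (T : measurableType d) (T' : measurableType d') (R : realType)
  (P : probability T R) (n : nat).
Implicit Types (X : 'I_n -> T -> T') (r s : seq 'I_n).

Definition indep_family X := forall A : 'I_n -> set T',
  (forall i, measurable (A i)) ->
  P (\bigcap_i (X i @^-1` A i)) = \prod_(i < n) P (X i @^-1` A i).

Variable X : 'I_n -> T -> T'.
Hypotheses (mX : forall i, measurable_fun setT (X i)) (iX : indep_family X).

(** Events that constrain only the coordinates listed in [r]. They form a pi-system, which generates
    the sigma-algebra of these coordinates. *)
Definition cylinders r : set (set T) :=
  [set E | exists A : 'I_n -> set T', [/\ forall i, measurable (A i),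
     forall i, i \notin r -> A i = setT & E = \bigcap_i (X i @^-1` A i)]].

Lemma cylindersI r : setI_closed (cylinders r).
Proof.
move=> _ _ [A [mA Ar ->]] [B [mB Br ->]]; exists (fun i => A i `&` B i); split.
- by move=> i; exact: measurableI.
- by move=> i ir; rewrite Ar// Br// setIT.
- apply/seteqP; split=> [w [Aw Bw] i _|w ABw]; first by split; [exact: Aw|exact: Bw].
  by split=> i _; have [] := ABw i I.
Qed.

Lemma cylindersT r : cylinders r setT.
Proof.
exists (fun=> setT); split => //; apply/seteqP; split => // w _ i _.
Qed.

Lemma measurable_preimageX i A : measurable A -> measurable (X i @^-1` A).
Proof. by move=> mA; rewrite -[X in measurable X]setTI; exact: mX. Qed.

Lemma cylinders_measurable r : cylinders r `<=` measurable.
Proof.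
move=> _ [A [mA _ ->]]; apply: fin_bigcap_measurable => //.
by move=> i _; exact: measurable_preimageX.
Qed.

Lemma cylinders_indep r s E F : (forall i, i \in r -> i \notin s) ->
  cylinders r E -> cylinders s F -> P (E `&` F) = P E * P F.
Proof.
move=> rs [A [mA Ar ->]] [B [mB Bs ->]].
have -> : \bigcap_i (X i @^-1` A i) `&` \bigcap_i (X i @^-1` B i) =
    \bigcap_i (X i @^-1` (A i `&` B i)).
  apply/seteqP; split=> [w [Aw Bw] i _|w ABw]; first by split; [exact: Aw|exact: Bw].
  by split=> i _; have [] := ABw i I.
rewrite !iX//; last by move=> i; exact: measurableI.
rewrite -big_split/=; apply: eq_bigr => i _.
have [ir|ir] := boolP (i \in r).
  by rewrite (Bs _ (rs _ ir)) setIT preimage_setT probability_setT mule1.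
by rewrite (Ar _ ir) setTI preimage_setT probability_setT mul1e.
Qed.

Lemma sigma_cylinders_measurable r : <<s cylinders r >> `<=` measurable.
Proof.
by apply: smallest_sub; [exact: sigma_algebra_measurable|exact: cylinders_measurable].
Qed.

(** Pi-lambda argument: as functions of [E], both sides are finite measures, and they agree on the
    pi-system [G]. *)
Lemma sigma_indep_half (G : set (set T)) F : setI_closed G -> G `<=` measurable ->
  G setT -> measurable F -> (forall E, G E -> P (E `&` F) = P E * P F) ->
  forall E, <<s G >> E -> P (E `&` F) = P E * P F.
Proof.
move=> GI Gm GT mF GF E sE.
have PF : P F \is a fin_num by exact: fin_num_measure.
have PF0 : (0 <= fine (P F))%R by rewrite fine_ge0.
pose m1 := mrestr P mF; pose m2 := mscale (NngNum PF0) P.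
have m12 : m1 E = m2 E.
  apply: (@g_sigma_algebra_measure_unique _ _ _ G Gm (fun=> setT)) => //.
  - by apply/seteqP; split => // x _; exists 0%N.
  - move=> A GA; transitivity (P (A `&` F)); first by [].
    transitivity ((fine (P F))%:E * P A); last by [].
    by rewrite fineK// GF// muleC.
  - move=> _; rewrite /m1 /= /mrestr setTI; exact: le_lt_trans (probability_le1 P mF) (ltry _).
transitivity (m1 E); first by [].
rewrite m12; transitivity ((fine (P F))%:E * P E); first by [].
by rewrite fineK// muleC.
Qed.

Lemma sigma_cylinders_indep r s E F : (forall i, i \in r -> i \notin s) ->
  <<s cylinders r >> E -> <<s cylinders s >> F -> P (E `&` F) = P E * P F.
Proof.
move=> rs sE sF; apply: (sigma_indep_half (@cylindersI r)) sE.
- exact: cylinders_measurable.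
- exact: cylindersT.
- exact: sigma_cylinders_measurable sF.
- move=> {}E cE; rewrite setIC muleC.
  apply: (sigma_indep_half (@cylindersI s)) sF.
  + exact: cylinders_measurable.
  + exact: cylindersT.
  + exact: cylinders_measurable cE.
  + move=> {}F cF; rewrite setIC muleC; exact: cylinders_indep cE cF.
Qed.

Definition measurable_wrt r d1 (T1 : measurableType d1) (Y : T -> T1) :=
  measurable_fun (T := g_sigma_algebraType (cylinders r)) setT Y.

Lemma measurable_wrt_preimage r d1 (T1 : measurableType d1) (Y : T -> T1) B :
  measurable_wrt r Y -> measurable B -> <<s cylinders r >> (Y @^-1` B).
Proof. by move=> mY mB; have := mY measurableT B mB; rewrite setTI. Qed.

Lemma measurable_wrtW r d1 (T1 : measurableType d1) (Y : T -> T1) :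
  measurable_wrt r Y -> measurable_fun setT Y.
Proof.
move=> mY _ B mB; rewrite setTI; apply: (@sigma_cylinders_measurable r).
exact: measurable_wrt_preimage.
Qed.

Lemma measurable_wrt_coord r i : i \in r -> measurable_wrt r (X i).
Proof.
move=> ir _ B mB; rewrite setTI; apply: sub_sigma_algebra.
exists (fun j => if j == i then B else setT); split.
- by move=> j; case: ifP.
- by move=> j jr; case: eqP => // ji; move: jr; rewrite ji ir.
- apply/seteqP; split => [w Bw j _|w /(_ i I)]; last by rewrite /preimage/= eqxx.
  by rewrite /preimage/=; case: eqP => // ->.
Qed.

Lemma ge0_integral_indep_groups r s d1 d2 (T1 : measurableType d1)
    (T2 : measurableType d2) (Y : T -> T1) (Z : T -> T2) (f : T1 * T2 -> \bar R) :
  (forall i, i \in r -> i \notin s) -> measurable_wrt r Y -> measurable_wrt s Z ->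
  measurable_fun setT f -> (forall x, 0 <= f x) ->
  \int[P]_w f (Y w, Z w) = \int[P]_w' \int[P]_w f (Y w, Z w').
Proof.
move=> rs mY mZ; apply: ge0_integral_indep.
- exact: measurable_wrtW mY.
- exact: measurable_wrtW mZ.
- move=> A B mA mB; apply: (@sigma_cylinders_indep r s) => //.
    exact: measurable_wrt_preimage.
  exact: measurable_wrt_preimage.
Qed.

Variable mu : probability T' R.
Hypothesis lawX : forall i A, measurable A -> P (X i @^-1` A) = mu A.

Lemma ge0_integral_law i (f : T' -> \bar R) : measurable_fun setT f ->
  (forall x, 0 <= f x) -> \int[P]_w f (X i w) = \int[mu]_x f x.
Proof.
move=> mf f0.
pose Y : {mfun T >-> T'} := HB.pack (X i) (isMeasurableFun.Build _ _ T T' (X i) (mX i)).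
transitivity (\int[distribution P Y]_x f x).
  by rewrite (ge0_integral_distribution Y).
by apply: eq_measure_integral => A mA _; exact: lawX.
Qed.

Lemma ge0_integral_indep_coord k r d2 (T2 : measurableType d2) (Z : T -> T2)
    (f : T' * T2 -> \bar R) : k \notin r -> measurable_wrt r Z ->
  measurable_fun setT f -> (forall x, 0 <= f x) ->
  \int[P]_w f (X k w, Z w) = \int[P]_w \int[mu]_x f (x, Z w).
Proof.
move=> kr mZ mf f0; rewrite (@ge0_integral_indep_groups [:: k] r)//.
- apply: eq_integral => w _; apply: (ge0_integral_law k (f := fun x => f (x, Z w))) => //.
  by apply: (measurableT_comp mf); exact: measurable_fun_pair.
- by move=> i; rewrite inE => /eqP ->.
- by apply: measurable_wrt_coord; rewrite inE.
Qed.

End IndependentFamily.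

(** * The small-ball estimate *)

Section Laplace.
Context {R : realType}.
Local Notation mu := (@lebesgue_measure R).
Local Notation posR := (`]0%R, +oo[%classic : set R).

Lemma integral_exp_decay (a : R) : 0 < a ->
  (\int[mu]_(s in posR) (expR (- (s * a)))%:E = (a^-1)%:E)%E.
Proof.
move=> a0.
have h : (\int[mu]_(s in posR) (a%:E * (expR (- (s * a)))%:E) = 1)%E.
  rewrite -(@integral_exponential_pdf R a a0) /exponential_pdf.
  rewrite (@integral_itv_obnd_cbnd _ 0 +oo%O); last first.
    by apply: measurable_funTS; apply: emeasurable_funM; meas.
  rewrite integral_mkcond; apply: eq_integral => s _; rewrite !patchE.
  by case: ifP => // _; rewrite -EFinM mulNr (mulrC s).
move: h; rewrite ge0_integralZl//; first last.
- by rewrite lee_fin ltW.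
- by apply: measurable_funTS; meas.
move=> h; rewrite -[LHS]mul1e -(@mulVf R a (lt0r_neq0 a0)) EFinM -muleA h mule1 //.
Qed.

(** The Laplace transform of the law of [1 / s] for an exponential variable [s]; in terms of the
    modified Bessel function it is [2 * sqrt l * K_1 (2 * sqrt l)]. *)
Definition psi (l : R) : R := fine (\int[mu]_(s in posR) (expR (- (s + l / s)))%:E)%E.

Lemma measurable_psi_kernel d (T : measurableType d) (l s : T -> R) :
  measurable_fun setT l -> measurable_fun setT s ->
  measurable_fun setT (fun t => expR (- (s t + l t / s t))).
Proof. by move=> ml ms; meas. Qed.

Let ge0kernel (l s : R) : (0 <= (expR (- (s + l / s)))%:E)%E.
Proof. by rewrite lee_fin expR_ge0. Qed.

Let int_exp1 : (\int[mu]_(s in posR) (expR (- s))%:E = 1)%E.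
Proof.
transitivity (\int[mu]_(s in posR) (expR (- (s * 1)))%:E)%E; last by rewrite integral_exp_decay ?invr1.
by apply: eq_integral => s _; rewrite mulr1.
Qed.

Lemma psi_int_le1 (l : R) : 0 <= l ->
  (\int[mu]_(s in posR) (expR (- (s + l / s)))%:E <= 1)%E.
Proof.
move=> l0; rewrite -int_exp1; apply: ge0_le_integral => //.
- by apply: measurable_funTS; meas.
- by apply: measurable_funTS; meas.
- move=> s /=; rewrite in_itv/= andbT => s0.
  by rewrite lee_fin ler_expR lerN2 lerDl divr_ge0// ltW.
Qed.

Lemma psiE (l : R) : 0 <= l ->
  (\int[mu]_(s in posR) (expR (- (s + l / s)))%:E = (psi l)%:E)%E.
Proof.
move=> l0; rewrite fineK// ge0_fin_numE ?integral_ge0//.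
by apply: le_lt_trans (psi_int_le1 l0) _; rewrite ltry.
Qed.

Lemma psi_ge0 (l : R) : 0 <= psi l.
Proof. by apply: fine_ge0; exact: integral_ge0. Qed.

Lemma psi_anti (l1 l2 : R) : 0 <= l1 -> l1 <= l2 -> psi l2 <= psi l1.
Proof.
move=> l10 l12; have l20 := le_trans l10 l12.
rewrite -lee_fin -!psiE//; apply: ge0_le_integral => //.
- by apply: measurable_funTS; meas.
- by apply: measurable_funTS; meas.
move=> s /=; rewrite in_itv/= andbT => s0.
by rewrite lee_fin ler_expR lerN2 lerD2l ler_wpM2r// invr_ge0 ltW.
Qed.

Lemma measurable_psi d (T : measurableType d) (h : T -> R) :
  measurable_fun setT h -> measurable_fun setT (fun t => psi (h t)).
Proof.
move=> mh; apply: (measurableT_comp (f := psi)) mh.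
apply: (measurableT_comp (@fine_measurable _ setT measurableT)).
pose F (l s : R) := (expR (- (s + l / s)))%:E.
apply: (@measurable_integral_in _ _ (measurableTypeR R) _ _ mu posR F) => //.
by apply/measurable_EFinP; apply: (measurable_psi_kernel (l := fst) (s := snd)); meas.
Qed.

Lemma integral_psi : (\int[mu]_(l in posR) (psi l)%:E = 1)%E.
Proof.
transitivity (\int[mu]_(l in posR) \int[mu]_(s in posR) (expR (- (s + l / s)))%:E)%E.
  by apply: eq_integral => l /[!inE]/=; rewrite in_itv/= andbT => l0; rewrite psiE// ltW.
rewrite (@tonelli_in _ _ _ _ _ mu mu posR posR (fun l s => (expR (- (s + l / s)))%:E))//; last first.
  by apply/measurable_EFinP; apply: (measurable_psi_kernel (l := fst) (s := snd)); meas.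
transitivity (\int[mu]_(s in posR) (s * expR (- (s * 1)))%:E)%E; last first.
  by rewrite integral_gamma2// expr1n invr1.
apply: eq_integral => s /[!inE]/=; rewrite in_itv/= andbT => s0.
transitivity (\int[mu]_(l in posR) ((expR (- s))%:E * (expR (- (l * s^-1)))%:E))%E.
  by apply: eq_integral => l _; rewrite -EFinM -expRD opprD.
rewrite ge0_integralZl//; first last.
- by apply: measurable_funTS; meas.
by rewrite integral_exp_decay ?invr_gt0// invrK -EFinM mulr1 mulrC.
Qed.

Lemma integral_inv (l : R) : 0 < l -> l < 1 ->
  (\int[mu]_(s in `[l, 1%R]) (s^-1)%:E = (- ln l)%:E)%E.
Proof.
move=> l0 l1.
have cinv : {within `[l, 1%R], continuous (fun s : R => s^-1)}.
  apply: continuous_in_subspaceT => s /[!inE]/=; rewrite in_itv/= => /andP[ls _].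
  by apply: cvgV; [rewrite gt_eqF// (lt_le_trans l0)|exact: cvg_id].
rewrite (@continuous_FTC2 R (fun s => s^-1) (@ln R))//.
- by rewrite ln1 -EFinB sub0r.
- split.
  + by move=> s; rewrite in_itv/= => /andP[ls _]; have [] := is_derive1_ln (lt_trans l0 ls).
  + by apply/cvg_at_right_filter; exact: continuous_ln.
  + by apply/cvg_at_left_filter; exact: continuous_ln.
- move=> s; rewrite in_itv/= => /andP[ls _]; rewrite derive1E.
  by have [_] := is_derive1_ln (lt_trans l0 ls).
Qed.

Lemma expRN_half (x : R) : 0 <= x <= 1 -> x / 2 <= 1 - expR (- x).
Proof.
move=> /andP[x0 x1]; rewrite expRN.
have := expR_ge1Dx x; move: (expR x) (expR_gt0 x) => e e0 he.
rewrite -subr_ge0 (_ : _ - _ - _ = ((2 - x) * e - 2) / (2 * e)); last by field; exact: lt0r_neq0.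
by apply: divr_ge0; nra.
Qed.

Definition psi_rate : R := expR (-1) / 2.

Lemma psi_rate_gt0 : 0 < psi_rate.
Proof. by rewrite divr_gt0// expR_gt0. Qed.

(** On [[l, 1]] one has [1 - expR (- (l / s)) >= l / (2 * s)] and [expR (- s) >= expR (-1)];
    integrating [s^-1] gives the logarithm. The order [l * ln l] in place of [l] reflects the
    infinite second moment of the projected point. *)
Lemma psi_le (l : R) : 0 < l -> l < 1 -> psi l <= expR (psi_rate * (l * ln l)).
Proof.
move=> l0 l1.
have mr : measurable_fun posR
    ((fun s : R => (psi_rate * l)%:E * (s^-1)%:E) \_ `[l, 1%R]%classic)%E.
  apply: measurable_funTS; apply/(measurable_restrictT _ (measurable_itv _)).
  by apply: measurable_funTS; meas.
have h : ((psi l)%:E + (psi_rate * l * - ln l)%:E <= 1)%E.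
  rewrite -(psiE (ltW l0)) (EFinM (psi_rate * l)) -integral_inv// -ge0_integralZl//; first last.
  - by rewrite lee_fin mulr_ge0// ltW// psi_rate_gt0.
  - by move=> s /=; rewrite in_itv/= lee_fin invr_ge0 => /andP[ls _]; apply: le_trans ls; exact: ltW.
  - by apply: measurable_funTS; meas.
  have sub : `[l, 1%R]%classic `<=` posR.
    by move=> s /=; rewrite !in_itv/= andbT => /andP[ls _]; exact: lt_le_trans ls.
  rewrite (_ : `[l, 1%R]%classic = posR `&` `[l, 1%R]%classic); last by rewrite setIidr.
  rewrite integral_mkcondr -ge0_integralD//; first last.
  - move=> s _; rewrite patchE; case: ifPn => // /[!inE]/=; rewrite in_itv/= => /andP[ls _].
    by rewrite -EFinM lee_fin !mulr_ge0 ?invr_ge0 ?ltW ?psi_rate_gt0// (lt_le_trans l0).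
  - by apply: measurable_funTS; meas.
  rewrite -int_exp1; apply: ge0_le_integral => //.
  - move=> s _; rewrite adde_ge0// patchE; case: ifPn => // /[!inE]/=; rewrite in_itv/= => /andP[ls _].
    by rewrite -EFinM lee_fin !mulr_ge0 ?invr_ge0 ?ltW ?psi_rate_gt0// (lt_le_trans l0).
  - apply: emeasurable_funD; first by apply: measurable_funTS; meas.
    exact: mr.
  - by apply: measurable_funTS; meas.
  move=> s /=; rewrite in_itv/= andbT => s0; rewrite patchE opprD expRD.
  have ls0 : 0 <= l / s by rewrite divr_ge0// ltW.
  case: ifPn => [|_]; last first.
    by rewrite adde0 lee_fin ler_piMr ?expR_ge0// -expR0 ler_expR oppr_le0.
  rewrite inE/= in_itv/= => /andP[ls s1].
  have ls1 : l / s <= 1 by rewrite ler_pdivrMr// mul1r.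
  have h1 : l / s / 2 <= 1 - expR (- (l / s)) by rewrite expRN_half// ls0.
  have h2 : expR (- 1) <= expR (- s) by rewrite ler_expR lerN2.
  rewrite -EFinM -EFinD lee_fin -lerBrDl -[X in X - _]mulr1 -mulrBr /psi_rate.
  have -> : expR (-1) / 2 * l / s = expR (-1) * (l / s / 2) by ring.
  by rewrite ler_pM ?expR_ge0// divr_ge0.
move: h; rewrite -EFinD lee_fin => h.
apply: le_trans (expR_ge1Dx _).
by rewrite mulrA; move: h; rewrite mulrN; lra.
Qed.

Lemma expRN_le_sqr (x : R) : 0 < x -> expR (- x) <= 4 / x ^+ 2.
Proof.
move=> x0; have -> : - x = 2%:R * - (x / 2) by field.
rewrite expRM_natl expRN; have h := expR_ge1Dx (x / 2).
have -> : 4 / x ^+ 2 = (2 / x) ^+ 2 by rewrite exprMn exprVn; ring.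
rewrite exprVn -exprVn.
rewrite lerXn2r ?nnegrE ?invr_ge0 ?expR_ge0 ?(divr_ge0 _ (ltW x0))//.
by rewrite -[2 / x]invf_div lef_pV2 ?posrE ?expR_gt0 ?divr_gt0//; lra.
Qed.

Lemma ln_ge_half n : (2 <= n)%N -> 1 / 2 <= ln (n%:R : R).
Proof.
move=> n2; apply: (@le_trans _ _ (ln 2%:R)); last first.
  by rewrite ler_ln ?posrE ?ltr0n ?ler_nat// (ltn_trans _ n2).
have h : expR (1 / 2) <= 2%:R :> R.
  have := @expR_ge1Dx R (- (1 / 2)); rewrite expRN.
  move: (expR (1 / 2)) (expR_gt0 (1 / 2 : R)) => e e0 h.
  have : 1 / 2 * e <= e^-1 * e by rewrite ler_wpM2r ?(ltW e0)//; lra.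
  by rewrite mulVf ?gt_eqF//; lra.
by rewrite -[leLHS]expRK ler_ln ?posrE ?expR_gt0.
Qed.

(** Cut at [a = n^(-1/2)]. Below, [ln l <= - ln n / 2] bounds the power by an exponential in [l] of
    rate of order [n * ln n]. Above, all factors but one are at most [psi a], whose power is
    exponentially small in [sqrt n * ln n], and the last factor has integral at most 1. The two
    terms of the constant correspond to the two ranges. *)
Lemma integral_psi_pow : exists2 C : R, 0 < C & forall n : nat, (2 <= n)%N ->
  (\int[mu]_(l in posR) (psi l ^+ n)%:E <= (C / (n%:R * ln n%:R))%:E)%E.
Proof.
have c0 := psi_rate_gt0; set c := psi_rate in c0 *.
exists (2 / c + 128 / c ^+ 2); first by rewrite addr_gt0// divr_gt0// exprn_gt0.
move=> n n2; have L0 := ln_ge_half n2.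
have n0 : 0 < n%:R :> R by rewrite ltr0n (ltn_trans _ n2).
have n2R : 2 <= n%:R :> R by rewrite ler_nat.
set q : R := Num.sqrt n%:R.
have q0 : 0 < q by rewrite sqrtr_gt0.
have qq : q ^+ 2 = n%:R by rewrite sqr_sqrtr ?ltW.
have q1 : 1 < q by nra.
have lnq : ln n%:R = 2 * ln q by rewrite -qq lnXn//; ring.
set L := ln n%:R in L0 lnq *.
have L00 : 0 < L by lra.
pose a := q^-1.
have a0 : 0 < a by rewrite invr_gt0.
have a1 : a < 1 by rewrite invf_lt1.
have lna : ln a = - (L / 2) by rewrite lnV ?posrE// lnq; field.
have mpsi m : measurable_fun setT (fun l : R => (psi l ^+ m)%:E).
  by apply/measurable_EFinP; apply: measurable_funX; apply: measurable_psi; meas.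
have -> : posR = `]0%R, a]%classic `|` `]a, +oo[%classic.
  by rewrite -itv_bndbnd_setU// bnd_simp ltW.
rewrite ge0_integral_setU//=; last 3 first.
- by apply: measurable_funTS; exact: mpsi.
- by move=> l _; rewrite lee_fin exprn_ge0// psi_ge0.
- apply/disj_setPS => l [] /=; rewrite !in_itv/= andbT => /andP[_ la] al.
  by move: (le_lt_trans la al); rewrite ltxx.
rewrite mulrDl EFinD; apply: leeD.
- apply: (@le_trans _ _ (\int[mu]_(l in `]0%R, a]) (expR (- (l * (c * n%:R * (L / 2)))))%:E)%E).
    apply: ge0_le_integral => //.
    + by move=> l _; rewrite lee_fin exprn_ge0// psi_ge0.
    + by apply: measurable_funTS; exact: mpsi.
    + by apply: measurable_funTS; meas.
    move=> l /=; rewrite in_itv/= => /andP[l0 la]; rewrite lee_fin.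
    apply: (@le_trans _ _ (expR (c * (l * ln l)) ^+ n)).
      by rewrite lerXn2r ?nnegrE ?psi_ge0 ?expR_ge0// psi_le// (le_lt_trans la).
    rewrite -expRM_natl ler_expR.
    have lnl : ln l <= - (L / 2) by rewrite -lna ler_ln ?posrE.
    have -> : - (l * (c * n%:R * (L / 2))) = n%:R * c * l * - (L / 2) by ring.
    have -> : n%:R * (c * (l * ln l)) = n%:R * c * l * ln l by ring.
    by rewrite ler_wpM2l// !mulr_ge0// ltW.
  apply: (@le_trans _ _ (\int[mu]_(l in posR) (expR (- (l * (c * n%:R * (L / 2)))))%:E)%E).
    apply: ge0_subset_integral => //.
    + by apply: measurable_funTS; meas.
    + by move=> l /=; rewrite !in_itv/= andbT => /andP[].
  rewrite integral_exp_decay ?mulr_gt0 ?divr_gt0// lee_fin.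
  by rewrite le_eqVlt; apply/orP; left; apply/eqP; field; rewrite !gt_eqF.
- apply: (@le_trans _ _ (\int[mu]_(l in `]a, +oo[) ((psi a ^+ n.-1)%:E * (psi l)%:E))%E).
    apply: ge0_le_integral => //.
    + by move=> l _; rewrite lee_fin exprn_ge0// psi_ge0.
    + by apply: measurable_funTS; exact: mpsi.
    + apply: measurable_funTS; apply/measurable_EFinP; apply: measurable_funM => //.
      by apply: measurable_psi; meas.
    move=> l /=; rewrite in_itv/= andbT => al; rewrite -EFinM lee_fin.
    rewrite -[in leLHS](prednK (ltnW n2)) exprSr ler_wpM2r ?psi_ge0//.
    by rewrite lerXn2r ?nnegrE ?psi_ge0// psi_anti// ltW.
  have mpsi1 (D : set R) : measurable D -> measurable_fun D (fun l : R => (psi l)%:E).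
    by move=> mD; apply: measurable_funTS; apply/measurable_EFinP; apply: measurable_psi; meas.
  rewrite ge0_integralZl//; first last.
  + by rewrite lee_fin exprn_ge0// psi_ge0.
  + by move=> l _; rewrite lee_fin psi_ge0.
  + exact: mpsi1.
  apply: (@le_trans _ _ ((psi a ^+ n.-1)%:E * 1)%E).
    rewrite lee_wpmul2l ?lee_fin ?exprn_ge0 ?psi_ge0// -integral_psi.
    apply: ge0_subset_integral => //.
    + exact: mpsi1.
    + by move=> l _; rewrite lee_fin psi_ge0.
    + by move=> l /=; rewrite !in_itv/= !andbT; exact: lt_trans.
  rewrite mule1 lee_fin.
  apply: (@le_trans _ _ (expR (c * (a * ln a)) ^+ n.-1)).
    by rewrite lerXn2r ?nnegrE ?psi_ge0 ?expR_ge0// psi_le.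
  rewrite -expRM_natl lna.
  (* Half of the exponent [c * q * L / 2] that the full power [n] would give, because
     [n - 1 >= n / 2]. *)
  pose x := c * q * L / 4.
  have x0 : 0 < x by rewrite divr_gt0// !mulr_gt0.
  apply: (@le_trans _ _ (expR (- x))).
    rewrite ler_expR.
    have -> : n.-1%:R * (c * (a * - (L / 2))) = - (n.-1%:R * (c * a * L / 2)) by ring.
    rewrite lerN2.
    have -> : x = n%:R / 2 * (c * a * L / 2) by rewrite /x /a -qq; field; exact: lt0r_neq0.
    rewrite ler_wpM2r//; first by rewrite divr_ge0// !mulr_ge0// ltW.
    by rewrite -subn1 natrB ?(ltnW n2)//; lra.
  apply: (le_trans (expRN_le_sqr x0)).
  have -> : 4 / x ^+ 2 = 64 / (c ^+ 2 * n%:R * L) / L.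
    by rewrite /x -qq; field; rewrite !gt_eqF.
  have -> : 128 / c ^+ 2 / (n%:R * L) = 64 / (c ^+ 2 * n%:R * L) * 2 by field; rewrite !gt_eqF.
  rewrite ler_wpM2l//; first by rewrite divr_ge0// !mulr_ge0// ?sqr_ge0// ltW.
  by rewrite -[leRHS]invrK lef_pV2 ?posrE ?invr_gt0//; lra.
Qed.

End Laplace.

(** * Concentration of a sum of projected points *)

Section SmallBall.
Context d (T : measurableType d) (R : realType) (P : probability T R) (n : nat).
Variable V : 'I_n -> T -> R3 R.
Hypotheses (mV : forall i, measurable_fun setT (V i)) (iV : indep_family P V).
Hypothesis lawV : forall i A, measurable A -> P (V i @^-1` A) = sigma A.
Local Notation mu := (@lebesgue_measure R).
Local Notation posR := (`]0%R, +oo[%classic : set R).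
Implicit Types r : seq 'I_n.

Lemma measurable_wrt_sum r (h : R3 R -> R) : measurable_fun setT h ->
  measurable_wrt V r (fun w => \sum_(i <- r) h (V i w)).
Proof.
move=> mh; have : {subset r <= r} by [].
elim: {1 4}r => [|i s IH] sr; rewrite /measurable_wrt.
  by under eq_fun do rewrite big_nil; exact: measurable_cst.
under eq_fun do rewrite big_cons.
apply: measurable_funD; last by apply: IH => j js; rewrite sr// inE js orbT.
apply: measurableT_comp mh _; apply: measurable_wrt_coord.
by rewrite sr// inE eqxx.
Qed.

Lemma measurable_stereo1 : measurable_fun setT (fun x : R3 R => (stereo x).1).
Proof. exact: measurableT_comp measurable_fst measurable_stereo. Qed.

Lemma measurable_stereo2 : measurable_fun setT (fun x : R3 R => (stereo x).2).
Proof. exact: measurableT_comp measurable_snd measurable_stereo. Qed.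

Definition ssum1 r w : R := \sum_(i <- r) (stereo (V i w)).1.
Definition ssum2 r w : R := \sum_(i <- r) (stereo (V i w)).2.

Lemma measurable_ssum1 r : measurable_wrt V r (ssum1 r).
Proof. exact: measurable_wrt_sum measurable_stereo1. Qed.

Lemma measurable_ssum2 r : measurable_wrt V r (ssum2 r).
Proof. exact: measurable_wrt_sum measurable_stereo2. Qed.

Let ssum1_cons k r w : ssum1 (k :: r) w = ssum1 r w + (stereo (V k w)).1.
Proof. by rewrite /ssum1 big_cons addrC. Qed.

Let ssum2_cons k r w : ssum2 (k :: r) w = ssum2 r w + (stereo (V k w)).2.
Proof. by rewrite /ssum2 big_cons addrC. Qed.

(** Each point raises the parameter by an independent [s_i^-1]. The final density is at most the
    inverse of [pi] times the total parameter, and this inverse is an integral over [l] of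
    exponentials; averaging over each [s_i] contributes one factor [psi l]. The centre and [b] are
    arbitrary for the sake of the induction. *)
Lemma gauss2_ssum_le r (b x y : R) : uniq r -> 0 < b ->
  (\int[P]_w (gauss2 b (x + ssum1 r w) (y + ssum2 r w))%:E <=
   (pi^-1)%:E * \int[mu]_(l in posR) (expR (- (l * b)) * psi l ^+ size r)%:E)%E.
Proof.
have pi0 := pi_gt0 R.
have mS1 s : measurable_fun setT (ssum1 s).
  by apply: (measurable_wrtW mV (r := s)); exact: measurable_ssum1.
have mS2 s : measurable_fun setT (ssum2 s).
  by apply: (measurable_wrtW mV (r := s)); exact: measurable_ssum2.
elim: r b x y => [|k r IH] b x y /=.
  move=> _ b0; under [X in (_ <= _ * X)%E]eq_integral do rewrite expr0 mulr1.
  rewrite integral_exp_decay// -EFinM -invfM.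
  rewrite (@le_trans _ _ (\int[P]_w ((pi * b)^-1)%:E)%E)//.
    apply: ge0_le_integral => //.
    - by move=> w _; rewrite lee_fin gauss2_ge0.
    - by apply: measurable_funTS; apply/measurable_EFinP; apply: measurable_gauss2; meas; auto.
    - by move=> w _; rewrite lee_fin gauss2_le.
  by rewrite integral_cst//= probability_setT mule1.
move=> /andP[kr ur] b0.
pose f (z : R3 R * (R * R)) := (gauss2 b (x + z.2.1 + (stereo z.1).1) (y + z.2.2 + (stereo z.1).2))%:E.
have mf : measurable_fun setT f.
  apply/measurable_EFinP; apply: measurable_gauss2; meas.
  - exact: measurableT_comp measurable_stereo measurable_fst.
  - exact: measurableT_comp measurable_stereo measurable_fst.
have mZ : measurable_wrt V r (fun w => (ssum1 r w, ssum2 r w)).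
  by apply: measurable_fun_pair; [exact: measurable_ssum1|exact: measurable_ssum2].
have -> : (\int[P]_w (gauss2 b (x + ssum1 (k :: r) w) (y + ssum2 (k :: r) w))%:E =
    \int[P]_w f (V k w, (ssum1 r w, ssum2 r w)))%E.
  by apply: eq_integral => w _; rewrite ssum1_cons ssum2_cons !addrA.
rewrite (ge0_integral_indep_coord mV iV lawV kr mZ mf); last first.
  by move=> z; rewrite lee_fin gauss2_ge0.
under eq_integral do rewrite /f/= integral_sigma_gauss2//.
pose F w (s : R) := (expR (- s) * gauss2 (b + `|s|^-1) (x + ssum1 r w) (y + ssum2 r w)).
have F0 w s : 0 <= F w s.
  by rewrite mulr_ge0 ?expR_ge0// gauss2_ge0// ltr_wpDr// invr_ge0.
have mF : measurable_fun setT (fun z : T * R => F z.1 z.2).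
  apply: measurable_funM; first by meas.
  apply: measurable_gauss2; meas.
  - exact: measurableT_comp (mS1 r) measurable_fst.
  - exact: measurableT_comp (mS2 r) measurable_fst.
rewrite (_ : (\int[P]_w _ = \int[P]_w \int[mu]_(s in posR) (F w s)%:E)%E); last first.
  apply: eq_integral => w _; apply: eq_integral => s /[!inE]/=; rewrite in_itv/= andbT => s0.
  by rewrite /F gtr0_norm.
rewrite (@tonelli_in _ _ _ _ _ P mu setT posR (fun w s => (F w s)%:E))//; last exact/measurable_EFinP.
pose G (s l : R) : R := pi^-1 * (expR (- s) * (expR (- (l * (b + s^-1))) * psi l ^+ size r)).
have G0 s l : 0 <= G s l.
  by rewrite !mulr_ge0 ?invr_ge0 ?expR_ge0 ?exprn_ge0 ?psi_ge0// ltW.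
have mG : measurable_fun setT (fun z : R * R => G z.1 z.2).
  by rewrite /G /=; meas; apply: measurable_psi; meas.
have mG1 s : measurable_fun setT (G s).
  by rewrite /G; meas; apply: measurable_psi; meas.
apply: (@le_trans _ _ (\int[mu]_(s in posR) \int[mu]_(l in posR) (G s l)%:E)%E).
  apply: ge0_le_integral => //.
  - by move=> s _; apply: integral_ge0 => w _; rewrite lee_fin.
  - apply: measurable_funTS.
    apply: (@measurable_integral_in _ _ (measurableTypeR R) _ _ P setT (fun s w => (F w s)%:E)) => //.
    + apply/measurable_EFinP.
      by apply: (measurableT_comp mF (g := fun z : R * T => (z.2, z.1))); exact: measurable_fun_pair.
    + by move=> s w; rewrite lee_fin.
  - apply: measurable_funTS.
    apply: (@measurable_integral_in _ _ (measurableTypeR R) _ _ mu posR (fun s l => (G s l)%:E)) => //.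
    + exact/measurable_EFinP.
  move=> s /=; rewrite in_itv/= andbT => s0.
  have bs : 0 < b + s^-1 by rewrite addr_gt0// invr_gt0.
  have -> : (\int[P]_w (F w s)%:E =
      (expR (- s))%:E * \int[P]_w (gauss2 (b + s^-1) (x + ssum1 r w) (y + ssum2 r w))%:E)%E.
    rewrite -ge0_integralZl//; first last.
    + by move=> w _; rewrite lee_fin gauss2_ge0.
    + by apply/measurable_EFinP; apply: measurable_gauss2; meas.
    by apply: eq_integral => w _; rewrite /F gtr0_norm.
  apply: (@le_trans _ _ ((expR (- s))%:E * ((pi^-1)%:E *
     \int[mu]_(l in posR) (expR (- (l * (b + s^-1))) * psi l ^+ size r)%:E))%E).
    by rewrite lee_wpmul2l ?lee_fin ?expR_ge0// IH.
  rewrite -ge0_integralZl//; first last.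
  + by rewrite lee_fin invr_ge0 ltW.
  + by move=> l _; rewrite lee_fin mulr_ge0 ?expR_ge0 ?exprn_ge0 ?psi_ge0.
  + by apply: measurable_funTS; apply/measurable_EFinP; meas; apply: measurable_psi; meas.
  rewrite -ge0_integralZl//; first last.
  + by move=> l _; rewrite lee_fin !mulr_ge0 ?expR_ge0 ?exprn_ge0 ?psi_ge0// invr_ge0 ltW.
  + by apply: measurable_funTS; apply/measurable_EFinP; meas; apply: measurable_psi; meas.
  rewrite le_eqVlt; apply/orP; left; apply/eqP; apply: eq_integral => l _.
  by rewrite -!EFinM /G; congr EFin; rewrite mulrCA.
rewrite (@tonelli_in _ _ _ _ _ mu mu posR posR (fun s l => (G s l)%:E))//; last exact/measurable_EFinP.
rewrite -ge0_integralZl//; first last.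
- by rewrite lee_fin invr_ge0 ltW.
- by move=> l _; rewrite lee_fin mulr_ge0 ?expR_ge0 ?exprn_ge0 ?psi_ge0.
- by apply: measurable_funTS; apply/measurable_EFinP; meas; apply: measurable_psi; meas.
rewrite le_eqVlt; apply/orP; left; apply/eqP; apply: eq_integral => l /[!inE]/=.
rewrite in_itv/= andbT => l0.
have c0 : 0 <= pi^-1 * expR (- (l * b)) * psi l ^+ size r.
  by rewrite !mulr_ge0 ?invr_ge0 ?expR_ge0 ?exprn_ge0 ?psi_ge0// ltW.
transitivity (\int[mu]_(s in posR) ((pi^-1 * expR (- (l * b)) * psi l ^+ size r)%:E *
    (expR (- (s + l / s)))%:E))%E.
  apply: eq_integral => s _; rewrite -EFinM /G; congr EFin.
  rewrite (_ : - (s + l / s) = - s - l / s) ?opprD// mulrDr opprD !expRD; ring.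
rewrite ge0_integralZl//; first last.
- by apply: measurable_funTS; apply/measurable_EFinP; apply: measurable_psi_kernel; meas.
by rewrite psiE ?ltW// -EFinM exprSr; congr EFin; ring.
Qed.

Lemma small_ball_psi r (e : R) : uniq r -> 0 < e ->
  (P [set w | (ssum1 r w ^+ 2 + ssum2 r w ^+ 2 <= e ^+ 2)%R] <=
   (expR 1 * e ^+ 2)%:E * \int[mu]_(l in posR) (psi l ^+ size r)%:E)%E.
Proof.
move=> ur e0; have pi0 := pi_gt0 R.
have mS1 r' : measurable_fun setT (ssum1 r').
  by apply: (measurable_wrtW mV (r := r')); exact: measurable_ssum1.
have mS2 r' : measurable_fun setT (ssum2 r').
  by apply: (measurable_wrtW mV (r := r')); exact: measurable_ssum2.
have e20 : 0 < e ^+ 2 by rewrite exprn_gt0.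
have mpsi m : measurable_fun setT (fun l : R => (psi l ^+ m)).
  by apply: measurable_funX; apply: measurable_psi; meas.
have mS : measurable_fun setT (fun w => ssum1 r w ^+ 2 + ssum2 r w ^+ 2).
  by apply: measurable_funD; apply: measurable_funX.
set A := [set w | _].
have mA : measurable A.
  have := mS measurableT _ (measurable_itv `]-oo, e ^+ 2]); rewrite setTI.
  by congr (measurable _); apply/seteqP; split => w; rewrite /A/= in_itv.
rewrite -[A in P A]setIT -integral_indic//.
(* On the disc of radius [e] the Gaussian density of parameter [e ^+ 2] is at least [K^-1]. *)
pose K : R := expR 1 * (pi * e ^+ 2).
have K0 : 0 <= K by rewrite !mulr_ge0 ?expR_ge0// ltW.
apply: (@le_trans _ _ (\int[P]_w (K%:E * (gauss2 (e ^+ 2) (0 + ssum1 r w) (0 + ssum2 r w))%:E))%E).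
  apply: ge0_le_integral => //.
  - by apply/measurable_EFinP; exact: measurable_indic.
  - by apply/measurable_EFinP; apply: measurable_funM => //; apply: measurable_gauss2; meas.
  move=> w _; rewrite -EFinM lee_fin indicE !add0r.
  have [|_] := boolP (w \in A); last by rewrite mulr_ge0// gauss2_ge0.
  rewrite inE /A/= => wA; rewrite /gauss2 /K.
  have -> : expR 1 * (pi * e ^+ 2) * (expR (- ((ssum1 r w ^+ 2 + ssum2 r w ^+ 2) / e ^+ 2)) / (pi * e ^+ 2)) =
     expR 1 * expR (- ((ssum1 r w ^+ 2 + ssum2 r w ^+ 2) / e ^+ 2)).
    by move: (expR (- _)) (expR 1) (pi : R) pi0 => E F p p0; field; rewrite !gt_eqF.
  by rewrite -expRD -[leLHS]expR0 ler_expR subr_ge0 ler_pdivrMr// mul1r.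
rewrite ge0_integralZl//; first last.
- by move=> w _; rewrite lee_fin gauss2_ge0.
- by apply/measurable_EFinP; apply: measurable_gauss2; meas.
apply: (@le_trans _ _ (K%:E * ((pi^-1)%:E *
   \int[mu]_(l in posR) (expR (- (l * e ^+ 2)) * psi l ^+ size r)%:E))%E).
  by rewrite lee_wpmul2l ?lee_fin// gauss2_ssum_le.
rewrite muleA -EFinM.
have -> : K / pi = expR 1 * e ^+ 2 by rewrite /K; move: (expR 1) (pi : R) pi0 => F p p0; field; rewrite gt_eqF.
have E0 : 0 <= expR 1 * e ^+ 2 by apply: mulr_ge0; [exact: expR_ge0|exact: ltW].
rewrite lee_wpmul2l ?lee_fin//.
apply: ge0_le_integral => //.
- by move=> l _; rewrite lee_fin mulr_ge0 ?expR_ge0 ?exprn_ge0 ?psi_ge0.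
- by apply: measurable_funTS; apply/measurable_EFinP; meas; apply: measurable_psi; meas.
- by apply: measurable_funTS; apply/measurable_EFinP; exact: mpsi.
move=> l /=; rewrite in_itv/= andbT => l0.
rewrite lee_fin ler_piMl ?exprn_ge0 ?psi_ge0// -expR0 ler_expR oppr_le0.
by rewrite mulr_ge0// ltW.
Qed.

End SmallBall.

Lemma small_ball (R : realType) : exists2 C : R, 0 < C &
  forall d (T : measurableType d) (P : probability T R) n (V : 'I_n -> T -> R3 R),
  (2 <= n)%N -> (forall i, measurable_fun setT (V i)) -> indep_family P V ->
  (forall i A, measurable A -> P (V i @^-1` A) = sigma A) ->
  forall e, 0 < e ->
  (P [set w | (\sum_i (stereo (V i w)).1) ^+ 2 + (\sum_i (stereo (V i w)).2) ^+ 2 <= e ^+ 2]%R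
   <= (C * e ^+ 2 / (n%:R * ln n%:R))%:E)%E.
Proof.
have [C C0 hC] := @integral_psi_pow R.
exists (expR 1 * C); first by rewrite mulr_gt0// expR_gt0.
move=> d T P n V n2 mV iV lawV e e0.
have := small_ball_psi mV iV lawV (enum_uniq 'I_n) e0.
rewrite /ssum1 /ssum2 size_enum_ord.
under eq_set do rewrite !big_enum/=.
move/le_trans; apply.
apply: le_trans (lee_wpmul2l _ (hC n n2)) _; first by rewrite lee_fin mulr_ge0 ?expR_ge0 ?sqr_ge0.
by rewrite -EFinM lee_fin le_eqVlt; apply/orP; left; apply/eqP; ring.
Qed.

(** * The gradient near a local maximum *)

Section LogBounds.
Context {R : realType}.

Lemma is_derive_ge0_le (f f' : R -> R) (a b : R) : a <= b ->
  (forall x, a <= x <= b -> is_derive x 1 f (f' x)) ->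
  (forall x, a <= x <= b -> 0 <= f' x) -> f a <= f b.
Proof.
move=> ab df f0; apply: (@ger0_derive1_ndecr R f a b) => //.
- by move=> x; rewrite in_itv/= => /andP[ax xb]; have [] := df x; rewrite ?ltW.
- move=> x; rewrite in_itv/= => /andP[ax xb]; rewrite derive1E.
  by have [|_ ->] := df x; rewrite ?f0 ?ltW.
- apply: derivable_within_continuous => x; rewrite in_itv/= => axb.
  by have [] := df x axb.
Qed.

(** The difference of the two sides has derivative [y ^+ 3 / (1 + y)], which has the sign of [y], so
    it is minimal at 0. *)
Lemma ln1D_le (x : R) : -1 < x -> ln (1 + x) <= x - x ^+ 2 / 2 + x ^+ 3 / 3.
Proof.
move=> x1.
pose g (x : R) := x - x ^+ 2 / 2 + x ^+ 3 / 3 - ln (1 + x).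
have dg (y : R) : -1 < y -> is_derive y 1 g (y ^+ 3 / (1 + y)).
  move=> y1; have y0 : 0 < 1 + y by lra.
  have dl : is_derive y 1 (fun t => ln (1 + t)) ((1 + y)^-1).
    have := is_derive1_ln y0 => dln.
    by apply: is_derive_eq; rewrite /GRing.scale/=; ring.
  by apply: is_derive_eq; rewrite /GRing.scale/=; field; rewrite gt_eqF.
have g0 : g 0 = 0 by rewrite /g addr0 ln1; ring.
suff : 0 <= g x by rewrite /g; lra.
rewrite -g0; have [x0|x0] := leP 0 x.
  apply: (is_derive_ge0_le (f' := fun y => y ^+ 3 / (1 + y)) x0).
    by move=> y /andP[y0 _]; apply: dg; lra.
  by move=> y /andP[y0 _]; apply: divr_ge0; [exact: exprn_ge0|lra].
rewrite -lerN2; apply: (@is_derive_ge0_le (fun y => - g y) (fun y => - (y ^+ 3 / (1 + y)))).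
- exact: ltW.
- by move=> y /andP[xy y0]; have := dg y (lt_le_trans x1 xy) => d; apply: is_derive_eq.
- move=> y /andP[xy y0]; rewrite -mulNr divr_ge0//; last by lra.
  by rewrite oppr_ge0 exprS mulr_le0_ge0// sqr_ge0.
Qed.

Lemma ln1D_ge (x : R) : - (1 / 2) <= x -> x - x ^+ 2 / 2 - 2 * `|x| ^+ 3 <= ln (1 + x).
Proof.
move=> x1.
have dl (y : R) : - (1 / 2) <= y -> is_derive y 1 (fun t => ln (1 + t)) ((1 + y)^-1).
  move=> y1; have y0 : 0 < 1 + y by lra.
  by have := is_derive1_ln y0 => dln; apply: is_derive_eq; rewrite /GRing.scale/=; ring.
have [x0|x0] := leP 0 x.
  pose g (x : R) := ln (1 + x) - (x - x ^+ 2 / 2).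
  have g0 : g 0 = 0 by rewrite /g addr0 ln1; ring.
  suff : g 0 <= g x by rewrite g0 /g; have : 0 <= `|x| ^+ 3 by []; lra.
  apply: (is_derive_ge0_le (f' := fun y => y ^+ 2 / (1 + y)) x0).
    move=> y /andP[y0 _]; have dy := dl y ltac:(lra).
    by apply: is_derive_eq; rewrite /GRing.scale/=; field; rewrite gt_eqF//; lra.
  by move=> y /andP[y0 _]; apply: divr_ge0; [exact: sqr_ge0|lra].
rewrite ltr0_norm//.
pose g (x : R) := x - x ^+ 2 / 2 + 2 * x ^+ 3 - ln (1 + x).
have g0 : g 0 = 0 by rewrite /g addr0 ln1; ring.
suff : g x <= g 0 by rewrite g0 /g (_ : (- x) ^+ 3 = - x ^+ 3); [lra|ring].
apply: (@is_derive_ge0_le g (fun y => y ^+ 2 * (5 + 6 * y) / (1 + y))).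
- exact: ltW.
- move=> y /andP[xy _]; have dy := dl y ltac:(lra).
  by apply: is_derive_eq; rewrite /GRing.scale/=; field; rewrite gt_eqF//; lra.
- move=> y /andP[xy y0]; apply: divr_ge0; last by lra.
  by apply: mulr_ge0; [exact: sqr_ge0|lra].
Qed.

Lemma ln_quadratic_ge (a q B t : R) : 1 <= B -> `|a| <= B -> 0 <= q <= 2 * B ^+ 2 ->
  0 <= t -> t * B <= 1 / 8 ->
  0 < 1 - 2 * t * a + t ^+ 2 * q /\
  - (2 * t * a) + t ^+ 2 * (q - 2 * a ^+ 2) - 70 * t ^+ 3 * B ^+ 3 <=
    ln (1 - 2 * t * a + t ^+ 2 * q).
Proof.
move=> B1 aB /andP[q0 qB] t0 tB.
pose u := t * B; pose x := - (2 * t * a) + t ^+ 2 * q.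
have u0 : 0 <= u by rewrite mulr_ge0//; lra.
have ta : `|t * a| <= u by rewrite normrM (ger0_norm t0) ler_wpM2l.
have tq0 : 0 <= t ^+ 2 * q by rewrite mulr_ge0 ?sqr_ge0.
have tq : t ^+ 2 * q <= 2 * u ^+ 2.
  by rewrite exprMn mulrCA ler_wpM2l ?sqr_ge0.
have u8 : u <= 1 / 8 by [].
move: ta; rewrite ler_norml => /andP[ta1 ta2].
have x3 : `|x| <= 3 * u by rewrite ler_norml /x; apply/andP; split; nra.
have x12 : - (1 / 2) <= x by move: x3; rewrite ler_norml; lra.
have e : 1 - 2 * t * a + t ^+ 2 * q = 1 + x by rewrite /x; ring.
rewrite e; split; first by lra.
apply: le_trans (ln1D_ge x12).
have h3 : `|x| ^+ 3 <= 27 * u ^+ 3.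
  have -> : 27 * u ^+ 3 = (3 * u) ^+ 3 by ring.
  by rewrite lerXn2r ?nnegrE// mulr_ge0.
have h2 : x ^+ 2 <= 4 * (t * a) ^+ 2 + 12 * u ^+ 3.
  have -> : x ^+ 2 = 4 * (t * a) ^+ 2 + t ^+ 2 * q * (t ^+ 2 * q - 4 * (t * a)) by rewrite /x; ring.
  rewrite lerD2l; apply: (@le_trans _ _ (2 * u ^+ 2 * (5 * u))); last by nra.
  apply: (@le_trans _ _ (t ^+ 2 * q * (5 * u))); first by rewrite ler_wpM2l//; nra.
  by rewrite ler_wpM2r//; lra.
have -> : - (2 * t * a) + t ^+ 2 * (q - 2 * a ^+ 2) - 70 * t ^+ 3 * B ^+ 3 =
   x - 2 * (t * a) ^+ 2 - 70 * u ^+ 3 by rewrite /x /u; ring.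
have u3 : 0 <= u ^+ 3 by rewrite exprn_ge0.
lra.
Qed.

Lemma le0_of_le_linear (s M t1 : R) : 0 < t1 ->
  (forall t, 0 < t <= t1 -> s <= M * t) -> s <= 0.
Proof.
move=> t10 h; rewrite leNgt; apply/negP => s0.
have M0 : 0 < M.
  by have := h t1; rewrite t10 lexx => /(_ isT) sM; rewrite -(pmulr_lgt0 _ t10); exact: lt_le_trans sM.
pose t := Num.min t1 (s / (2 * M)).
have t0 : 0 < t by rewrite lt_min t10 divr_gt0// mulr_gt0.
have : s <= M * t by apply: h; rewrite t0 ge_min lexx.
have : M * t <= M * (s / (2 * M)) by rewrite (ler_wpM2l (ltW M0))// ge_min lexx orbT.
have -> : M * (s / (2 * M)) = s / 2 by field; rewrite gt_eqF.
lra.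
Qed.

End LogBounds.

(** * Expansions along great circles through the pole *)

Section Horocycle.
Context {R : realType}.

(* The squared length of the spherical gradient of [- sum_i ln (1 - dot y (v i))] at [y]. *)
Definition grad_sq n (v : 'I_n -> R3 R) (y : R3 R) : R :=
  \sum_i \sum_j (dot (v i) (v j) - dot y (v i) * dot y (v j)) /
    ((1 - dot y (v i)) * (1 - dot y (v j))).

(** [f] and [g] are meant as the coordinates, in an orthonormal basis of the tangent plane at [y],
    of the tangential parts of the points. *)
Lemma grad_sqE n (v : 'I_n -> R3 R) (y : R3 R) (f g : 'I_n -> R) :
  (forall i j, dot (v i) (v j) - dot y (v i) * dot y (v j) = f i * f j + g i * g j) ->
  grad_sq v y = (\sum_i f i / (1 - dot y (v i))) ^+ 2 + (\sum_i g i / (1 - dot y (v i))) ^+ 2.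
Proof.
move=> e; rewrite !expr2 !big_distrlr -big_split/=; apply: eq_bigr => i _.
rewrite -big_split/=; apply: eq_bigr => j _; rewrite e invfM; ring.
Qed.

(** For the complex number [w = a + i b] the fractions are the real and imaginary parts of
    [(w + t) / (1 - t * w)], the stereographic image once the centre of projection has moved. Its
    expansion [w + t * (1 + w^2)] is how the sum of squares enters. *)
Lemma mobius_taylor (a b B t : R) : 1 <= B -> `|a| <= B -> `|b| <= B ->
  a ^+ 2 + b ^+ 2 <= 2 * B ^+ 2 -> 0 <= t -> t * B <= 1 / 8 ->
  let q := a ^+ 2 + b ^+ 2 in let D := 1 - 2 * t * a + t ^+ 2 * q in
  `|(a + t - t ^+ 2 * a - t * q) / D - (a + t * (1 + (a ^+ 2 - b ^+ 2)))| <= 18 * B ^+ 3 * t ^+ 2 /\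
  `|b * (1 + t ^+ 2) / D - (b + t * (2 * a * b))| <= 18 * B ^+ 3 * t ^+ 2.
Proof.
move=> B1 aB bB qB t0 tB q D; have B0 : 0 < B by lra.
have q0 : 0 <= q by rewrite addr_ge0 ?sqr_ge0.
have B2 : 1 <= B ^+ 2 by rewrite expr_ge1// ltW.
have ta : `|t * a| <= 1 / 8 by rewrite normrM (ger0_norm t0); apply: le_trans tB; rewrite ler_wpM2l.
have tq : t * q <= B / 4.
  by apply: (@le_trans _ _ (t * (2 * B ^+ 2))); [rewrite ler_wpM2l|nra].
have tq0 : 0 <= t ^+ 2 * q by rewrite mulr_ge0 ?sqr_ge0.
have D2 : 1 / 2 <= D by move: ta; rewrite ler_norml /D => /andP[_ ta]; lra.
have D0 : 0 < D by lra.
have h3 : `|2 * a - t * q| <= 3 * B.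
  move: aB; rewrite !ler_norml => /andP[? ?]; have : 0 <= t * q by rewrite mulr_ge0.
  by move=> ?; apply/andP; split; lra.
have aux (N : R) : `|N| <= 9 * B ^+ 3 -> `|t ^+ 2 * N / D| <= 18 * B ^+ 3 * t ^+ 2.
  move=> NB; rewrite normrM normfV normrM (gtr0_norm D0) (ger0_norm (sqr_ge0 t)) ler_pdivrMr//.
  have t20 := sqr_ge0 t; have B3 : 0 <= B ^+ 3 by rewrite exprn_ge0// ltW.
  apply: (@le_trans _ _ (t ^+ 2 * (9 * B ^+ 3))); first by rewrite ler_wpM2l.
  have : 0 <= B ^+ 3 * t ^+ 2 by rewrite mulr_ge0.
  by move: D2; move: (B ^+ 3) (t ^+ 2) => x y; nra.
split.
- have -> : (a + t - t ^+ 2 * a - t * q) / D - (a + t * (1 + (a ^+ 2 - b ^+ 2))) =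
     t ^+ 2 * (- (a * (1 + q)) + (1 + (a ^+ 2 - b ^+ 2)) * (2 * a - t * q)) / D.
    by move: D0; rewrite /D /q => D0; field; exact: lt0r_neq0.
  apply: aux; apply: (le_trans (ler_normD _ _)).
  rewrite normrN !normrM.
  have h1 : `|a| * `|1 + q| <= B * (3 * B ^+ 2).
    have q1 : 0 <= 1 + q by rewrite addr_ge0.
    by rewrite (ger0_norm q1) ler_pM//; move: qB; rewrite -/q; lra.
  have h2 : `|1 + (a ^+ 2 - b ^+ 2)| * `|2 * a - t * q| <= (2 * B ^+ 2) * (3 * B).
    rewrite ler_pM// ler_norml.
    have := sqr_ge0 a; have := sqr_ge0 b.
    have : a ^+ 2 <= B ^+ 2 by rewrite -real_normK ?num_real// lerXn2r ?nnegrE// ltW.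
    have : b ^+ 2 <= B ^+ 2 by rewrite -real_normK ?num_real// lerXn2r ?nnegrE// ltW.
    by move=> *; apply/andP; split; lra.
  by apply: (le_trans (lerD h1 h2)); rewrite le_eqVlt; apply/orP; left; apply/eqP; ring.
- have -> : b * (1 + t ^+ 2) / D - (b + t * (2 * a * b)) =
     t ^+ 2 * (b * (1 - q) + (2 * a) * b * (2 * a - t * q)) / D.
    by move: D0; rewrite /D /q => D0; field; exact: lt0r_neq0.
  apply: aux; apply: (le_trans (ler_normD _ _)).
  rewrite !normrM.
  have h1 : `|b| * `|1 - q| <= B * (2 * B ^+ 2).
    by rewrite ler_pM// ler_norml; move: qB; rewrite -/q => qB; apply/andP; split; lra.
  have h2 : `|2| * `|a| * `|b| * `|2 * a - t * q| <= (2 * B * B) * (3 * B).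
    by rewrite !ler_pM// ?mulr_ge0// ger0_norm.
  apply: (le_trans (lerD h1 h2)).
  have B3 : 0 <= B ^+ 3 by rewrite exprn_ge0// ltW.
  have -> : B * (2 * B ^+ 2) + 2 * B * B * (3 * B) = 8 * B ^+ 3 by ring.
  lra.
Qed.

(* The point whose stereographic image, projecting from the north pole, is (c / t, s / t). *)
Definition horo (c s t : R) : R3 R :=
  (2 * t * c / (1 + t ^+ 2), 2 * t * s / (1 + t ^+ 2), (1 - t ^+ 2) / (1 + t ^+ 2)).

Let sq1 (t : R) : 0 < 1 + t ^+ 2.
Proof. by rewrite ltr_pwDl// sqr_ge0. Qed.

Lemma dot_horo_self c s t : c ^+ 2 + s ^+ 2 = 1 -> dot (horo c s t) (horo c s t) = 1.
Proof.
move=> cs; rewrite /dot/=.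
transitivity ((4 * t ^+ 2 * (c ^+ 2 + s ^+ 2) + (1 - t ^+ 2) ^+ 2) / (1 + t ^+ 2) ^+ 2).
  by field; rewrite gt_eqF.
by rewrite cs; field; rewrite gt_eqF.
Qed.

Lemma one_sub_dot_horo c s t (X : R3 R) : 1 - dot (horo c s t) X =
  (1 - X.2 - 2 * t * (c * X.1.1 + s * X.1.2) + t ^+ 2 * (1 + X.2)) / (1 + t ^+ 2).
Proof. by rewrite /dot/=; field; rewrite gt_eqF. Qed.

Variables (n : nat) (X : 'I_n -> R3 R).
Hypothesis X1 : forall i, dot (X i) (X i) = 1.

Let a (c s : R) i := c * (stereo (X i)).1 + s * (stereo (X i)).2.
Let q i := (1 + (X i).2) / (1 - (X i).2).
(** A common bound: when no point is at the pole, unit length gives [|a c s i| <= B] and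
    [q i <= 2 * B ^+ 2]. The summand 1 ensures [1 <= B]. *)
Let B : R := 1 + \sum_i (1 - (X i).2)^-1.

Lemma unit_coord_le1 (c s : R) i : c ^+ 2 + s ^+ 2 = 1 ->
  `|c * (X i).1.1 + s * (X i).1.2| <= 1 /\ `|(X i).2| <= 1.
Proof.
move=> cs; have := X1 i; rewrite /dot; case: (X i) => [[x y] z]/= e.
split; rewrite -(@ler_pXn2r _ 2) ?nnegrE// -normrX expr1n ger0_norm ?sqr_ge0//.
  have : (c * x + s * y) ^+ 2 + (s * x - c * y) ^+ 2 = x ^+ 2 + y ^+ 2.
    by rewrite -[RHS]mul1r -cs; ring.
  have := sqr_ge0 (s * x - c * y); have := sqr_ge0 z; nra.
by have := sqr_ge0 x; have := sqr_ge0 y; nra.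
Qed.

Let c1s0 : (1 : R) ^+ 2 + 0 ^+ 2 = 1.
Proof. by rewrite expr1n expr0n addr0. Qed.

Let X2_le1 i : (X i).2 <= 1.
Proof. by have [_] := unit_coord_le1 i c1s0; rewrite ler_norml => /andP[]. Qed.

Let X2_geN1 i : -1 <= (X i).2.
Proof. by have [_] := unit_coord_le1 i c1s0; rewrite ler_norml => /andP[]. Qed.

Let inv_le_B i : (1 - (X i).2)^-1 <= B.
Proof.
rewrite /B (bigD1 i)//= addrCA lerDl addr_ge0// sumr_ge0// => j _.
by rewrite invr_ge0 subr_ge0.
Qed.

Let B1 : 1 <= B.
Proof. by rewrite lerDl sumr_ge0// => j _; rewrite invr_ge0 subr_ge0. Qed.

Definition pole_max := exists2 t0 : R, 0 < t0 & forall c s t,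
  c ^+ 2 + s ^+ 2 = 1 -> 0 <= t <= t0 ->
  \prod_i (1 - dot (horo c s t) (X i)) <= \prod_i (1 - (X i).2).

(** If a point sat at the pole the product would vanish there, whereas it is positive at
    [horo 1 0 t] for small [t > 0]. *)
Lemma pole_max_lt1 : pole_max -> forall i, (X i).2 < 1.
Proof.
move=> [t0 t00 h] k; rewrite lt_neqAle X2_le1 andbT; apply/negP => /eqP k1.
have B0 : 0 < B := lt_le_trans ltr01 B1.
pose t := Num.min t0 (4 * B)^-1.
have tp : 0 < t by rewrite lt_min t00 invr_gt0 mulr_gt0.
have tB : t * B <= 1 / 4.
  apply: (@le_trans _ _ ((4 * B)^-1 * B)); first by rewrite ler_wpM2r ?(ltW B0)// ge_min lexx orbT.
  by rewrite invfM -mulrA mulVf ?gt_eqF// mulr1 div1r.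
have := h 1 0 t c1s0; rewrite (ltW tp) ge_min lexx => /(_ isT).
rewrite [leRHS](bigD1 k)//= k1 subrr mul0r leNgt => /negP; apply.
apply: prodr_gt0 => i _; rewrite one_sub_dot_horo divr_gt0// mul1r mul0r addr0.
have [Xi1|Xi1] := eqVneq (X i).2 1.
  have := X1 i; rewrite /dot Xi1 => e.
  have -> : (X i).1.1 = 0.
    apply/eqP; rewrite -sqrf_eq0 eq_le sqr_ge0 andbT.
    by have := sqr_ge0 (X i).1.2; nra.
  by rewrite subrr mulr0 subr0 add0r mulr_gt0 ?exprn_gt0.
have Xi : 0 < 1 - (X i).2 by rewrite subr_gt0 lt_neqAle Xi1 X2_le1.
have := unit_coord_le1 i c1s0; rewrite mul1r mul0r addr0 => -[x1 _].
move: x1; rewrite ler_norml => /andP[_ x1].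
have iB : 1 <= B * (1 - (X i).2) by have := inv_le_B i; rewrite -ler_pdivrMr// mul1r.
have : 0 <= t ^+ 2 * (1 + (X i).2) by rewrite mulr_ge0 ?sqr_ge0//; have := X2_geN1 i; lra.
have : t <= (1 - (X i).2) / 4.
  by rewrite -(ler_pM2r B0); apply: le_trans tB _; lra.
nra.
Qed.

Section Below.
Hypothesis X2_lt1 : forall i, (X i).2 < 1.

Let X2p i : 0 < 1 - (X i).2.
Proof. by rewrite subr_gt0. Qed.

Let a_le (c s : R) i : c ^+ 2 + s ^+ 2 = 1 -> `|a c s i| <= B.
Proof.
move=> cs; have -> : a c s i = (c * (X i).1.1 + s * (X i).1.2) / (1 - (X i).2).
  by rewrite /a /stereo/=; field; exact: lt0r_neq0 (X2p i).
rewrite normrM normfV (gtr0_norm (X2p i)).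
apply: le_trans (inv_le_B i); rewrite ler_piMl ?invr_ge0 ?(ltW (X2p i))//.
by have [] := unit_coord_le1 i cs.
Qed.

Let q_bound i : 0 <= q i <= 2 * B ^+ 2.
Proof.
have h : 0 <= 1 + (X i).2 by have := X2_geN1 i; lra.
rewrite /q divr_ge0 ?(ltW (X2p i))//=.
apply: (@le_trans _ _ (2 * B)).
  rewrite ler_pM// ?invr_ge0 ?(ltW (X2p i))//; first by have := X2_le1 i; lra.
by rewrite ler_wpM2l// ler_eXnr.
Qed.

Lemma stereo_sqr i (c s : R) : c ^+ 2 + s ^+ 2 = 1 ->
  q i = a c s i ^+ 2 + a (- s) c i ^+ 2.
Proof.
move=> cs; transitivity ((c ^+ 2 + s ^+ 2) * ((stereo (X i)).1 ^+ 2 + (stereo (X i)).2 ^+ 2)); last first.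
  by rewrite /a; ring.
rewrite cs mul1r /q /stereo/=; have := X1 i; rewrite /dot => e.
have -> : ((X i).1.1 / (1 - (X i).2)) ^+ 2 + ((X i).1.2 / (1 - (X i).2)) ^+ 2 =
   ((X i).1.1 * (X i).1.1 + (X i).1.2 * (X i).1.2) / (1 - (X i).2) ^+ 2.
  by field; exact: lt0r_neq0 (X2p i).
have -> : (X i).1.1 * (X i).1.1 + (X i).1.2 * (X i).1.2 = 1 - (X i).2 * (X i).2 by lra.
by field; exact: lt0r_neq0 (X2p i).
Qed.

(** Divided by its value at the pole, each factor becomes [(1 - 2 * t * a + t ^+ 2 * q) / (1 + t ^+
    2)]. After taking logarithms, order [t] gives the first moment a sign in every direction, so it
    vanishes by reversing the direction; order [t ^+ 2] gives the second claim, where [n] comes from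
    the denominators. *)
Lemma pole_max_moments (c s : R) : pole_max -> c ^+ 2 + s ^+ 2 = 1 ->
  \sum_i a c s i = 0 /\ \sum_i (q i - 2 * a c s i ^+ 2) <= n%:R.
Proof.
move=> [t0 t00 h] cs; have B0 : 0 < B := lt_le_trans ltr01 B1.
pose K : R := n%:R * (70 * B ^+ 3).
pose t1 := Num.min t0 (8 * B)^-1.
have t10 : 0 < t1 by rewrite lt_min t00 invr_gt0 mulr_gt0.
have main c' s' t : c' ^+ 2 + s' ^+ 2 = 1 -> 0 < t <= t1 ->
    t ^+ 2 * \sum_i (q i - 2 * a c' s' i ^+ 2) <= 2 * t * \sum_i a c' s' i + n%:R * t ^+ 2 + K * t ^+ 3.
  move=> cs' /andP[tp tt1].
  have tB : t * B <= 1 / 8.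
    apply: (@le_trans _ _ ((8 * B)^-1 * B)).
      by rewrite ler_wpM2r ?(ltW B0)// (le_trans tt1)// ge_min lexx orbT.
    by rewrite invfM -mulrA mulVf ?gt_eqF// mulr1 div1r.
  have lnD i := ln_quadratic_ge B1 (a_le i cs') (q_bound i) (ltW tp) tB.
  have D0 i := (lnD i).1.
  have hD : \prod_i (1 - 2 * t * a c' s' i + t ^+ 2 * q i) <= (1 + t ^+ 2) ^+ n.
    have := h c' s' t cs'; rewrite (ltW tp) (le_trans tt1) ?ge_min ?lexx// => /(_ isT).
    have P0 : 0 < \prod_i (1 - (X i).2) by apply: prodr_gt0.
    have -> : \prod_i (1 - dot (horo c' s' t) (X i)) =
       \prod_i (1 - (X i).2) * (\prod_i (1 - 2 * t * a c' s' i + t ^+ 2 * q i) / (1 + t ^+ 2) ^+ n).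
      rewrite -[in X in _ / _ ^+ X](card_ord n) -prodr_const -prodf_div -big_split/=.
      apply: eq_bigr => i _; rewrite one_sub_dot_horo /a /q /stereo/=.
      by field; rewrite !(lt0r_neq0 (X2p i)) (lt0r_neq0 (sq1 t)).
    by rewrite -[leRHS]mulr1 ler_pM2l// ler_pdivrMr ?exprn_gt0// mul1r.
  have hln : \sum_i ln (1 - 2 * t * a c' s' i + t ^+ 2 * q i) <= n%:R * t ^+ 2.
    rewrite -ler_expR expR_sum.
    under eq_bigr => i _ do rewrite lnK ?posrE//.
    apply: le_trans hD _; rewrite expRM_natl.
    by rewrite lerXn2r ?nnegrE ?expR_ge0 ?(ltW (sq1 t))// expR_ge1Dx.
  have hs : \sum_i (- (2 * t * a c' s' i) + t ^+ 2 * (q i - 2 * a c' s' i ^+ 2) - 70 * t ^+ 3 * B ^+ 3)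
     <= n%:R * t ^+ 2 by apply: le_trans hln; apply: ler_sum => i _; exact: (lnD i).2.
  move: hs; rewrite sumrB sumr_const card_ord big_split/= -mulr_sumr sumrN -mulr_sumr -mulr_natl /K; lra.
have sumge0 c' s' : c' ^+ 2 + s' ^+ 2 = 1 -> 0 <= \sum_i a c' s' i.
  move=> cs'; rewrite -oppr_le0.
  pose Q := \sum_i (q i - 2 * a c' s' i ^+ 2).
  apply: (le0_of_le_linear (M := (n%:R + K * t1 + `|Q|)) t10) => t tt; have /andP[tp tt1] := tt.
  have := main c' s' t cs' tt; rewrite -/Q => m.
  have K0 : 0 <= K by rewrite mulr_ge0// mulr_ge0// exprn_ge0// ltW.
  rewrite -(ler_pM2l (x := 2 * t)) ?mulr_gt0//.
  have h1 : K * t ^+ 3 <= K * t1 * t ^+ 2.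
    have -> : K * t ^+ 3 = K * t * t ^+ 2 by ring.
    by rewrite ler_wpM2r ?sqr_ge0// ler_wpM2l.
  have h2 : - t ^+ 2 * Q <= t ^+ 2 * `|Q|.
    by rewrite mulNr -mulrN ler_wpM2l ?sqr_ge0// -normrN ler_norm.
  have h3 : 0 <= (n%:R + K * t1 + `|Q|) * t ^+ 2.
    by rewrite mulr_ge0 ?sqr_ge0// !addr_ge0// mulr_ge0// ltW.
  lra.
have sum0 : \sum_i a c s i = 0.
  apply/eqP; rewrite eq_le sumge0// andbT.
  have := sumge0 (- c) (- s); rewrite !sqrrN => /(_ cs).
  have -> : \sum_i a (- c) (- s) i = - \sum_i a c s i.
    by rewrite -sumrN; apply: eq_bigr => i _; rewrite /a; ring.
  by rewrite oppr_ge0.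
split=> //; rewrite -subr_le0.
apply: (le0_of_le_linear (M := K) t10) => t tt; have /andP[tp _] := tt.
have := main c s t cs tt; rewrite sum0 mulr0 add0r => m.
rewrite -(ler_pM2l (x := t ^+ 2)) ?exprn_gt0//; lra.
Qed.

(** At distance [t] the sum of W, zero at the pole, becomes [t * (n + sum of W^2)] up to an error
    [n * t / 4] in each coordinate. The coordinates are thus at most [9 / 4] and [5 / 4] times
    [n * t], and the sum of their squares stays below [9 * n ^+ 2 * t ^+ 2]. *)
Lemma horo_grad_sq : pole_max -> exists2 t1 : R, 0 < t1 & forall c s t,
  c ^+ 2 + s ^+ 2 = 1 -> 0 <= t <= t1 ->
  grad_sq X (horo c s t) <= 9 * n%:R ^+ 2 * t ^+ 2.
Proof.
move=> mx; have B0 : 0 < B := lt_le_trans ltr01 B1.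
have B30 : 0 < B ^+ 3 by rewrite exprn_gt0.
(* For such [t] the error [18 * B ^+ 3 * t ^+ 2] of [mobius_taylor] is at most [t / 4] for each
   point. *)
exists (72 * B ^+ 3)^-1; first by rewrite invr_gt0 mulr_gt0.
move=> c s t cs /andP[t0 tt1].
have tB3 : t * (72 * B ^+ 3) <= 1 by rewrite -ler_pdivlMr ?mulr_gt0// div1r.
have tB : t * B <= 1 / 8.
  have : B <= B ^+ 3 by rewrite ler_eXnr.
  by move=> /(ler_wpM2l t0); lra.
have sc : (- s) ^+ 2 + c ^+ 2 = 1 by rewrite sqrrN addrC.
pose al := a c s; pose be := a (- s) c.
have qE i : q i = al i ^+ 2 + be i ^+ 2 by exact: stereo_sqr.
pose f i := ((1 - t ^+ 2) * (c * (X i).1.1 + s * (X i).1.2) - 2 * t * (X i).2) / (1 + t ^+ 2).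
pose g i := - s * (X i).1.1 + c * (X i).1.2.
have fg i j : dot (X i) (X j) - dot (horo c s t) (X i) * dot (horo c s t) (X j) =
    f i * f j + g i * g j.
  transitivity ((c ^+ 2 + s ^+ 2) * ((X i).1.1 * (X j).1.1 + (X i).1.2 * (X j).1.2) +
    (X i).2 * (X j).2 - dot (horo c s t) (X i) * dot (horo c s t) (X j)).
    by rewrite cs mul1r.
  by rewrite /f /g /dot/=; field; exact: lt0r_neq0 (sq1 t).
rewrite (grad_sqE fg).
have D0 i : 0 < 1 - 2 * t * al i + t ^+ 2 * q i.
  by have [] := ln_quadratic_ge B1 (a_le i cs) (q_bound i) t0 tB.
have D0' i : 0 < 1 - (X i).2 - 2 * t * (c * (X i).1.1 + s * (X i).1.2) + t ^+ 2 * (1 + (X i).2).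
  have -> : 1 - (X i).2 - 2 * t * (c * (X i).1.1 + s * (X i).1.2) + t ^+ 2 * (1 + (X i).2) =
    (1 - (X i).2) * (1 - 2 * t * al i + t ^+ 2 * q i).
    by rewrite /al /a /q /stereo/=; field; exact: lt0r_neq0 (X2p i).
  by rewrite mulr_gt0.
have fE i : f i / (1 - dot (horo c s t) (X i)) =
    (al i + t - t ^+ 2 * al i - t * q i) / (1 - 2 * t * al i + t ^+ 2 * q i).
  have := D0 i; have := D0' i; rewrite one_sub_dot_horo /f /al /a /q /stereo/=.
  have := X2p i; have := sq1 t; move: ((X i).1.1) ((X i).1.2) ((X i).2) => x y z h1 h2 h3 h4.
  apply/eqP; rewrite eqr_div ?lt0r_neq0 ?divr_gt0//; apply/eqP.
  by field; rewrite !lt0r_neq0.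
have gE i : g i / (1 - dot (horo c s t) (X i)) =
    be i * (1 + t ^+ 2) / (1 - 2 * t * al i + t ^+ 2 * q i).
  have := D0 i; have := D0' i; rewrite one_sub_dot_horo /g /al /be /a /q /stereo/=.
  have := X2p i; have := sq1 t; move: ((X i).1.1) ((X i).1.2) ((X i).2) => x y z h1 h2 h3 h4.
  apply/eqP; rewrite eqr_div ?lt0r_neq0 ?divr_gt0//; apply/eqP.
  by field; rewrite !lt0r_neq0.
under eq_bigr do rewrite fE.
under [X in _ + X ^+ 2 <= _]eq_bigr do rewrite gE.
have tay i : `|(al i + t - t ^+ 2 * al i - t * q i) / (1 - 2 * t * al i + t ^+ 2 * q i) -
      (al i + t * (1 + (al i ^+ 2 - be i ^+ 2)))| <= 18 * B ^+ 3 * t ^+ 2 /\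
    `|be i * (1 + t ^+ 2) / (1 - 2 * t * al i + t ^+ 2 * q i) - (be i + t * (2 * al i * be i))|
      <= 18 * B ^+ 3 * t ^+ 2.
  have := mobius_taylor B1 (a_le i cs) (a_le i sc); rewrite -(stereo_sqr i cs).
  by have /andP[_ qB] := q_bound i => /(_ _ qB t0 tB).
have r2 : 0 < Num.sqrt 2 :> R by rewrite sqrtr_gt0.
have r22 : Num.sqrt 2 ^+ 2 = 2 :> R by rewrite sqr_sqrtr.
have [al0 al2] := pole_max_moments mx cs.
have [be0 be2] := pole_max_moments mx sc.
(* The second-order condition along [(c, s)] and its perpendicular controls the real part of the sum
   of squares; the directions turned by 45 degrees control the imaginary part. *)
have diag (c' s' : R) : c' ^+ 2 + s' ^+ 2 = 1 ->
    ((c' - s') / Num.sqrt 2) ^+ 2 + ((s' + c') / Num.sqrt 2) ^+ 2 = 1.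
  move=> cs'; rewrite !exprMn -mulrDl exprVn r22.
  by rewrite (_ : _ + _ = 2 * (c' ^+ 2 + s' ^+ 2)); [rewrite cs'; field|ring].
have [_ ab1] := pole_max_moments mx (diag _ _ cs).
have [_ ab2] := pole_max_moments mx (diag _ _ sc).
have sum1 : `|\sum_i (al i ^+ 2 - be i ^+ 2)| <= n%:R.
  rewrite ler_norml; apply/andP; split; [rewrite lerNl -sumrN; apply: le_trans al2|apply: le_trans be2];
    by rewrite le_eqVlt; apply/orP; left; apply/eqP; apply: eq_bigr => i _; rewrite qE /al /be; ring.
have sum2 : `|\sum_i (2 * al i * be i)| <= n%:R.
  have sq2 (x y : R) i : a ((x - y) / Num.sqrt 2) ((y + x) / Num.sqrt 2) i ^+ 2 =
      (a x y i + a (- y) x i) ^+ 2 / 2.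
    rewrite -[in RHS]r22 /a; move: (Num.sqrt 2 : R) r2 => r r0.
    by field; exact: lt0r_neq0.
  have ss i : a (- c) (- s) i = - al i by rewrite /a /al /a; ring.
  rewrite ler_norml; apply/andP; split; [rewrite lerNl -sumrN; apply: le_trans ab1|apply: le_trans ab2];
    rewrite le_eqVlt; apply/orP; left; apply/eqP; apply: eq_bigr => i _; rewrite sq2.
    by rewrite qE -/(al i) -/(be i); field.
  by rewrite ss qE -/(be i); field.
have close (F G : 'I_n -> R) : (forall i, `|F i - G i| <= 18 * B ^+ 3 * t ^+ 2) ->
    `|\sum_i F i - \sum_i G i| <= n%:R * t / 4.
  move=> FG; rewrite -sumrB; apply: (le_trans (ler_norm_sum _ _ _)).
  apply: (@le_trans _ _ (\sum_(i < n) (t / 4))).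
    apply: ler_sum => i _; apply: (le_trans (FG i)).
    have : t * (t * (72 * B ^+ 3)) <= t * 1 by rewrite ler_wpM2l.
    lra.
  by rewrite sumr_const card_ord -[leLHS]mulr_natl mulrA.
have n0 : 0 <= n%:R :> R by [].
have hA := close _ _ (fun i => (tay i).1); have hB := close _ _ (fun i => (tay i).2).
have splitE (u w : 'I_n -> R) : \sum_i (u i + t * w i) = \sum_i u i + t * \sum_i w i.
  by rewrite big_split/= mulr_sumr.
move: hA hB; rewrite !splitE (_ : \sum_i al i = 0)// (_ : \sum_i be i = 0)// !add0r.
rewrite [\sum_i (1 + _)]big_split/= sumr_const card_ord.
move: sum1 sum2; move: (\sum_i (al i ^+ 2 - be i ^+ 2)) (\sum_i 2 * al i * be i) => S1 S2.
set SA := \sum_i _; set SB := \sum_i _.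
move=> /ler_normlP[S11 S12] /ler_normlP[S21 S22] /ler_normlP[A1 A2] /ler_normlP[H1 H2].
have nt0 : 0 <= n%:R * t by rewrite mulr_ge0.
have S11' : t * - S1 <= t * n%:R by rewrite ler_wpM2l.
have S12' : t * S1 <= t * n%:R by rewrite ler_wpM2l.
have S21' : t * - S2 <= t * n%:R by rewrite ler_wpM2l.
have S22' : t * S2 <= t * n%:R by rewrite ler_wpM2l.
clearbody SA SB; clear - nt0 A1 A2 H1 H2 S11' S12' S21' S22'.
have SA1 : `|SA| <= 9 / 4 * (n%:R * t) by rewrite ler_norml; apply/andP; split; lra.
have SB1 : `|SB| <= 5 / 4 * (n%:R * t) by rewrite ler_norml; apply/andP; split; lra.
have SA2 : SA ^+ 2 <= (9 / 4 * (n%:R * t)) ^+ 2.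
  by rewrite -real_normK ?num_real// lerXn2r ?nnegrE// mulr_ge0.
have SB2 : SB ^+ 2 <= (5 / 4 * (n%:R * t)) ^+ 2.
  by rewrite -real_normK ?num_real// lerXn2r ?nnegrE// mulr_ge0.
apply: (le_trans (lerD SA2 SB2)).
by rewrite -subr_ge0; have := sqr_ge0 (n%:R * t); rewrite !exprMn; lra.
Qed.

End Below.
End Horocycle.

(** * Caps around the local maxima of a fixed configuration *)

Section LocalMaxima.
Context {R : realType}.
Local Notation mu := (@lebesgue_measure R).
Local Notation sigma := (@sigma R).

Definition unframe (u : R * R) (x : R3 R) : R3 R :=
  rotZ u.2 (u.1 * x.1.1 + Num.sqrt (1 - u.1 ^+ 2) * x.2, x.1.2,
    u.1 * x.2 - Num.sqrt (1 - u.1 ^+ 2) * x.1.1).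

Lemma unframeK u : -1 <= u.1 <= 1 -> cancel (unframe u) (frame u).
Proof.
case: u => c p /= c1 [[x y] z]; have := sqrt1B_sqr c1; rewrite /frame /unframe /tilt /rotZ/= cosN sinN.
move: (Num.sqrt _) => s s2; have := cos2Dsin2 p; move: (cos p) (sin p) => e f ef.
congr (_, _, _).
- transitivity ((e ^+ 2 + f ^+ 2) * c * (c * x + s * z) - s * (c * z - s * x)); first by ring.
  rewrite ef; transitivity (c ^+ 2 * x + s ^+ 2 * x); first by ring.
  by rewrite s2; ring.
- transitivity ((e ^+ 2 + f ^+ 2) * y); first by ring.
  by rewrite ef mul1r.
- transitivity ((e ^+ 2 + f ^+ 2) * s * (c * x + s * z) + c * (c * z - s * x)); first by ring.
  rewrite ef; transitivity (c ^+ 2 * z + s ^+ 2 * z); first by ring.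
  by rewrite s2; ring.
Qed.

Lemma dotC (x y : R3 R) : dot x y = dot y x.
Proof. by rewrite /dot; ring. Qed.

Lemma dot_le1 (x y : R3 R) : dot x x = 1 -> dot y y = 1 -> dot x y <= 1.
Proof.
rewrite /dot; case: x y => [[x1 x2] x3] [[y1 y2] y3]/= hx hy.
by have := sqr_ge0 (x1 - y1); have := sqr_ge0 (x2 - y2); have := sqr_ge0 (x3 - y3); nra.
Qed.

Lemma dot_eq1 (x y : R3 R) : dot x x = 1 -> dot y y = 1 -> dot x y = 1 -> x = y.
Proof.
rewrite /dot; case: x y => [[x1 x2] x3] [[y1 y2] y3]/= hx hy hxy.
have e : (x1 - y1) ^+ 2 + (x2 - y2) ^+ 2 + (x3 - y3) ^+ 2 = 0.
  rewrite (_ : _ + _ = (x1 * x1 + x2 * x2 + x3 * x3) + (y1 * y1 + y2 * y2 + y3 * y3) -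
     2 * (x1 * y1 + x2 * y2 + x3 * y3)); last by ring.
  by rewrite hx hy hxy; ring.
have h1 := sqr_ge0 (x1 - y1); have h2 := sqr_ge0 (x2 - y2); have h3 := sqr_ge0 (x3 - y3).
have z (a : R) : a ^+ 2 = 0 -> a = 0 by move/eqP; rewrite sqrf_eq0 => /eqP.
have /z/eqP : (x1 - y1) ^+ 2 = 0 by lra.
have /z/eqP : (x2 - y2) ^+ 2 = 0 by lra.
have /z/eqP : (x3 - y3) ^+ 2 = 0 by lra.
by rewrite !subr_eq0 => /eqP-> /eqP-> /eqP->.
Qed.

Lemma dot_sph_frame u (x : R3 R) : -1 <= u.1 <= 1 -> dot x (sph u) = (frame u x).2.
Proof. by move=> u1; rewrite -(dot_frame _ _ u1) frame_sph// /dot/=; ring. Qed.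

Lemma measurable_dot d (T : measurableType d) (f g : T -> R3 R) :
  measurable_fun setT f -> measurable_fun setT g ->
  measurable_fun setT (fun t => dot (f t) (g t)).
Proof. by move=> mf mg; rewrite /dot; meas. Qed.

Lemma measurable_gt (d : measure_display) (T : measurableType d) (f : T -> R) (a : R) :
  measurable_fun setT f -> measurable [set t | a < f t].
Proof.
move=> mf; have := mf measurableT _ (measurable_itv `]a, +oo[); rewrite setTI.
by congr measurable; apply/seteqP; split => t; rewrite /= in_itv/= andbT.
Qed.

Lemma measurable_le (d : measure_display) (T : measurableType d) (f : T -> R) (a : R) :
  measurable_fun setT f -> measurable [set t | f t <= a].
Proof.
move=> mf; have := mf measurableT _ (measurable_itv `]-oo, a]); rewrite setTI.
by congr measurable; apply/seteqP; split => t; rewrite /= in_itv/=.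
Qed.

(** In the frame at [x] the cap is a condition on the height, which is uniform on [[-1, 1]]. *)
Lemma sigma_cap (x : R3 R) (h : R) : dot x x = 1 -> 0 <= h <= 2 ->
  sigma [set y | 1 - h < dot y x] = (h / 2)%:E.
Proof.
move=> /sph_surj[u [u1 u2 ->]] /andP[h0 h2]; have pi0 := pi_gt0 R.
have mA : measurable [set y : R3 R | 1 - h < dot y (sph u)].
  by apply: measurable_gt; apply: measurable_dot => //; meas.
have mB : measurable [set y : R3 R | 1 - h < y.2] by apply: measurable_gt; meas.
have E (y : R3 R) : (\1_[set y : R3 R | 1 - h < dot y (sph u)] y =
    \1_[set y : R3 R | 1 - h < y.2] (frame u y) :> R).
  by rewrite !indicE; congr (nat_of_bool _)%:R; apply/idP/idP; rewrite !inE/= dot_sph_frame.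
rewrite -[X in sigma X]setIT -integral_indic//.
under eq_integral do rewrite E.
rewrite (integral_sigma_frame (f := fun y => (\1_[set y : R3 R | 1 - h < y.2] y)%:E))//; last first.
  exact/measurable_EFinP.
rewrite integral_sigma//; last exact/measurable_EFinP.
have -> : (\int[mu]_(c in `[(-1)%R, 1%R]) \int[mu]_(p in `[0%R, (2 * pi)%R])
     (\1_[set y : R3 R | (1 - h < y.2)%R] (sph (c, p)))%:E =
   \int[mu]_(c in `[(-1)%R, 1%R]) ((2 * pi)%:E * (\1_(`](1 - h)%R, 1%R]%classic : set R) c)%:E))%E.
  apply: eq_integral => c /[!inE]/=; rewrite in_itv/= => /andP[c1 c2].
  rewrite (_ : (fun p => _) = cst (\1_(`](1 - h)%R, 1%R]%classic : set R) c)%:E); last first.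
    apply/funext => p; rewrite !indicE; congr (nat_of_bool _)%:R%:E.
    by apply/idP/idP; rewrite !inE/= in_itv/= c2 andbT.
  by rewrite integral_cst//= lebesgue_measure_itv/= lte_fin two_pi_gt0 muleC -EFinB subr0.
rewrite ge0_integralZl//; last 2 first.
- by apply: measurable_funTS; apply/measurable_EFinP.
- by rewrite lee_fin mulr_ge0// ltW.
rewrite integral_indic//= setIidl; last first.
  by move=> c /=; rewrite !in_itv/= => /andP[/ltW c1 ->]; rewrite andbT; apply: le_trans c1; lra.
rewrite lebesgue_measure_itv/= lte_fin.
case: ltP => hh; last first.
  have -> : h = 0 by lra.
  by rewrite !mule0 mul0r.
rewrite -EFinB -!EFinM; congr EFin; move: (pi : R) pi0 => p p0.
by field; exact: lt0r_neq0.
Qed.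

(** [sigma] is carried by the unit sphere, so the two functions need only be compared there. *)
Lemma le_integral_sigma (f g : R3 R -> \bar R) : measurable_fun setT f -> measurable_fun setT g ->
  (forall y, 0 <= f y)%E -> (forall y, 0 <= g y)%E ->
  (forall y, dot y y = 1 -> (f y <= g y)%E) -> (\int[sigma]_y f y <= \int[sigma]_y g y)%E.
Proof.
move=> mf mg f0 g0 fg; rewrite !integral_sigma// lee_wpmul2l ?lee_fin ?invr_ge0 ?mulr_ge0 ?pi_ge0//.
have msph (k : R3 R -> \bar R) : measurable_fun setT k -> measurable_fun setT (fun z : R * R => k (sph z)).
  by move=> mk; apply: (measurableT_comp mk); exact: measurable_sph.
have mint (k : R3 R -> \bar R) : measurable_fun setT k -> (forall y, 0 <= k y)%E ->
    measurable_fun setT (fun c : R => \int[mu]_(p in `[0%R, (2 * pi)%R]) k (sph (c, p)))%E.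
  move=> mk k0; exact: (measurable_integral_itv _ _ (msph _ mk) (fun z => k0 _)).
apply: ge0_le_integral => //.
- by move=> c _; exact: integral_ge0.
- by apply: measurable_funTS; exact: mint.
- by apply: measurable_funTS; exact: mint.
move=> c /=; rewrite in_itv/= => c1; have mc : measurable_fun setT (fun p : R => (c, p)) by exact: measurable_fun_pair.
apply: ge0_le_integral => //.
- by apply: measurable_funTS; apply: (measurableT_comp (msph _ mf) mc).
- by apply: measurable_funTS; apply: (measurableT_comp (msph _ mg) mc).
- by move=> p _; apply: fg; rewrite dot_sph.
Qed.

Lemma sigma_unit : sigma [set y | dot y y = 1] = 1%E.
Proof.
have md : measurable_fun setT (fun y : R3 R => dot y y) by apply: measurable_dot; meas.
have mS : measurable [set y : R3 R | dot y y = 1].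
  by have := md measurableT _ (measurable_set1 1); rewrite setTI.
apply/le_anti/andP; split; first exact: probability_le1.
rewrite -[leLHS](@probability_setT _ _ _ sigma).
rewrite -[X in (sigma X <= _)%E]setIT -integral_indic// -[X in (_ <= sigma X)%E]setIT -integral_indic//.
apply: le_integral_sigma => //; try exact/measurable_EFinP.
by move=> y y1; rewrite lee_fin !indicE in_setT mem_set.
Qed.

Lemma uniform_seq (T : eqType) (s : seq T) (Q : T -> R -> Prop) :
  (forall x, x \in s -> exists2 h0, 0 < h0 & forall h, 0 < h <= h0 -> Q x h) ->
  exists2 h0, 0 < h0 & forall h, 0 < h <= h0 -> forall x, x \in s -> Q x h.
Proof.
elim: s => [|x s IH] H; first by exists 1.
have [h1 h10 H1] := IH (fun z zs => H z (mem_behead (s := x :: s) zs)).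
have [h2 h20 H2] := H x (mem_head _ _).
exists (Num.min h1 h2); first by rewrite lt_min h10.
move=> h /andP[h0]; rewrite le_min => /andP[hh1 hh2] z.
by rewrite inE => /predU1P[->|zs]; [apply: H2|apply: H1] => //; rewrite h0.
Qed.

Section Deterministic.
Variables (n : nat) (v : 'I_n -> R3 R).
Hypothesis v1 : forall i, dot (v i) (v i) = 1.

(* On the unit sphere [1 - dot y z] is half the squared distance of [y] and [z]. *)
Definition local_max_unit (x : R3 R) := dot x x = 1 /\ exists2 h : R, 0 < h &
  forall y, dot y y = 1 -> 1 - h < dot y x ->
    \prod_i (1 - dot y (v i)) <= \prod_i (1 - dot x (v i)).

Lemma grad_sq_frame u y : -1 <= u.1 <= 1 ->
  grad_sq (fun i => frame u (v i)) (frame u y) = grad_sq v y.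
Proof. by move=> u1; do 2 apply: eq_bigr => ? _; rewrite !dot_frame. Qed.

(** In the frame at [x] each [y] of a small cap has the form [horo c s t] with [t] the tangent of
    half the angle between [x] and [y]; then [t ^+ 2 <= 1 - dot y x]. *)
Lemma local_max_cap x : local_max_unit x -> exists2 h0 : R, 0 < h0 &
  forall y, dot y y = 1 -> 1 - h0 < dot y x ->
    grad_sq v y <= 9 * n%:R ^+ 2 * (1 - dot y x).
Proof.
move=> [/sph_surj[u [u1 u2 ->]] [h h0 hmax]].
pose X i := frame u (v i).
have X1 i : dot (X i) (X i) = 1 by rewrite dot_frame.
have mx : pole_max X.
  exists (Num.min 1 (h / 4)); first by rewrite lt_min ltr01 divr_gt0.
  move=> c s t cs /andP[t0]; rewrite le_min => /andP[t1 th].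
  have sq1 : 0 < 1 + t ^+ 2 by rewrite ltr_pwDl// sqr_ge0.
  have := hmax (unframe u (horo c s t)).
  rewrite dot_sph_frame// -(dot_frame _ _ u1) unframeK// dot_horo_self// => /(_ erefl).
  have hh : 1 - h < (horo c s t).2.
    rewrite /horo/= ltr_pdivlMr//; have : t ^+ 2 <= t by rewrite expr2 ler_piMr.
    have : 0 <= h * t ^+ 2 by rewrite mulr_ge0 ?sqr_ge0// ltW.
    nra.
  move=> /(_ hh); under eq_bigr do rewrite -(dot_frame _ _ u1) unframeK//.
  move/le_trans; apply; rewrite le_eqVlt; apply/orP; left; apply/eqP; apply: eq_bigr => i _.
  by rewrite dotC dot_sph_frame.
have Xlt := pole_max_lt1 X1 mx.
have [t1 t10 ht] := horo_grad_sq X1 Xlt mx.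
have t12 : 0 < t1 ^+ 2 by rewrite exprn_gt0.
exists (Num.min 1 (t1 ^+ 2)); first by rewrite lt_min ltr01.
move=> y y1; rewrite dot_sph_frame// -(grad_sq_frame _ u1).
set z := frame u y; have z1 : dot z z = 1 by rewrite dot_frame.
move: z1; clearbody z; case: z => [[a b] m]; rewrite /dot/= => z1 hm.
have m1 : m <= 1 by have := sqr_ge0 a; have := sqr_ge0 b; nra.
have m0 : 0 < m by move: hm; rewrite ltrBlDr -ltrBlDl lt_min => /andP[]; lra.
have mt : 1 - m < t1 ^+ 2 by move: hm; rewrite ltrBlDr -ltrBlDl lt_min => /andP[]; lra.
pose t := Num.sqrt ((1 - m) / (1 + m)).
have t2 : t ^+ 2 = (1 - m) / (1 + m) by rewrite sqr_sqrtr// divr_ge0; lra.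
have t2le : t ^+ 2 <= 1 - m by rewrite t2 ler_pdivrMr; nra.
have t0 : 0 <= t by exact: sqrtr_ge0.
have tt1 : t <= t1.
  by rewrite -(@ler_pXn2r _ 2) ?nnegrE ?(ltW t10)//; apply: le_trans t2le (ltW mt).
suff [c [s [cs ->]]] : exists c s : R, c ^+ 2 + s ^+ 2 = 1 /\ (a, b, m) = horo c s t.
  apply: (le_trans (ht c s t cs _)); first by rewrite t0.
  by rewrite ler_wpM2l ?mulr_ge0 ?sqr_ge0.
have mE : (1 - t ^+ 2) / (1 + t ^+ 2) = m by rewrite t2; field; rewrite !gt_eqF//; lra.
have t2E : 1 + t ^+ 2 = 2 / (1 + m) by rewrite t2; field; rewrite !gt_eqF//; lra.
(* At the centre of the cap the direction [(c, s)] is arbitrary. *)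
have [m1'|m1'] := eqVneq m 1.
  have ts : t = 0 by apply/eqP; rewrite -sqrf_eq0 t2 m1' subrr mul0r.
  have ab : a ^+ 2 + b ^+ 2 = 0 by move: z1; rewrite m1'; nra.
  have [ha hb] := (sqr_ge0 a, sqr_ge0 b).
  have /eqP : a ^+ 2 = 0 by lra.
  have /eqP : b ^+ 2 = 0 by lra.
  rewrite !sqrf_eq0 => /eqP b0 /eqP a0.
  exists 1, 0; split; first by rewrite expr1n expr0n addr0.
  by rewrite /horo ts a0 b0 m1' expr0n/= subr0 addr0 !divr1 !mulr0 !mul0r.
have tp : 0 < t by rewrite sqrtr_gt0 divr_gt0 ?subr_gt0 ?lt_neqAle ?m1'//; lra.
exists (a / ((1 + m) * t)), (b / ((1 + m) * t)); split.
  have -> : (a / ((1 + m) * t)) ^+ 2 + (b / ((1 + m) * t)) ^+ 2 =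
     (a * a + b * b) / ((1 + m) ^+ 2 * t ^+ 2) by field; rewrite !gt_eqF//; lra.
  have -> : a * a + b * b = 1 - m * m by lra.
  have m1p : 0 < 1 - m by rewrite subr_gt0 lt_neqAle m1'.
  by rewrite t2; field; rewrite !gt_eqF//; lra.
rewrite /horo mE t2E; congr (_, _, _); field; rewrite !gt_eqF//; lra.
Qed.

(** The squared length of [x + x' - 2 y] is nonnegative. *)
Lemma cap_disjoint (x x' y : R3 R) (h : R) : dot x x = 1 -> dot x' x' = 1 -> dot y y = 1 ->
  1 - h < dot y x -> 1 - h < dot y x' -> 1 - 4 * h < dot x x'.
Proof.
rewrite /dot; case: x x' y => [[x1 x2] x3] [[z1 z2] z3] [[y1 y2] y3]/= hx hz hy h1 h2.
have := sqr_ge0 (x1 + z1 - 2 * y1); have := sqr_ge0 (x2 + z2 - 2 * y2).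
have := sqr_ge0 (x3 + z3 - 2 * y3); nra.
Qed.

Lemma measurable_grad_sq d (T : measurableType d) (V : 'I_n -> T -> R3 R) (g : T -> R3 R) :
  (forall i, measurable_fun setT (V i)) -> measurable_fun setT g ->
  measurable_fun setT (fun t => grad_sq (V ^~ t) (g t)).
Proof.
move=> mV mg; rewrite /grad_sq.
apply: measurable_sum => i; apply: measurable_sum => j.
have md k l : measurable_fun setT (fun t => dot (V k t) (V l t)) by exact: measurable_dot.
have mh k : measurable_fun setT (fun t => dot (g t) (V k t)) by exact: measurable_dot.
by meas.
Qed.

(** For small [h] the caps of height [h] around the points of [s] are disjoint, of measure [h / 2]
    each, and contained in the set on the right by [local_max_cap]. Finite lists are used because
    the set of maxima may be infinite. *)
Lemma local_max_count (s : seq (R3 R)) : uniq s -> (forall x, x \in s -> local_max_unit x) ->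
  exists2 h0 : R, 0 < h0 & forall h, 0 < h <= h0 ->
  (((size s)%:R * (h / 2))%:E <= sigma [set y | (grad_sq v y <= 9 * n%:R ^+ 2 * h)%R])%E.
Proof.
move=> us ms.
have [h1 h10 H1] : exists2 h1 : R, 0 < h1 & forall h, 0 < h <= h1 -> forall x, x \in s ->
    forall x', x' \in s -> x != x' -> 4 * h <= 1 - dot x x'.
  apply: uniform_seq => x xs; apply: uniform_seq => x' xs'.
  have [<-|xx'] := eqVneq x x'; first by exists 1.
  have d1 : 0 < 1 - dot x x'.
    have [[x1 _] [x1' _]] := (ms x xs, ms x' xs').
    rewrite subr_gt0 lt_neqAle dot_le1// andbT; apply: contra_neq xx' => e.
    exact: dot_eq1.
  by exists ((1 - dot x x') / 4); [rewrite divr_gt0|move=> h /andP[_ hh] _; lra].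
have [h2 h20 H2] : exists2 h2 : R, 0 < h2 & forall h, 0 < h <= h2 -> forall x, x \in s ->
    forall y, dot y y = 1 -> 1 - h < dot y x -> grad_sq v y <= 9 * n%:R ^+ 2 * (1 - dot y x).
  apply: uniform_seq => x xs; have [h3 h30 H3] := local_max_cap (ms x xs).
  by exists h3 => // h /andP[_ hh] y y1 hy; apply: H3 => //; apply: le_lt_trans hy; rewrite lerB.
exists (Num.min (Num.min 1 h1) h2); first by rewrite !lt_min ltr01 h10.
move=> h /andP[h0]; rewrite !le_min -andbA => /and3P[hle1 hh1 hh2].
have mE : measurable [set y | grad_sq v y <= 9 * n%:R ^+ 2 * h].
  by apply: measurable_le; apply: (measurable_grad_sq (V := fun i _ => v i)) => //; meas.
have mC x : measurable [set y : R3 R | 1 - h < dot y x].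
  by apply: measurable_gt; apply: measurable_dot => //; meas.
rewrite -[X in (_ <= sigma X)%E]setIT -integral_indic//.
have -> : (((size s)%:R * (h / 2))%:E =
    \int[sigma]_y \sum_(x <- s) (\1_[set y : R3 R | (1 - h < dot y x)%R] y)%:E)%E.
  rewrite ge0_integral_sum//; last by move=> x; exact/measurable_EFinP.
  rewrite (eq_big_seq (fun=> (h / 2)%:E)).
    by rewrite sumEFin big_const_seq count_predT iter_addr_0 mulr_natl.
  move=> x xs /=; rewrite integral_indic// setIT.
  have [x1 _] := ms x xs; apply: (sigma_cap x1).
  by rewrite (ltW h0)/=; lra.
apply: le_integral_sigma.
- by apply: emeasurable_sum => x; exact/measurable_EFinP.
- exact/measurable_EFinP.
- by move=> y; apply: sume_ge0 => x _; rewrite lee_fin.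
- by move=> y; rewrite lee_fin.
move=> y y1; have [[x xs xy]|nx] := pselect (exists2 x, x \in s & 1 - h < dot y x).
  rewrite (bigD1_seq x)//= big_seq_cond big1 ?adde0.
    rewrite lee_fin !indicE !mem_set//=; apply: (le_trans (H2 h _ x xs y y1 xy)); first by rewrite h0.
    by rewrite ler_wpM2l ?mulr_ge0 ?sqr_ge0//; lra.
  move=> z /andP[zs zx]; rewrite indicE memNset//= => zy.
  have [[x1 _] [z1 _]] := (ms x xs, ms z zs).
  have := cap_disjoint x1 z1 y1 xy zy.
  have := H1 h; rewrite h0 hh1 => /(_ isT x xs z zs); rewrite eq_sym => /(_ zx).
  lra.
rewrite big_seq big1 ?lee_fin// => x xs; rewrite indicE memNset// => xy.
by apply: nx; exists x.
Qed.

End Deterministic.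
End LocalMaxima.

(** * The upper bound *)

Section NonMeasurable.
Context d (T : measurableType d) (R : realType) (P : probability T R).
Local Open Scope ereal_scope.
Implicit Types f g : T -> \bar R.

(* [num_local_maxima] is not known to be measurable, so that integrals are compared
   through the supremum over simple functions. *)
Lemma le_integral_ge0 f g : (forall x, 0 <= f x) -> (forall x, f x <= g x) ->
  \int[P]_x f x <= \int[P]_x g x.
Proof.
move=> f0 fg; have g0 x : 0 <= g x by apply: le_trans (fg x).
rewrite !ge0_integralTE//; apply: ereal_sup_le => _ [h hf <-].
by exists h => // x; exact: le_trans (hf x) (fg x).
Qed.

Variables (A : set T) (mA : measurable A) (PA : P A = 1).

Let PAC : P (~` A) = 0.
Proof. by rewrite probability_setC// PA subee. Qed.

(** Making [g] infinite outside [A] preserves its measurability and its integral; [f] may then be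
    arbitrary. *)
Lemma le_integral_as_r f g : (forall x, 0 <= f x) -> (forall x, 0 <= g x) ->
  measurable_fun setT g -> (forall x, A x -> f x <= g x) -> \int[P]_x f x <= \int[P]_x g x.
Proof.
move=> f0 g0 mg fg; pose g' x := g x + +oo * (\1_(~` A) x)%:E.
have g'0 x : 0 <= g' x by rewrite adde_ge0// mule_ge0// lee_fin.
have <- : \int[P]_x g' x = \int[P]_x g x.
  apply: ge0_ae_eq_integral => //.
  - apply: emeasurable_funD => //; apply: emeasurable_funM => //.
    by apply/measurable_EFinP; apply: measurable_indic; exact: measurableC.
  - exists (~` A); split => //; first exact: measurableC.
    move=> x /= h Ax; apply: h => _.
    by rewrite /g' indicE memNset//= mule0 adde0.
apply: le_integral_ge0 => // x; rewrite /g'; have [Ax|Ax] := pselect (A x).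
  by rewrite indicE memNset//= mule0 adde0 fg.
by rewrite indicE mem_set//= mule1 addey ?leey// gt_eqF// (lt_le_trans _ (g0 x)).
Qed.

(** Here it is the measurable [f] that is modified, by setting it to 0 outside [A], and [g] may be
    arbitrary. *)
Lemma le_integral_as_l f g : (forall x, 0 <= f x) -> (forall x, 0 <= g x) ->
  measurable_fun setT f -> (forall x, A x -> f x <= g x) -> \int[P]_x f x <= \int[P]_x g x.
Proof.
move=> f0 g0 mf fg; pose f' x := f x * (\1_A x)%:E.
have f'0 x : 0 <= f' x by rewrite mule_ge0// lee_fin.
have -> : \int[P]_x f x = \int[P]_x f' x.
  apply: ge0_ae_eq_integral => //.
  - apply: emeasurable_funM => //.
    by apply/measurable_EFinP; exact: measurable_indic.
  - exists (~` A); split => //; first exact: measurableC.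
    move=> x /= h Ax; apply: h => _.
    by rewrite /f' indicE mem_set//= mule1.
apply: le_integral_ge0 => // x; rewrite /f'; have [Ax|Ax] := pselect (A x).
  by rewrite indicE mem_set//= mule1 fg.
by rewrite indicE memNset//= mule0.
Qed.

End NonMeasurable.

(** An infinite set has finite subsets of every size, which forces [g] to be infinite. *)
Lemma counting_le (T : choiceType) (R : realType) (M : set T) (g : \bar R) :
  (forall s : seq T, uniq s -> (forall x, x \in s -> M x) -> ((size s)%:R%:E <= g)%E) ->
  (counting M <= g)%E.
Proof.
move=> H; rewrite /counting; case: asboolP => [fM|iM].
  by apply: H => // x; rewrite in_fset_set// inE.
rewrite leye_eq; apply/eqP/eqyP => r r0.
have [B BM Br] := infinite_set_fset (Num.trunc r).+1 iM.
have : ((size (finmap.enum_fset B))%:R%:E <= g)%E.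
  by apply: H => [|x xB]; [exact: finmap.fset_uniq|exact: BM].
apply: le_trans.
rewrite lee_fin; apply/ltW; apply: (lt_le_trans (truncnS_gt r)).
by rewrite ler_nat.
Qed.

Lemma counting_ge1 (T : choiceType) (R : realType) (M : set T) (x : T) : M x ->
  (1 <= counting M :> \bar R)%E.
Proof.
move=> Mx; rewrite /counting; case: asboolP => fM; last by rewrite leey.
rewrite lee_fin ler1n finmap.cardfs_gt0; apply/finmap.fset0Pn; exists x.
by rewrite in_fset_set// inE.
Qed.

Lemma limn_einf_ge (R : realType) (u : (\bar R)^nat) (a : \bar R) (m0 : nat) :
  (forall m, (m0 <= m)%N -> (a <= u m)%E) -> (a <= limn_einf u)%E.
Proof.
move=> h; rewrite limn_einf_lim; apply: lime_ge; first exact: is_cvg_einfs.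
exists m0 => // m /= m0m; apply: le_ereal_inf_tmp => _ [k /= mk <-].
by apply: h; exact: leq_trans mk.
Qed.

Lemma limn_einf_le (R : realType) (u : (\bar R)^nat) (a : \bar R) :
  (forall m, (u m <= a)%E) -> (limn_einf u <= a)%E.
Proof.
move=> h; rewrite limn_einf_lim; apply: lime_le; first exact: is_cvg_einfs.
exists 0%N => // m _; apply: le_trans (h m); apply: ereal_inf_lbound.
by exists m => /=.
Qed.

(** * From the potential to products over the unit sphere *)

Section Potential.
Context {R : realType}.

(** Vanishing factors are covered because [lne] of 0 is [-oo], which absorbs the sum. *)
Lemma lneM_ge0 (a b : R) : 0 <= a -> 0 <= b -> (lne (a * b)%:E = lne a%:E + lne b%:E)%E.
Proof.
have l0 : lne (0 : R)%:E = -oo%E by rewrite le0_lneNy.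
rewrite le_eqVlt => /predU1P[<- _|a0]; first by rewrite mul0r l0 addNye.
rewrite le_eqVlt => /predU1P[<-|b0]; first by rewrite mulr0 l0 addeNy.
by rewrite !lne_EFin ?mulr_gt0// lnM.
Qed.

Lemma sum_lne (I : Type) (s : seq I) (f : I -> R) : (forall i, 0 <= f i) ->
  (\sum_(i <- s) lne (f i)%:E = lne (\prod_(i <- s) f i)%:E)%E.
Proof.
move=> f0; elim: s => [|i s IH]; first by rewrite !big_nil lne1.
by rewrite !big_cons IH lneM_ge0// prodr_ge0.
Qed.

Variables (n : nat) (v : 'I_n -> R3 R).
Hypotheses (n0 : (0 < n)%N) (v1 : forall i, dot (v i) (v i) = 1).
Let r := @sphere_radius R n.
Let r0 : 0 < r. Proof. exact: sphere_radius_gt0. Qed.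

Lemma sphere_scale (x : R3 R) : sphere n (scale r x) <-> dot x x = 1.
Proof.
rewrite /sphere/= /enorm /scale/=.
have -> : (r * x.1.1) ^+ 2 + (r * x.1.2) ^+ 2 + (r * x.2) ^+ 2 = r ^+ 2 * dot x x.
  by rewrite /dot; ring.
rewrite sqrtrM ?sqr_ge0// sqrtr_sqr gtr0_norm// -/r; split => [|->]; last by rewrite sqrtr1 mulr1.
move=> e; have e1 : Num.sqrt (dot x x) = 1.
  by apply: (mulfI (lt0r_neq0 r0)); rewrite e mulr1.
have d0 : 0 <= dot x x by rewrite /dot -!expr2 !addr_ge0 ?sqr_ge0.
by rewrite -(sqr_sqrtr d0) e1 expr1n.
Qed.

(** On the sphere of radius [r] the squared distance of two points is [2 * r ^+ 2] times one minus
    the dot product of their directions, and [lne] is increasing. *)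
Lemma potential_scale_le (x y : R3 R) : dot x x = 1 -> dot y y = 1 ->
  (potential (fun i => scale r (v i)) (scale r y) <= potential (fun i => scale r (v i)) (scale r x))%E
  = (\prod_i (1 - dot y (v i)) <= \prod_i (1 - dot x (v i))).
Proof.
move=> x1 y1; rewrite /potential !sum_lne; try by move=> i; exact: sqrtr_ge0.
have e0 (z : R3 R) : 0 <= \prod_i enorm (scale r z - scale r (v i)).
  by apply: prodr_ge0 => i _; exact: sqrtr_ge0.
rewrite lee_lne ?in_itv/= ?leey ?andbT ?lee_fin//.
have sq (z : R3 R) : dot z z = 1 -> (\prod_i enorm (scale r z - scale r (v i))) ^+ 2 =
    (2 * r ^+ 2) ^+ n * \prod_i (1 - dot z (v i)).
  move=> z1; rewrite -prodrXl -[in X in _ = _ ^+ X * _](card_ord n) -prodr_const -big_split/=.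
  apply: eq_bigr => i _; rewrite /enorm sqr_sqrtr ?addr_ge0 ?sqr_ge0//.
  have -> : (2 * r ^+ 2) * (1 - dot z (v i)) = r ^+ 2 * (1 + 1 - 2 * dot z (v i)) by ring.
  by rewrite -{1}z1 -{1}(v1 i) /dot /scale/=; ring.
rewrite -(@ler_pXn2r _ 2) ?nnegrE// !sq// ler_pM2l// exprn_gt0// mulr_gt0// exprn_gt0//.
Qed.

(** Neighbourhoods on the left come from balls of the sup norm, on the right from caps; on the
    sphere each kind contains one of the other. *)
Lemma local_maxP (x : R3 R) :
  local_max_on (sphere n) (potential (fun i => scale r (v i))) (scale r x) <-> local_max_unit v x.
Proof.
have dE (y : R3 R) : dot x x = 1 -> dot y y = 1 ->
    (y.1.1 - x.1.1) ^+ 2 + (y.1.2 - x.1.2) ^+ 2 + (y.2 - x.2) ^+ 2 = 2 * (1 - dot y x).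
  move=> x1 y1; transitivity (dot y y + dot x x - 2 * dot y x); first by rewrite /dot; ring.
  by rewrite x1 y1; ring.
have unscale (y : R3 R) : y = scale r (scale r^-1 y).
  by case: y => [[a b] c]; rewrite /scale/= !mulVKf ?lt0r_neq0.
split.
- move=> [/sphere_scale x1]; rewrite near_withinE => /nbhs_ballP[e /= e0 he]; split => //.
  exists ((e / r) ^+ 2 / 2); first by rewrite divr_gt0// exprn_gt0// divr_gt0.
  move=> y y1 hy; rewrite -potential_scale_le//; apply: he; last exact/sphere_scale.
  have := dE y x1 y1; have er : 0 <= e / r by rewrite ltW// divr_gt0.
  have h1 := sqr_ge0 (y.1.1 - x.1.1); have h2 := sqr_ge0 (y.1.2 - x.1.2).
  have h3 := sqr_ge0 (y.2 - x.2) => E.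
  have aux (a b : R) : (b - a) ^+ 2 < (e / r) ^+ 2 -> ball (r * a : R) e (r * b : R).
    move=> h; rewrite -ball_normE/= -mulrBr normrM (gtr0_norm r0) mulrC -ltr_pdivlMr//.
    by rewrite -(@ltr_pXn2r _ 2) ?nnegrE// real_normK ?num_real// -sqrrN opprB.
  by split; [split|]; apply: aux; lra.
- move=> [x1 [h h0 hx]]; split; first exact/sphere_scale.
  rewrite near_withinE; apply/nbhs_ballP; exists (r * Num.min 1 (h / 2)).
    by rewrite /= mulr_gt0// lt_min ltr01 divr_gt0.
  move=> y; rewrite (unscale y); move: (scale r^-1 y) => {}y [[/= b1 b2] b3] /sphere_scale y1.
  rewrite potential_scale_le//; apply: hx => //.
  have aux (a b : R) : ball (r * a : R) (r * Num.min 1 (h / 2)) (r * b : R) -> (b - a) ^+ 2 <= h / 2.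
    rewrite -ball_normE/= -mulrBr normrM (gtr0_norm r0) ltr_pM2l// lt_min => /andP[l1 l2].
    rewrite -sqrrN opprB -real_normK ?num_real//.
    by have := normr_ge0 (a - b); nra.
  by have := dE y x1 y1; have := aux _ _ b1; have := aux _ _ b2; have := aux _ _ b3; lra.
Qed.

Lemma scale_inj : injective (@scale R r).
Proof.
move=> [[a b] c] [[a' b'] c'] [] /(mulfI (lt0r_neq0 r0))-> /(mulfI (lt0r_neq0 r0))->.
by move/(mulfI (lt0r_neq0 r0)) ->.
Qed.

Lemma scale_unscale (y : R3 R) : scale r (scale r^-1 y) = y.
Proof. by case: y => [[a b] c]; rewrite /scale/= !mulVKf ?lt0r_neq0. Qed.

(** [local_max_count] holds below a threshold that varies with the configuration and with the list
    of maxima, hence a lower limit along a fixed sequence [h]. *)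
Lemma num_local_maxima_le (h : R ^nat) : (forall m, 0 < h m) -> h @ \oo --> 0 ->
  (num_local_maxima (fun i => scale r (v i)) <= limn_einf (fun m =>
    (2 / h m)%:E * sigma [set y | (grad_sq v y <= 9 * n%:R ^+ 2 * h m)%R]))%E.
Proof.
move=> hp h0; apply: counting_le => s us ms.
have us' : uniq (map (scale r^-1) s).
  rewrite map_inj_uniq// => a b e.
  by rewrite -(scale_unscale a) e scale_unscale.
have ms' x : x \in map (scale r^-1) s -> local_max_unit v x.
  by move=> /mapP[y ys ->]; apply/local_maxP; rewrite scale_unscale; exact: ms.
have [h1 h10 H] := local_max_count v1 us' ms'.
have [m0 _ Hm] : \forall m \near \oo, h m <= h1.
  by near do apply: ltW; move: h0 => /cvgrPdist_lt/(_ _ h10); apply: filterS => m; rewrite sub0r normrN gtr0_norm.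
apply: (limn_einf_ge (m0 := m0)) => m mm0.
have := H (h m); rewrite hp (Hm m mm0) => /(_ isT); rewrite size_map => hs.
have h2 : 0 < 2 / h m by rewrite divr_gt0.
apply: le_trans (lee_wpmul2l _ hs); last by rewrite lee_fin ltW.
rewrite -EFinM lee_fin (_ : 2 / h m * _ = (size s)%:R)//.
by move: (hp m) => hm; field; exact: lt0r_neq0.
Unshelve. all: by end_near. Qed.

End Potential.

(** * Expected area where the gradient is small *)

Section ExpectationUpper.
Context {R : realType}.

Lemma sigma_frame (u : R * R) (A : set (R3 R)) : -1 <= u.1 <= 1 -> 0 <= u.2 <= 2 * pi ->
  measurable A -> sigma (frame u @^-1` A) = sigma A.
Proof.
move=> u1 u2 mA.
have mf : measurable_fun setT (frame u) by apply: measurable_frame; meas.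
have mFA : measurable (frame u @^-1` A) by rewrite -[X in measurable X]setTI; exact: mf.
rewrite -[X in sigma X = _]setIT -integral_indic// -[X in _ = sigma X]setIT -integral_indic//.
rewrite -(integral_sigma_frame u1 u2 (f := fun y => (\1_A y)%:E))//; last exact/measurable_EFinP.
Qed.

(** For fixed [y] the points rotated into the frame at [y] are again independent and uniform, and
    [grad_sq] becomes the squared modulus of the sum of their projections. The bound of [small_ball]
    is uniform in [y], so it also bounds the mean area, and division by the cap measure [h / 2]
    cancels [h]. *)
Lemma expectation_upper : exists2 C : R, 0 < C & forall d (T : measurableType d)
  (P : probability T R) n (V : 'I_n -> T -> R3 R), (2 <= n)%N ->
  (forall i, measurable_fun setT (V i)) -> indep_family P V ->
  (forall i A, measurable A -> P (V i @^-1` A) = sigma A) ->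
  (\int[P]_w num_local_maxima (fun i => scale (@sphere_radius R n) (V i w)) <=
     (C * n%:R / ln n%:R)%:E)%E.
Proof.
(* The factor 18 is 9, from the bound on [grad_sq], times 2, from the cap measure [h / 2]. *)
have [C C0 hC] := small_ball R; exists (18 * C); first by rewrite mulr_gt0.
move=> d T P n V n2 mV iV lawV.
have n0 : (0 < n)%N by exact: ltnW.
have nR : 0 < n%:R :> R by rewrite ltr0n.
have ln0 : 0 < ln n%:R :> R by have := @ln_ge_half R n n2; lra.
pose h m : R := m.+1%:R^-1.
have hp m : 0 < h m by rewrite invr_gt0.
pose e m : R := 3 * n%:R * Num.sqrt (h m).
have e2 m : e m ^+ 2 = 9 * n%:R ^+ 2 * h m.
  by rewrite !exprMn sqr_sqrtr ?(ltW (hp m))//; ring.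
have ep m : 0 < e m by rewrite !mulr_gt0// sqrtr_gt0.
pose E m (w : T) : set (R3 R) := [set y | grad_sq (V ^~ w) y <= 9 * n%:R ^+ 2 * h m].
pose F m w (y : R3 R) : R := \1_(E m w) y.
have mg : measurable_fun setT (fun z : T * R3 R => grad_sq (V ^~ z.1) z.2).
  apply: (measurable_grad_sq (V := fun i (z : T * R3 R) => V i z.1)); last by meas.
  by move=> i; apply: measurableT_comp (mV i) _; meas.
have mE m : measurable [set z : T * R3 R | E m z.1 z.2] by exact: measurable_le.
have mF m : measurable_fun setT (fun z : T * R3 R => F m z.1 z.2).
  rewrite (_ : (fun z => _) = \1_[set z : T * R3 R | E m z.1 z.2]).
    exact: measurable_indic.
  by apply/funext => z; rewrite /F !indicE; congr (nat_of_bool _)%:R; apply/idP/idP; rewrite !inE.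
have mEw m w : measurable (E m w).
  apply: measurable_le; apply: (measurableT_comp mg (g := fun y => (w, y))).
  exact: measurable_fun_pair.
have sE m w : sigma (E m w) = (\int[sigma]_y (F m w y)%:E)%E.
  have /esym := @integral_indic _ _ R sigma setT measurableT (E m w) (mEw m w).
  by rewrite setIT.
have small m : (\int[P]_w sigma (E m w) <= (C * e m ^+ 2 / (n%:R * ln n%:R))%:E)%E.
  under eq_integral do rewrite sE.
  rewrite (@tonelli_in _ _ _ _ _ P sigma setT setT (fun w y => (F m w y)%:E))//; last 2 first.
  - exact/measurable_EFinP.
  - by move=> w y; rewrite lee_fin.
  apply: (@le_trans _ _ (\int[sigma]_y (C * e m ^+ 2 / (n%:R * ln n%:R))%:E)%E); last first.
    by rewrite integral_cst//= probability_setT mule1.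
  have K0 : 0 <= C * e m ^+ 2 / (n%:R * ln n%:R).
    by rewrite divr_ge0 ?mulr_ge0 ?sqr_ge0// ltW.
  apply: le_integral_sigma => //.
  - apply: (@measurable_integral_in _ _ _ _ _ P setT (fun y w => (F m w y)%:E)) => //.
    + apply/measurable_EFinP; apply: (measurableT_comp (mF m) (g := fun z : R3 R * T => (z.2, z.1))).
      exact: measurable_fun_pair.
    + by move=> y w; rewrite lee_fin.
  - by move=> y; apply: integral_ge0 => w _; rewrite lee_fin.
  move=> _ /sph_surj[u [u1 u2 ->]].
  pose V' i w := frame u (V i w).
  have mf : measurable_fun setT (frame u) by apply: measurable_frame; meas.
  have mfA A : measurable A -> measurable (frame u @^-1` A).
    by move=> mA; rewrite -[X in measurable X]setTI; exact: mf.
  have mV' i : measurable_fun setT (V' i) by exact: measurableT_comp.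
  have iV' : indep_family P V'.
    by move=> A mA; exact: (iV (fun i => frame u @^-1` A i) (fun i => mfA _ (mA i))).
  have lawV' i A : measurable A -> P (V' i @^-1` A) = sigma A.
    move=> mA; rewrite -[RHS](sigma_frame u1 u2 mA); exact: lawV (mfA _ mA).
  apply: le_trans (hC _ _ P n V' n2 mV' iV' lawV' (e m) (ep m)).
  set B := [set w | _].
  have gE w : grad_sq (V ^~ w) (sph u) =
      (\sum_i (stereo (V' i w)).1) ^+ 2 + (\sum_i (stereo (V' i w)).2) ^+ 2.
    rewrite -(grad_sq_frame _ _ u1) frame_sph//.
    have d3 (x : R3 R) : dot (0, 0, 1) x = x.2 by rewrite /dot/= !mul0r !add0r mul1r.
    rewrite (grad_sqE (f := fun i => (V' i w).1.1) (g := fun i => (V' i w).1.2)).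
      by congr (_ ^+ 2 + _ ^+ 2); apply: eq_bigr => i _; rewrite d3.
    by move=> i j; rewrite !d3 /dot addrK.
  have EB : [set w | E m w (sph u)] = B.
    by apply/seteqP; split => w; rewrite /E /B/= gE e2.
  rewrite -EB -[X in (_ <= P X)%E]setIT -integral_indic//.
  by apply: measurable_le; apply: (measurableT_comp mg (g := fun w => (w, sph u))); exact: measurable_fun_pair.
have sE0 m w : (0 <= sigma (E m w))%E by exact: measure_ge0.
have msE m : measurable_fun setT (fun w => sigma (E m w)).
  rewrite (_ : (fun w => _) = (fun w => \int[sigma]_y (F m w y)%:E)%E); last by apply/funext => w.
  apply: (@measurable_integral_in _ _ _ _ _ sigma setT (fun w y => (F m w y)%:E)) => //.
  - exact/measurable_EFinP.
  - by move=> w y; rewrite lee_fin.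
pose U m w := ((2 / h m)%:E * sigma (E m w))%E.
have U0 m w : (0 <= U m w)%E by rewrite mule_ge0// lee_fin divr_ge0// ltW.
have mU m : measurable_fun setT (U m) by apply: emeasurable_funM.
have h20 m : 0 <= 2 / h m by rewrite divr_ge0// ltW.
pose good := \bigcap_(i in [set: 'I_n]) (V i @^-1` [set x | dot x x = 1]).
have mS : measurable [set x : R3 R | dot x x = 1].
  have md : measurable_fun setT (fun y : R3 R => dot y y) by apply: measurable_dot; meas.
  by have := md measurableT _ (measurable_set1 1); rewrite setTI.
have mgood : measurable good.
  apply: fin_bigcap_measurable => // i _.
  by rewrite -[X in measurable X]setTI; exact: mV.
have Pgood : P good = 1%E.
  rewrite /good (iV (fun=> [set x | dot x x = 1]))// big1// => i _.
  by rewrite lawV// sigma_unit.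
apply: (@le_trans _ _ (\int[P]_w limn_einf (U ^~ w))%E).
  apply: (le_integral_as_r mgood Pgood).
  - by move=> w; exact: measure_ge0.
  - by move=> w; apply: (limn_einf_ge (m0 := 0%N)) => m _.
  - apply: (measurableT_comp (f := -%E)); first exact: oppe_measurable.
    apply: measurable_fun_limn_esup => m.
    by apply: (measurableT_comp (f := -%E)); first exact: oppe_measurable.
  move=> w gw; apply: num_local_maxima_le => //.
  - by move=> i; exact: (gw i I).
  - exact: cvg_harmonic.
apply: (le_trans (fatou P measurableT mU (fun m w _ => U0 m w))).
apply: limn_einf_le => m.
rewrite ge0_integralZl//; last by rewrite lee_fin.
apply: le_trans (lee_wpmul2l _ (small m)) _; first by rewrite lee_fin.
rewrite -EFinM lee_fin e2 le_eqVlt; apply/orP; left; apply/eqP.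
by move: (ln _) ln0 (h m) (hp m) => l l0 k k0; field; rewrite !lt0r_neq0.
Qed.

End ExpectationUpper.

(** * A criterion for the presence of a local maximum *)

Section CapMaxima.
Context {R : realType}.
Local Notation sigma := (@sigma R).
Variables (n : nat) (v : 'I_n -> R3 R).
Hypothesis v1 : forall i, dot (v i) (v i) = 1.

Let G (y : R3 R) : R := \prod_i (1 - dot y (v i)).

Lemma continuous_dot (x : R3 R) : continuous (fun y : R3 R => dot y x).
Proof.
move=> y; rewrite /dot; apply: cvgD; [apply: cvgD|]; apply: cvgM; try exact: cvg_cst.
- by apply: (@continuous_comp _ _ _ fst fst); exact: cvg_fst.
- by apply: (@continuous_comp _ _ _ fst snd); [exact: cvg_fst|exact: cvg_snd].
- exact: cvg_snd.
Qed.

Lemma continuous_dot_self : continuous (fun y : R3 R => dot y y).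
Proof.
have c1 : continuous (fun y : R3 R => y.1.1).
  by move=> y; apply: (@continuous_comp _ _ _ fst fst); exact: cvg_fst.
have c2 : continuous (fun y : R3 R => y.1.2).
  by move=> y; apply: (@continuous_comp _ _ _ fst snd); [exact: cvg_fst|exact: cvg_snd].
have c3 : continuous (fun y : R3 R => y.2) by move=> y; exact: cvg_snd.
by move=> y; rewrite /dot; apply: cvgD; [apply: cvgD|]; apply: cvgM; first [exact: c1|exact: c2|exact: c3].
Qed.

Lemma continuous_prod_dot : continuous G.
Proof.
rewrite /G => y; elim: (index_enum _) => [|i s IH].
  rewrite (_ : (fun y => _) = cst 1); first exact: cst_continuous.
  by apply/funext => z; rewrite big_nil.
rewrite (_ : (fun y => _) = (fun z => (1 - dot z (v i)) * \prod_(j <- s) (1 - dot z (v j)))).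
  rewrite /continuous_at; apply: cvgM => //; apply: cvgB; [exact: cvg_cst|exact: continuous_dot].
by apply/funext => z; rewrite big_cons.
Qed.

Lemma cap_max (x : R3 R) (m : R) : dot x x = 1 -> m <= 1 -> exists y,
  [/\ dot y y = 1, m <= dot y x & forall z, dot z z = 1 -> m <= dot z x -> G z <= G y].
Proof.
move=> x1 m1.
pose cube : set (R3 R) := (`[(-1)%R, 1%R] `*` `[(-1)%R, 1%R]) `*` `[(-1)%R, 1%R].
pose S := (fun y : R3 R => dot y y) @^-1` [set 1].
pose H := (fun y : R3 R => dot y x) @^-1` [set t | m <= t].
have cS : closed S.
  by apply: closed_comp => [y _|]; [exact: continuous_dot_self|exact: closed_eq].
have cH : closed H.
  by apply: closed_comp => [y _|]; [exact: continuous_dot|exact: closed_ge].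
have cA : compact (cube `&` (S `&` H)).
  apply: compact_closedI; last exact: closedI.
  by apply: compact_setX; [apply: compact_setX|]; exact: segment_compact.
have inc (y : R3 R) : dot y y = 1 -> cube y.
  rewrite /dot; case: y => [[a b] c]/= e.
  have := sqr_ge0 a; have := sqr_ge0 b; have := sqr_ge0 c => ha hb hc.
  have aux (t : R) : t ^+ 2 <= 1 -> `[(-1)%R, 1%R]%classic t.
    move=> t1; rewrite /= in_itv/= -ler_norml -(@ler_pXn2r _ 2) ?nnegrE//.
    by rewrite real_normK ?num_real// expr1n.
  by split; [split|]; apply: aux => /=; lra.
have A0 : cube `&` (S `&` H) !=set0.
  by exists x; split; [exact: inc|split; rewrite /S /H/= x1].
have [|y] := compact_EVT_max A0 cA (f := G).
  by apply: continuous_subspaceT; exact: continuous_prod_dot.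
rewrite inE => -[_ [y1 ym]] ymax; exists y; split => // z z1 zm; apply: ymax.
by rewrite inE; split; [exact: inc|].
Qed.

Lemma local_max_exists : exists x, local_max_unit v x.
Proof.
have p1 : dot (0, 0, 1) (0, 0, 1) = 1 :> R by rewrite /dot/= !mul0r !add0r mulr1.
(* With [m = - 1] the cap is the whole sphere. *)
have [|y [y1 _ ymax]] := cap_max (m := - 1) p1; first by lra.
exists y; split => //; exists 1 => // z z1 _; apply: ymax => //.
have m1 : dot (0, 0, - 1) (0, 0, - 1) = 1 :> R by rewrite /dot/= !mul0r !add0r mulrNN mulr1.
have := dot_le1 z1 m1; rewrite /dot/=; lra.
Qed.

(** Cauchy-Schwarz for [y - z] and [x], through Lagrange's identity. *)
Lemma dot_sub_sqr (x y z : R3 R) :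
  (dot y x - dot z x) ^+ 2 <= (dot y y + dot z z - 2 * dot z y) * dot x x.
Proof.
move: x y z => [[x1 x2] x3] [[y1 y2] y3] [[z1 z2] z3]; rewrite /dot/= -subr_ge0.
set p := y1 - z1; set r := y2 - z2; set s := y3 - z3.
rewrite (_ : _ - _ = (p * x2 - r * x1) ^+ 2 + (p * x3 - s * x1) ^+ 2 + (r * x3 - s * x2) ^+ 2).
  by rewrite !addr_ge0 ?sqr_ge0.
by rewrite /p /r /s; ring.
Qed.

Lemma norm_le_of_sqr (x y : R) : 0 <= y -> x ^+ 2 <= y ^+ 2 -> - y <= x <= y.
Proof.
by move=> y0 xy; rewrite -ler_norml -(@ler_pXn2r _ 2) ?nnegrE// real_normK ?num_real.
Qed.

(** A maximum over the closed cap is not on the boundary circle, where [G] is smaller than at the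
    centre; by Cauchy-Schwarz the points close to it remain in the cap. *)
Lemma local_max_in_cap (x : R3 R) (m : R) : dot x x = 1 -> m < 1 ->
  (forall z, dot z z = 1 -> dot z x = m -> G z < G x) ->
  exists2 y, local_max_unit v y & m < dot y x.
Proof.
move=> x1 m1 hb; have [y [y1 ym ymax]] := cap_max x1 (ltW m1).
have ym' : m < dot y x.
  rewrite lt_neqAle ym andbT; apply/eqP => e.
  have := ymax x x1; rewrite x1 => /(_ (ltW m1)).
  by rewrite leNgt hb.
exists y => //; split => //; exists ((dot y x - m) ^+ 2 / 2).
  by rewrite divr_gt0// exprn_gt0// subr_gt0.
move=> z z1 hz; apply: ymax => //.
have cs : (dot y x - dot z x) ^+ 2 <= 2 * (1 - dot z y).
  by apply: (le_trans (dot_sub_sqr _ _ _)); rewrite x1 y1 z1; lra.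
have : (dot y x - dot z x) ^+ 2 < (dot y x - m) ^+ 2 by lra.
have [//|h] := leP m (dot z x).
rewrite ltr_pXn2r ?nnegrE ?subr_ge0//; lra.
Qed.

Let q y i := (1 + dot y (v i)) / (1 - dot y (v i)).

(* [hess_sq] is the squared norm of the traceless part of the Hessian, [cubic] controls
   the third-order term; both are written without reference to a frame at [y]. *)
Definition hess_sq (y : R3 R) : R := \sum_i \sum_j
  (2 * ((dot (v i) (v j) - dot y (v i) * dot y (v j)) /
    ((1 - dot y (v i)) * (1 - dot y (v j)))) ^+ 2 - q y i * q y j).

Definition cubic (y : R3 R) : R := \sum_i q y i * Num.sqrt (q y i).

(** With [t = n^(-1/2)] the thresholds make the terms of orders 1, 2 and 3 at most [1 / 2], [1 / 6]
    and [1 / 10]. The last condition bounds every squared modulus by [n / 16], so that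
    [t * |W| <= 1 / 4]. *)
Definition peaked (y : R3 R) := [/\ grad_sq v y <= n%:R / 16, hess_sq y <= (n%:R / 6) ^+ 2,
  cubic y <= n%:R * Num.sqrt n%:R / 60 & forall i, dot y (v i) <= 1 - 32 / n%:R].

Section AtPole.
Variable u : R * R.
Hypotheses (u1 : -1 <= u.1 <= 1) (n16 : (16 <= n)%N).
Hypothesis lt1 : forall i, dot (sph u) (v i) < 1.
Let X i := frame u (v i).
Let a i := (stereo (X i)).1.
Let b i := (stereo (X i)).2.

Let X1 i : dot (X i) (X i) = 1. Proof. by rewrite dot_frame. Qed.
Let X2E i : dot (sph u) (v i) = (X i).2. Proof. by rewrite dotC dot_sph_frame. Qed.
Let X2p i : 0 < 1 - (X i).2. Proof. by rewrite subr_gt0 -X2E. Qed.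

Lemma stereo_norm_sqr i : q (sph u) i = a i ^+ 2 + b i ^+ 2.
Proof.
have lt i' : (X i').2 < 1 by rewrite -X2E.
rewrite /q X2E (stereo_sqr X1 lt i (c := 1) (s := 0)) ?expr1n ?expr0n ?addr0//.
by rewrite /a /b !mul1r !mul0r oppr0 mul0r addr0 add0r.
Qed.

Lemma grad_sq_stereo : grad_sq v (sph u) = (\sum_i a i) ^+ 2 + (\sum_i b i) ^+ 2.
Proof.
rewrite (grad_sqE (f := fun i => (X i).1.1) (g := fun i => (X i).1.2)).
  by congr (_ ^+ 2 + _ ^+ 2); apply: eq_bigr => i _; rewrite X2E.
by move=> i j; rewrite !X2E -(dot_frame _ _ u1) /dot addrK.
Qed.

Lemma hess_sq_stereo : hess_sq (sph u) =
  (\sum_i (a i ^+ 2 - b i ^+ 2)) ^+ 2 + (\sum_i 2 * a i * b i) ^+ 2.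
Proof.
rewrite !expr2 !big_distrlr -big_split/=; apply: eq_bigr => i _.
rewrite -big_split/=; apply: eq_bigr => j _; rewrite !stereo_norm_sqr !X2E.
have -> : dot (v i) (v j) - (X i).2 * (X j).2 = (X i).1.1 * (X j).1.1 + (X i).1.2 * (X j).1.2.
  by rewrite -(dot_frame _ _ u1) /dot addrK.
have -> : ((X i).1.1 * (X j).1.1 + (X i).1.2 * (X j).1.2) / ((1 - (X i).2) * (1 - (X j).2)) =
   a i * a j + b i * b j.
  by rewrite /a /b /stereo/= invfM; ring.
by ring.
Qed.

(** At this radius the term [n * ln (1 + t ^+ 2)], which comes from the Laplacian, is close to 1 and
    exceeds what the other terms can contribute. *)
Lemma peaked_circle : peaked (sph u) -> forall c s, c ^+ 2 + s ^+ 2 = 1 ->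
  \prod_i (1 - dot (horo c s (Num.sqrt n%:R)^-1) (X i)) < \prod_i (1 - (X i).2).
Proof.
move=> [hG hH hT hm] c s cs; set t := _^-1.
have n0 : 0 < n%:R :> R by rewrite ltr0n (leq_trans _ n16).
have n16R : 16 <= n%:R :> R by rewrite ler_nat.
have rn : 0 < Num.sqrt n%:R :> R by rewrite sqrtr_gt0.
have t0 : 0 < t by rewrite invr_gt0.
have nt : n%:R * t ^+ 2 = 1.
  by rewrite /t exprVn sqr_sqrtr ?(ltW n0)// mulfV// lt0r_neq0.
have t2 : t ^+ 2 <= 1 / 16.
  by rewrite -(ler_pM2l n0) nt; lra.
pose al i := c * a i + s * b i; pose be i := - s * a i + c * b i.
pose Q i := q (sph u) i; pose rho i := Num.sqrt (Q i).
have QE i : Q i = al i ^+ 2 + be i ^+ 2.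
  rewrite /Q stereo_norm_sqr /al /be; transitivity ((c ^+ 2 + s ^+ 2) * (a i ^+ 2 + b i ^+ 2)); last by ring.
  by rewrite cs mul1r.
have Q0 i : 0 <= Q i by rewrite QE addr_ge0 ?sqr_ge0.
have rho0 i : 0 <= rho i by exact: sqrtr_ge0.
have rho2 i : rho i ^+ 2 = Q i by rewrite sqr_sqrtr.
have Qn i : Q i <= n%:R / 16.
  have h := hm i; rewrite X2E in h; have xp := X2p i.
  rewrite /Q /q X2E ler_pdivrMr//.
  have : 32 / n%:R <= 1 - (X i).2 by lra.
  rewrite ler_pdivrMr// => h'.
  have : - 1 <= (X i).2.
    have p1 : dot (0, 0, - 1) (0, 0, - 1) = 1 :> R by rewrite /dot/= !mul0r !add0r mulrNN mulr1.
    by have := dot_le1 (X1 i) p1; rewrite /dot/=; lra.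
  lra.
have trho i : t * rho i <= 1 / 4.
  rewrite -(@ler_pXn2r _ 2) ?nnegrE ?mulr_ge0 ?(ltW t0)// exprMn rho2.
  apply: (@le_trans _ _ (t ^+ 2 * (n%:R / 16))); first by rewrite ler_wpM2l ?sqr_ge0.
  by rewrite mulrA (mulrC _ n%:R) nt; lra.
have alrho i : `|al i| <= rho i.
  rewrite -(@ler_pXn2r _ 2) ?nnegrE// rho2 real_normK ?num_real// QE.
  by rewrite lerDl sqr_ge0.
have lnD i : 0 < 1 - 2 * t * al i + t ^+ 2 * Q i /\
    ln (1 - 2 * t * al i + t ^+ 2 * Q i) <=
    - (2 * t * al i) + t ^+ 2 * (be i ^+ 2 - al i ^+ 2) + 6 * t ^+ 3 * (Q i * rho i).
  pose w := t * rho i; pose z := t * al i.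
  have w0 : 0 <= w by rewrite mulr_ge0// ltW.
  have w4 : w <= 1 / 4 by exact: trho.
  have zw : `|z| <= w by rewrite normrM (gtr0_norm t0) ler_wpM2l// ltW.
  move: (zw); rewrite ler_norml => /andP[z1 z2].
  have e : 1 - 2 * t * al i + t ^+ 2 * Q i = 1 + (- (2 * z) + w ^+ 2).
    by rewrite /z /w exprMn rho2; ring.
  rewrite e.
  have -> : t ^+ 2 * (be i ^+ 2 - al i ^+ 2) = w ^+ 2 - 2 * z ^+ 2.
    by rewrite /w exprMn rho2 QE /z; ring.
  have -> : 6 * t ^+ 3 * (Q i * rho i) = 6 * w ^+ 3 by rewrite -rho2 /w; ring.
  have -> : - (2 * t * al i) = - (2 * z) by rewrite /z; ring.
  set x := - (2 * z) + w ^+ 2.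
  have x1 : -1 < x by rewrite /x; nra.
  split; first by lra.
  apply: (le_trans (ln1D_le x1)).
  have x94 : `|x| <= 9 / 4 * w by rewrite ler_norml /x; apply/andP; split; nra.
  have x3 : x ^+ 3 <= 12 * w ^+ 3.
    apply: (@le_trans _ _ (`|x| ^+ 3)); first by rewrite -normrX ler_norm.
    apply: (@le_trans _ _ ((9 / 4 * w) ^+ 3)).
      by rewrite lerXn2r ?nnegrE// mulr_ge0.
    have : 0 <= w ^+ 3 by rewrite exprn_ge0.
    rewrite (_ : (9 / 4 * w) ^+ 3 = 729 / 64 * w ^+ 3); last by field.
    lra.
  have x2 : 4 * z ^+ 2 - 4 * w ^+ 3 <= x ^+ 2.
    have -> : x ^+ 2 = 4 * z ^+ 2 - 4 * (w ^+ 2 * z) + w ^+ 4 by rewrite /x; ring.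
    have h4 : 0 <= w ^+ 4 by rewrite exprn_ge0.
    have : w ^+ 2 * z <= w ^+ 3 by rewrite [leRHS]exprSr ler_wpM2l ?sqr_ge0.
    lra.
  by rewrite {1}/x; lra.
have D0 i := (lnD i).1.
have hsum : \sum_i ln (1 - 2 * t * al i + t ^+ 2 * Q i) < n%:R * ln (1 + t ^+ 2).
  (* The three terms add up to at most [1 / 2 + 1 / 6 + 1 / 10 < 4 / 5], while [n * ln (1 + t ^+ 2)]
     exceeds [4 / 5] because [t ^+ 2 <= 1 / 16]. *)
  apply: (@le_lt_trans _ _ (4 / 5)); last first.
    have := @ln1D_ge R (t ^+ 2); rewrite ger0_norm ?sqr_ge0// => h.
    have : t ^+ 2 - (t ^+ 2) ^+ 2 / 2 - 2 * (t ^+ 2) ^+ 3 <= ln (1 + t ^+ 2).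
      by apply: h; have := sqr_ge0 t; lra.
    move/(ler_wpM2l (ltW n0)); apply: lt_le_trans.
    have -> : n%:R * (t ^+ 2 - (t ^+ 2) ^+ 2 / 2 - 2 * (t ^+ 2) ^+ 3) =
      n%:R * t ^+ 2 * (1 - t ^+ 2 / 2 - 2 * (t ^+ 2) ^+ 2) by ring.
    by rewrite nt; have := sqr_ge0 t; nra.
  apply: (@le_trans _ _ (\sum_i (- (2 * t * al i) + t ^+ 2 * (be i ^+ 2 - al i ^+ 2) + 6 * t ^+ 3 * (Q i * rho i)))).
    by apply: ler_sum => i _; exact: (lnD i).2.
  rewrite !big_split/= sumrN -!mulr_sumr.
  pose A := \sum_i a i; pose B := \sum_i b i.
  have SA : \sum_i al i = c * A + s * B by rewrite /al big_split/= -!mulr_sumr.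
  pose A2 := \sum_i (a i ^+ 2 - b i ^+ 2); pose B2 := \sum_i 2 * a i * b i.
  have SB : \sum_i (be i ^+ 2 - al i ^+ 2) = (s ^+ 2 - c ^+ 2) * A2 - (2 * c * s) * B2.
    rewrite /A2 /B2 !mulr_sumr -sumrB; apply: eq_bigr => i _; rewrite /be /al; ring.
  have lagr (x y p w : R) : x ^+ 2 + y ^+ 2 = 1 -> (x * p + y * w) ^+ 2 <= p ^+ 2 + w ^+ 2.
    move=> xy; rewrite -subr_ge0 (_ : _ - _ = (y * p - x * w) ^+ 2) ?sqr_ge0//.
    by rewrite -[X in X - _]mul1r -xy; ring.
  have SA' : (2 * t * \sum_i al i) ^+ 2 <= (1 / 2) ^+ 2.
    have := lagr c s A B cs; rewrite -grad_sq_stereo SA exprMn => h.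
    apply: (@le_trans _ _ ((2 * t) ^+ 2 * (n%:R / 16))).
      by rewrite ler_wpM2l ?sqr_ge0//; apply: (le_trans h).
    have -> : (2 * t) ^+ 2 * (n%:R / 16) = n%:R * t ^+ 2 / 4 by field.
    by rewrite nt; lra.
  have SB' : (t ^+ 2 * \sum_i (be i ^+ 2 - al i ^+ 2)) ^+ 2 <= (1 / 6) ^+ 2.
    (* Turning the direction by an angle turns the sum of squares by twice that angle, so a unit
       vector again multiplies [(A2, B2)]. *)
    have cs2 : (s ^+ 2 - c ^+ 2) ^+ 2 + (- (2 * c * s)) ^+ 2 = 1.
      by transitivity ((c ^+ 2 + s ^+ 2) ^+ 2); [ring|rewrite cs expr1n].
    have := lagr _ _ A2 B2 cs2; rewrite -hess_sq_stereo mulNr -SB exprMn => h.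
    apply: (@le_trans _ _ ((t ^+ 2) ^+ 2 * (n%:R / 6) ^+ 2)).
      by rewrite ler_wpM2l ?sqr_ge0//; apply: (le_trans h).
    rewrite -exprMn (_ : t ^+ 2 * (n%:R / 6) = n%:R * t ^+ 2 / 6); last by ring.
    by rewrite nt.
  have ST : 6 * t ^+ 3 * \sum_i Q i * rho i <= 1 / 10.
    apply: (@le_trans _ _ (6 * t ^+ 3 * (n%:R * Num.sqrt n%:R / 60))).
      by rewrite ler_wpM2l// mulr_ge0// exprn_ge0// ltW.
    have tr : t * Num.sqrt n%:R = 1 by rewrite mulVf// lt0r_neq0.
    have -> : 6 * t ^+ 3 * (n%:R * Num.sqrt n%:R / 60) =
      (n%:R * t ^+ 2) * (t * Num.sqrt n%:R) / 10 by field.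
    by rewrite nt tr; lra.
  have h12 : 0 <= 1 / 2 :> R by rewrite divr_ge0.
  have h16 : 0 <= 1 / 6 :> R by rewrite divr_ge0.
  have /andP[h1 _] := norm_le_of_sqr h12 SA'.
  have /andP[_ h2] := norm_le_of_sqr h16 SB'.
  move: h1 h2 ST; move: (2 * t * _) (t ^+ 2 * _) (6 * t ^+ 3 * _) => x y z h1 h2 h3; lra.
have hD : \prod_i (1 - 2 * t * al i + t ^+ 2 * Q i) < (1 + t ^+ 2) ^+ n.
  have sq1 : 0 < 1 + t ^+ 2 by rewrite ltr_pwDl// sqr_ge0.
  rewrite -[ltRHS]lnK ?posrE ?exprn_gt0// lnXn// -[X in expR X]mulr_natl.
  rewrite (eq_bigr (fun i => expR (ln (1 - 2 * t * al i + t ^+ 2 * Q i)))).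
    by rewrite -expR_sum ltr_expR.
  by move=> i _; rewrite lnK ?posrE.
have sq1 : 0 < 1 + t ^+ 2 by rewrite ltr_pwDl// sqr_ge0.
have P0 : 0 < \prod_i (1 - (X i).2) by apply: prodr_gt0.
have -> : \prod_i (1 - dot (horo c s t) (X i)) =
   \prod_i (1 - (X i).2) * (\prod_i (1 - 2 * t * al i + t ^+ 2 * Q i) / (1 + t ^+ 2) ^+ n).
  rewrite -[in X in _ / _ ^+ X](card_ord n) -prodr_const -prodf_div -big_split/=.
  apply: eq_bigr => i _; rewrite one_sub_dot_horo /al /Q /a /b /q X2E /stereo/=.
  by field; rewrite (lt0r_neq0 (X2p i)) (lt0r_neq0 sq1).
by rewrite -[ltRHS]mulr1 ltr_pM2l// ltr_pdivrMr ?exprn_gt0// mul1r.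
Qed.

(** The height [(n - 1) / (n + 1)] is that of the circle of [peaked_circle], where
    [t ^+ 2 = n^-1]. *)
Lemma peaked_local_max : peaked (sph u) ->
  exists2 x, local_max_unit v x & (n%:R - 1) / (n%:R + 1) < dot x (sph u).
Proof.
move=> pk; have n0 : 0 < n%:R :> R by rewrite ltr0n (leq_trans _ n16).
have n16R : 16 <= n%:R :> R by rewrite ler_nat.
apply: local_max_in_cap; first exact: dot_sph.
  by rewrite ltr_pdivrMr; lra.
move=> z z1; rewrite dot_sph_frame// => zm.
have := dot_frame z z u1; rewrite z1 => e; rewrite /G.
under eq_bigr do rewrite -(dot_frame _ _ u1).
under [ltRHS]eq_bigr do rewrite X2E.
move: zm e; case: (frame u z) => [[x y] m] zm e; rewrite /dot /= in zm e.
pose t : R := (Num.sqrt n%:R)^-1.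
have rn : 0 < Num.sqrt n%:R :> R by rewrite sqrtr_gt0.
have t0 : 0 < t by rewrite invr_gt0.
have r2 : Num.sqrt n%:R ^+ 2 = n%:R :> R by rewrite sqr_sqrtr// ltW.
pose k : R := (n%:R + 1) / (2 * Num.sqrt n%:R).
have cs : (x * k) ^+ 2 + (y * k) ^+ 2 = 1.
  transitivity ((x * x + y * y) * k ^+ 2); first by ring.
  have -> : x * x + y * y = 1 - m * m by lra.
  rewrite zm /k expr_div_n exprMn r2; field; rewrite !lt0r_neq0//; lra.
have := peaked_circle pk cs; rewrite -/t (_ : horo (x * k) (y * k) t = (x, y, m))//.
rewrite /horo zm /k /t exprVn r2; congr (_, _, _).
- move: rn r2; move: (Num.sqrt n%:R) => r r0 <-.
  by field; rewrite !lt0r_neq0// addr_gt0// exprn_gt0.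
- move: rn r2; move: (Num.sqrt n%:R) => r r0 <-.
  by field; rewrite !lt0r_neq0// addr_gt0// exprn_gt0.
- by field; rewrite !lt0r_neq0//; lra.
Qed.

End AtPole.
End CapMaxima.

(** * Truncated moments *)

Section PeakedCount.
Context {R : realType}.
Local Notation sigma := (@sigma R).
Variable n : nat.

Lemma measurable_peaked d (T : measurableType d) (V : 'I_n -> T -> R3 R) (g : T -> R3 R) :
  (forall i, measurable_fun setT (V i)) -> measurable_fun setT g ->
  measurable [set t | peaked (V ^~ t) (g t)].
Proof.
move=> mV mg.
have md k l : measurable_fun setT (fun t => dot (V k t) (V l t)) by exact: measurable_dot.
have mh k : measurable_fun setT (fun t => dot (g t) (V k t)) by exact: measurable_dot.
have mG := measurable_grad_sq mV mg.
have mH : measurable_fun setT (fun t => hess_sq (V ^~ t) (g t)).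
  by rewrite /hess_sq; apply: measurable_sum => i; apply: measurable_sum => j; meas.
have mC : measurable_fun setT (fun t => cubic (V ^~ t) (g t)).
  by rewrite /cubic; apply: measurable_sum => i; meas.
rewrite (_ : [set t | _] = [set t | grad_sq (V ^~ t) (g t) <= n%:R / 16] `&`
   [set t | hess_sq (V ^~ t) (g t) <= (n%:R / 6) ^+ 2] `&`
   ([set t | cubic (V ^~ t) (g t) <= n%:R * Num.sqrt n%:R / 60] `&`
   \bigcap_(i in [set: 'I_n]) [set t | dot (g t) (V i t) <= 1 - 32 / n%:R])).
  apply: measurableI; apply: measurableI; try exact: measurable_le.
  by apply: fin_bigcap_measurable => // i _; exact: measurable_le.
apply/seteqP; split => t /=.
  by move=> [h1 h2 h3 h4]; split; split => // i _; exact: h4.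
by move=> [[h1 h2] [h3 h4]]; split => // i; exact: h4.
Qed.

Variable v : 'I_n -> R3 R.
Hypotheses (v1 : forall i, dot (v i) (v i) = 1) (n16 : (16 <= n)%N).

(** The caps of measure [1 / (n + 1)] around the local maxima cover the peaked points of the unit
    sphere, so the area of these is at most the number of maxima divided by [n + 1]. *)
Lemma num_local_maxima_ge :
  (n%:R%:E * sigma [set y | peaked v y] <=
    num_local_maxima (fun i => scale (@sphere_radius R n) (v i)))%E.
Proof.
have n0 : (0 < n)%N by exact: leq_trans n16.
have nR : 0 < n%:R :> R by rewrite ltr0n.
rewrite /num_local_maxima /counting; case: asboolP => [fM|_]; last by rewrite leey.
set M := [set x | _] in fM *; set s := finmap.enum_fset _.
set r := @sphere_radius R n.
have us : uniq s by exact: finmap.fset_uniq.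
have sM x : M x -> x \in s by move=> Mx; rewrite /s in_fset_set// inE.
have Ms x : x \in s -> M x by rewrite /s in_fset_set// inE.
pose h : R := 2 / (n%:R + 1).
have h02 : 0 <= h <= 2.
  by rewrite divr_ge0 ?addr_ge0//= ler_pdivrMr ?ltr_wpDl// ler_peMr// lerDr.
have unit_s x : x \in s -> dot (scale r^-1 x) (scale r^-1 x) = 1.
  by move=> /Ms[+ _]; rewrite -{1}(scale_unscale n0 x) => /(sphere_scale n0).
have mP : measurable [set y | peaked v y].
  by apply: (measurable_peaked (V := fun i _ => v i)) => //; meas.
have mC x : measurable [set y : R3 R | 1 - h < dot y (scale r^-1 x)].
  by apply: measurable_gt; apply: measurable_dot => //; meas.
have cover : (sigma [set y | peaked v y] <= ((size s)%:R * (h / 2))%:E)%E.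
  have -> : (((size s)%:R * (h / 2))%:E =
      \int[sigma]_y \sum_(x <- s) (\1_[set y : R3 R | (1 - h < dot y (scale r^-1 x))%R] y)%:E)%E.
    rewrite ge0_integral_sum//; last by move=> x; exact/measurable_EFinP.
    rewrite (eq_big_seq (fun=> (h / 2)%:E)).
      by rewrite sumEFin big_const_seq count_predT iter_addr_0 mulr_natl.
    move=> x xs /=; rewrite integral_indic// setIT.
    exact: (sigma_cap (unit_s x xs)).
  rewrite -[X in (sigma X <= _)%E]setIT -integral_indic//.
  apply: le_integral_sigma.
  - exact/measurable_EFinP.
  - by apply: emeasurable_sum => x; exact/measurable_EFinP.
  - by move=> y; rewrite lee_fin.
  - by move=> y; apply: sume_ge0 => x _; rewrite lee_fin.
  move=> _ /sph_surj[u [u1 u2 ->]]; have [pk|npk] := pselect (peaked v (sph u)); last first.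
    rewrite indicE memNset//=; apply: sume_ge0 => x _; rewrite lee_fin//.
  have lt1 i : dot (sph u) (v i) < 1.
    have [_ _ _ /(_ i)] := pk; have : 0 < 32 / n%:R :> R by rewrite divr_gt0.
    lra.
  have [x /(local_maxP n0 v1) xM hx] := peaked_local_max v1 u1 n16 lt1 pk.
  have xs : scale r x \in s by apply: sM.
  rewrite (bigD1_seq (scale r x))//=; apply: (@le_trans _ _ (1 + 0)%E).
    by rewrite adde0 indicE lee_fin; case: (_ \in _).
  apply: leeD; last by apply: sume_ge0 => z _; rewrite lee_fin.
  rewrite indicE mem_set//= dotC.
  have -> : scale r^-1 (scale r x) = x.
    by apply: (scale_inj n0); rewrite scale_unscale.
  apply: le_lt_trans hx; rewrite le_eqVlt; apply/orP; left; apply/eqP; rewrite /h.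
  by field; rewrite lt0r_neq0// ltr_wpDl.
apply: (le_trans (lee_wpmul2l _ cover)); first by rewrite lee_fin ltW.
rewrite -EFinM lee_fin /h.
have -> : n%:R * ((size s)%:R * (2 / (n%:R + 1) / 2)) = (size s)%:R * (n%:R / (n%:R + 1)) :> R.
  by field; rewrite lt0r_neq0// ltr_wpDl.
by rewrite ler_piMr// ler_pdivrMr ?ltr_wpDl// mul1r lerDl.
Qed.

End PeakedCount.

(** * Moments of the projected point outside a cap *)

Section Moments.
Context {R : realType}.
Local Notation mu := (@lebesgue_measure R).
Local Notation sigma := (@sigma R).

Definition stereo_sq (x : R3 R) : R := (stereo x).1 ^+ 2 + (stereo x).2 ^+ 2.

Lemma measurable_stereo_sq d (T : measurableType d) (h : T -> R3 R) :
  measurable_fun setT h -> measurable_fun setT (fun t => stereo_sq (h t)).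
Proof. by move=> mh; rewrite /stereo_sq /stereo/=; meas. Qed.

Lemma stereo_sqE (x : R3 R) : dot x x = 1 -> x.2 < 1 -> stereo_sq x = (1 + x.2) / (1 - x.2).
Proof.
case: x => [[a b] c]; rewrite /stereo_sq /stereo /dot/= => e c1.
have c0 : 1 - c != 0 by rewrite lt0r_neq0// subr_gt0.
have -> : (a / (1 - c)) ^+ 2 + (b / (1 - c)) ^+ 2 = (a * a + b * b) / (1 - c) ^+ 2 by field.
have -> : a * a + b * b = 1 - c * c by lra.
by field.
Qed.

Lemma integral_sigma_height (f : R -> \bar R) : measurable_fun setT f -> (forall c, 0 <= f c)%E ->
  (\int[sigma]_x f x.2 = (2^-1)%:E * \int[mu]_(c in `[(-1)%R, 1%R]) f c)%E.
Proof.
move=> mf f0; have pi0 := pi_gt0 R.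
rewrite (integral_sigma (f := fun x => f x.2))//; last first.
  by apply: (measurableT_comp mf); meas.
have -> : (\int[mu]_(c in `[(-1)%R, 1%R]) \int[mu]_(p in `[0%R, (2 * pi)%R]) f (sph (c, p)).2 =
    \int[mu]_(c in `[(-1)%R, 1%R]) ((2 * pi)%:E * f c))%E.
  apply: eq_integral => c _; rewrite /= integral_cst//= lebesgue_measure_itv/= lte_fin two_pi_gt0.
  by rewrite -EFinB subr0 muleC.
rewrite ge0_integralZl//; first last.
- by rewrite lee_fin mulr_ge0// ltW.
- exact: measurable_funTS.
rewrite muleA -EFinM; congr (_%:E * _)%E; move: (pi : R) pi0 => p p0.
by field; exact: lt0r_neq0.
Qed.

Lemma sigma_low (e : R) : 0 <= e <= 2 -> sigma [set x : R3 R | x.2 <= 1 - e] = (1 - e / 2)%:E.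
Proof.
move=> e02; have p1 : dot (0, 0, 1) (0, 0, 1) = 1 :> R by rewrite /dot/= !mul0r !add0r mulr1.
have := sigma_cap p1 e02.
rewrite (_ : [set y | _] = ~` [set x : R3 R | x.2 <= 1 - e]); last first.
  apply/seteqP; split => x /=; rewrite /dot/= !mulr0 !add0r mulr1; first by rewrite ltNge => /negP.
  by move/negP; rewrite -ltNge.
have mA : measurable [set x : R3 R | x.2 <= 1 - e] by apply: measurable_le; meas.
move=> h; have := probability_setC sigma (measurableC mA); rewrite setCK h => ->.
by rewrite -EFinB.
Qed.

(** The height being uniform, the moment is half an integral over [[-1, 1 - e]]. The majorant [f],
    in practice obtained from [1 + c <= 2], has the explicit antiderivative [F]. The absolute value
    makes the integrand nonnegative everywhere. *)
Lemma truncated_moment (e : R) (psi f F : R -> R) : 0 < e < 2 ->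
  measurable_fun setT psi -> (forall q, 0 <= q -> 0 <= psi q) ->
  (forall c, -1 <= c < 1 -> psi ((1 + c) / (1 - c)) <= f c) ->
  (forall c : R, c < 1 -> is_derive c 1 F (f c)) -> (forall c : R, c < 1 -> derivable f c 1) ->
  0 <= F (-1) ->
  (\int[sigma]_x (\1_[set x : R3 R | (x.2 <= 1 - e)%R] x * `|psi (stereo_sq x)|)%:E
    <= (F (1 - e) / 2)%:E)%E.
Proof.
move=> /andP[e0 e2] mpsi psi0 psif dF df F0.
have N1e : - 1 < 1 - e by lra.
pose g (c : R) : R := \1_(`]-oo, 1 - e]%classic : set R) c * `|psi ((1 + c) / (1 - c))|.
have g0 c : 0 <= g c by rewrite /g mulr_ge0.
have mg : measurable_fun setT g.
  apply: measurable_funM; first exact: measurable_indic.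
  by apply: measurable_normr_comp; apply: (measurableT_comp mpsi); meas.
have q0 (c : R) : -1 <= c < 1 -> 0 <= (1 + c) / (1 - c) by move=> /andP[? ?]; apply: divr_ge0; lra.
have f0 (c : R) : -1 <= c < 1 -> 0 <= f c by move=> c1; apply: le_trans (psif c c1); exact/psi0/q0.
have mA : measurable [set x : R3 R | x.2 <= 1 - e] by apply: measurable_le; meas.
apply: (@le_trans _ _ (\int[sigma]_x (g x.2)%:E)%E).
  apply: le_integral_sigma.
  - apply/measurable_EFinP; apply: measurable_funM; first exact: measurable_indic.
    by apply: measurable_normr_comp; apply: (measurableT_comp mpsi); apply: measurable_stereo_sq; meas.
  - by apply/measurable_EFinP; apply: (measurableT_comp mg); meas.
  - by move=> x; rewrite lee_fin mulr_ge0.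
  - by move=> x; rewrite lee_fin.
  move=> x x1; rewrite lee_fin /g; have [xe|xe] := leP x.2 (1 - e); last first.
    by rewrite indicE memNset ?mul0r ?mulr_ge0//= => h; move: xe; rewrite ltNge h.
  by rewrite stereo_sqE//; lra.
rewrite (integral_sigma_height (f := fun c => (g c)%:E))//; last first.
  exact/measurable_EFinP.
have cf : {within `[(-1)%R, 1 - e], continuous f}.
  by apply: derivable_within_continuous => c; rewrite in_itv/= => /andP[_ c1]; apply: df; lra.
have mf : measurable_fun `[(-1)%R, 1 - e]%classic (EFin \o f).
  by apply/measurable_EFinP; exact: subspace_continuous_measurable_fun.
have sub : `[(-1)%R, 1 - e]%classic `<=` `[(-1)%R, 1%R]%classic.
  by move=> c /=; rewrite !in_itv/= => /andP[-> c1]; lra.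
have le1 : (\int[mu]_(c in `[(-1)%R, 1%R]) (g c)%:E <= \int[mu]_(c in `[(-1)%R, (1 - e)%R]) (f c)%:E)%E.
  rewrite -(setIidr sub) integral_mkcondr; apply: ge0_le_integral => //.
  - by move=> c _; rewrite lee_fin.
  - by apply: measurable_funTS; apply/measurable_EFinP.
  - apply: measurable_funTS; apply/(measurable_restrictT _ (measurable_itv _)); exact: mf.
  move=> c /=; rewrite in_itv/= => /andP[c1 c2]; rewrite patchE /g.
  have [ce|ce] := leP c (1 - e); last first.
    rewrite !(indicE, memNset) ?mul0r/=; first by [].
      by rewrite in_itv/= => /andP[_]; rewrite leNgt ce.
    by rewrite in_itv/= leNgt ce.
  rewrite mem_set; last by rewrite /= in_itv/= c1.
  have cc : -1 <= c < 1 by rewrite c1/=; lra.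
  by rewrite indicE mem_set/= ?in_itv//= mul1r lee_fin ger0_norm ?psif//; exact/psi0/q0.
apply: (le_trans (lee_wpmul2l _ le1)); first by rewrite lee_fin invr_ge0.
rewrite (@continuous_FTC2 R f F)//; last 2 first.
- split.
  + by move=> c; rewrite in_itv/= => /andP[_ c1]; have [] := dF c ltac:(lra).
  + apply/cvg_at_right_filter; apply: differentiable_continuous.
    by apply/derivable1_diffP; have [] := dF (-1) ltac:(lra).
  + apply/cvg_at_left_filter; apply: differentiable_continuous.
    by apply/derivable1_diffP; have [] := dF (1 - e) ltac:(lra).
- by move=> c; rewrite in_itv/= => /andP[_ c1]; rewrite derive1E; have [_] := dF c ltac:(lra).
by rewrite -EFinB -EFinM lee_fin; lra.
Qed.

Lemma truncated_moment2 (e : R) : 0 < e < 2 ->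
  (\int[sigma]_x (\1_[set x : R3 R | (x.2 <= 1 - e)%R] x * `|stereo_sq x|)%:E
    <= (ln (2 / e))%:E)%E.
Proof.
move=> /andP[e0 e2].
pose F (c : R) : R := 2 * ln 2 - 2 * ln (1 - c); pose f (c : R) : R := 2 / (1 - c).
have -> : ln (2 / e) = F (1 - e) / 2.
  by rewrite lnM ?posrE ?invr_gt0// lnV ?posrE// /F (_ : 1 - (1 - e) = e); [field|ring].
apply: (truncated_moment (psi := id) (f := f)); first by rewrite e0.
- exact: measurable_id.
- by [].
- by move=> c /andP[c1 c2]; rewrite /f ler_pM2r ?invr_gt0 ?subr_gt0//; lra.
- move=> c c1; have c0 : 0 < 1 - c by lra.
  have dl : is_derive c 1 (fun t => ln (1 - t)) (- (1 - c)^-1).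
    by have := is_derive1_ln c0 => dln; apply: is_derive_eq; rewrite /GRing.scale/=; ring.
  by apply: is_derive_eq; rewrite /f /GRing.scale/=; ring.
- move=> c c1; have c0 : 1 - c != 0 by rewrite lt0r_neq0// subr_gt0.
  by apply: derivableM => //; apply: derivableV => //; exact: derivableB.
- by rewrite /F opprK subrr.
Qed.

Lemma truncated_moment4 (e : R) : 0 < e < 2 ->
  (\int[sigma]_x (\1_[set x : R3 R | (x.2 <= 1 - e)%R] x * `|stereo_sq x ^+ 2|)%:E
    <= (2 / e)%:E)%E.
Proof.
move=> /andP[e0 e2].
pose F (c : R) : R := 4 / (1 - c); pose f (c : R) : R := 4 / (1 - c) ^+ 2.
have -> : 2 / e = F (1 - e) / 2.
  by rewrite /F (_ : 1 - (1 - e) = e); [field; exact: lt0r_neq0|ring].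
apply: (truncated_moment (psi := fun q => q ^+ 2) (f := f)); first by rewrite e0.
- by meas.
- by move=> q _; exact: sqr_ge0.
- move=> c /andP[c1 c2]; rewrite /f expr_div_n ler_pM2r ?invr_gt0 ?exprn_gt0 ?subr_gt0//.
  by nra.
- move=> c c1; have c0 : 1 - c != 0 by rewrite lt0r_neq0// subr_gt0.
  by apply: is_derive_eq; rewrite /f /GRing.scale/=; field.
- move=> c c1; have c0 : (1 - c) ^+ 2 != 0 by rewrite lt0r_neq0// exprn_gt0// subr_gt0.
  apply: derivableM => //; apply: derivableV => //; apply: derivableX; exact: derivableB.
- by rewrite /F opprK divr_ge0// addr_ge0.
Qed.

Lemma truncated_moment3 (e : R) : 0 < e < 2 ->
  (\int[sigma]_x (\1_[set x : R3 R | (x.2 <= 1 - e)%R] x * `|stereo_sq x * Num.sqrt (stereo_sq x)|)%:E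
    <= (2 * Num.sqrt (2 / e))%:E)%E.
Proof.
move=> /andP[e0 e2].
(* [E c] is the square root of [2 / (1 - c)], in a form that is easy to differentiate. *)
pose E (c : R) : R := expR ((ln 2 - ln (1 - c)) / 2).
pose F (c : R) : R := 4 * E c; pose f (c : R) : R := 2 / (1 - c) * E c.
have EE (c : R) : c < 1 -> E c = Num.sqrt (2 / (1 - c)).
  move=> c1; have c0 : 0 < 1 - c by lra.
  have e2' : E c ^+ 2 = 2 / (1 - c).
    rewrite /E -expRM_natl (_ : 2%:R * _ = ln 2 - ln (1 - c)); last by field.
    by rewrite expRD expRN !lnK ?posrE.
  by rewrite -e2' sqrtr_sqr ger0_norm// expR_ge0.
have dE (c : R) : c < 1 -> is_derive c 1 E (E c / (2 * (1 - c))).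
  move=> c1; have c0 : 0 < 1 - c by lra.
  have dl : is_derive c 1 (fun t => ln (1 - t)) (- (1 - c)^-1).
    by have := is_derive1_ln c0 => dln; apply: is_derive_eq; rewrite /GRing.scale/=; ring.
  apply: is_derive_eq; rewrite /GRing.scale/= -/(E c); field; exact: lt0r_neq0.
have -> : 2 * Num.sqrt (2 / e) = F (1 - e) / 2.
  rewrite /F EE; last by lra.
  rewrite (_ : 1 - (1 - e) = e); last by ring.
  by move: (Num.sqrt _) => z; field.
apply: (truncated_moment (psi := fun q => q * Num.sqrt q) (f := f)); first by rewrite e0.
- by meas.
- by move=> q q0; rewrite mulr_ge0// sqrtr_ge0.
- move=> c /andP[c1 c2]; have c0 : 0 < 1 - c by lra.
  rewrite /f EE//; apply: ler_pM; rewrite ?sqrtr_ge0//; first by apply: divr_ge0; lra.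
    by rewrite ler_pM2r ?invr_gt0//; lra.
  by rewrite ler_wsqrtr// ler_pM2r ?invr_gt0//; lra.
- move=> c c1; have d := dE c c1; have c0 : 1 - c != 0 by rewrite lt0r_neq0// subr_gt0.
  by apply: is_derive_eq; rewrite /f /GRing.scale/=; field.
- move=> c c1; have c0 : 1 - c != 0 by rewrite lt0r_neq0// subr_gt0.
  apply: derivableM; last by have [] := dE c c1.
  by apply: derivableM => //; apply: derivableV => //; exact: derivableB.
- by rewrite /F mulr_ge0// expR_ge0.
Qed.

End Moments.

(** * The lower bound *)

Section Accumulator.
Context d (T : measurableType d) (R : realType) (P : probability T R) (n : nat).
Variable V : 'I_n -> T -> R3 R.
Hypotheses (mV : forall i, measurable_fun setT (V i)) (iV : indep_family P V).
Hypothesis lawV : forall i A, measurable A -> P (V i @^-1` A) = sigma A.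
Context dz (Z : measurableType dz) (st : R3 R -> Z -> Z).
Hypothesis mst : measurable_fun setT (fun z : R3 R * Z => st z.1 z.2).
Local Open Scope ereal_scope.

Definition gather (x0 : Z) (r : seq 'I_n) (w : T) : Z := foldr (fun k => st (V k w)) x0 r.

(** Transition operator of the Markov chain of successive states. *)
Definition avg_step (f : Z -> \bar R) (z : Z) : \bar R := \int[sigma]_v f (st v z).

Lemma measurable_gather x0 r : measurable_wrt V r (gather x0 r).
Proof.
have : {subset r <= r} by [].
elim: {1 4}r => [|i s IH] sr; rewrite /measurable_wrt /gather/=; first exact: measurable_cst.
apply: (measurableT_comp mst (g := fun w : g_sigma_algebraType (cylinders V r) => (V i w, gather x0 s w))).
apply: measurable_fun_pair; last by apply: IH => j js; rewrite sr// inE js orbT.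
by apply: measurable_wrt_coord; rewrite sr// inE eqxx.
Qed.

Lemma measurable_avg_step f : measurable_fun setT f -> (forall z, 0 <= f z) ->
  measurable_fun setT (avg_step f).
Proof.
move=> mf f0; apply: (@measurable_integral_in _ _ _ _ _ sigma setT (fun z v => f (st v z))) => //.
apply: (measurableT_comp mf).
by apply: (measurableT_comp mst (g := fun z : Z * R3 R => (z.2, z.1))); exact: measurable_fun_pair.
Qed.

Lemma avg_step_ge0 f : (forall z, 0 <= f z) -> forall z, 0 <= avg_step f z.
Proof. by move=> f0 z; exact: integral_ge0. Qed.

Lemma measurable_iter_avg_step f m : measurable_fun setT f -> (forall z, 0 <= f z) ->
  measurable_fun setT (iter m avg_step f) /\ (forall z, 0 <= iter m avg_step f z).
Proof.
move=> mf f0; elim: m => //= m [IHm IH0].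
by split; [exact: measurable_avg_step|exact: avg_step_ge0].
Qed.

(** The head of the list is independent of the state gathered from the tail and is integrated out
    first. *)
Lemma integral_gather x0 r f : uniq r -> measurable_fun setT f -> (forall z, 0 <= f z) ->
  \int[P]_w f (gather x0 r w) = iter (size r) avg_step f x0.
Proof.
elim: r f => [|k r IH] f /=.
  by move=> _ _ _; rewrite integral_cst//= probability_setT mule1.
move=> /andP[kr ur] mf f0; rewrite -iterS iterSr -IH//; first last.
- exact: avg_step_ge0.
- exact: measurable_avg_step.
rewrite (ge0_integral_indep_coord mV iV lawV (f := fun z => f (st z.1 z.2)) kr (Z := gather x0 r))//.
- exact: measurable_gather.
- exact: measurableT_comp.
Qed.

Let mstl z : measurable_fun setT (fun v => st v z).
Proof. by apply: (measurableT_comp mst (g := fun v => (v, z))); exact: measurable_fun_pair. Qed.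

(** With [g] a half turn, this will give the state and its mirror image the same law. *)
Lemma iter_avg_step_sym (g : R3 R -> R3 R) (nu : Z -> Z) f m z :
  (forall h : R3 R -> \bar R, measurable_fun setT h -> (forall x, 0 <= h x) ->
     \int[sigma]_x h (g x) = \int[sigma]_x h x) ->
  (forall v z, st (g v) (nu z) = nu (st v z)) ->
  measurable_fun setT f -> (forall z, 0 <= f z) ->
  iter m avg_step (f \o nu) z = iter m avg_step f (nu z).
Proof.
move=> hg hst mf f0; elim: m z => //= m IH z.
have [mI I0] := measurable_iter_avg_step m mf f0.
rewrite /avg_step; under eq_integral do rewrite IH -hst.
by rewrite (hg (fun v => iter m avg_step f (st v (nu z))))//; exact: measurableT_comp.
Qed.

(** The two hypotheses form a triangular linear recursion with equal diagonal entries [p], whence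
    the factor [m * p ^+ m.-1]. *)
Lemma iter_avg_step_le (G H : Z -> R) (p b : R) m z :
  measurable_fun setT G -> measurable_fun setT H -> (forall z, 0 <= G z)%R -> (forall z, 0 <= H z)%R ->
  (0 <= p)%R -> (0 <= b)%R ->
  (forall z, avg_step (EFin \o G) z <= (p * G z)%:E) ->
  (forall z, avg_step (EFin \o H) z <= (p * H z + b * G z)%:E) ->
  iter m avg_step (EFin \o H) z <= (p ^+ m * H z + m%:R * b * p ^+ m.-1 * G z)%:E.
Proof.
move=> mG mH G0 H0 p0 b0 hG hH; elim: m z => [|m IH] z /=.
  by rewrite expr0 mul1r !mul0r addr0.
have mEH : measurable_fun setT (EFin \o H) by exact/measurable_EFinP.
have [mI I0] := measurable_iter_avg_step m mEH (fun z => H0 z : (0 <= (EFin \o H) z)%E).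
pose c1 := (p ^+ m)%R; pose c2 := (m%:R * b * p ^+ m.-1)%R.
have c10 : (0 <= c1)%R by exact: exprn_ge0.
have c20 : (0 <= c2)%R by rewrite !mulr_ge0// exprn_ge0.
apply: (@le_trans _ _ (\int[sigma]_v (c1%:E * (H (st v z))%:E + c2%:E * (G (st v z))%:E))).
  apply: ge0_le_integral => //.
  - exact: measurableT_comp.
  - apply/measurable_EFinP; apply: measurable_funD; apply: measurable_funM => //.
      exact: (measurableT_comp mH).
    exact: (measurableT_comp mG).
rewrite ge0_integralD//; first last.
- by apply/measurable_EFinP; apply: measurable_funM => //; exact: (measurableT_comp mG).
- by move=> v _; rewrite mule_ge0// lee_fin.
- by apply/measurable_EFinP; apply: measurable_funM => //; exact: (measurableT_comp mH).
- by move=> v _; rewrite mule_ge0// lee_fin.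
rewrite !ge0_integralZl//; first last.
- by move=> v _; rewrite lee_fin.
- by apply/measurable_EFinP; exact: (measurableT_comp mH).
- by move=> v _; rewrite lee_fin.
- by apply/measurable_EFinP; exact: (measurableT_comp mG).
apply: (le_trans (leeD (lee_wpmul2l _ (hH z)) (lee_wpmul2l _ (hG z)))) => //.
rewrite -!EFinM -EFinD lee_fin le_eqVlt; apply/orP; left; apply/eqP.
rewrite /c1 /c2; case: m {IH mI I0 c1 c2 c10 c20} => [|m] /=; first by rewrite !expr0; ring.
by rewrite -[in RHS]natr1 !exprS; ring.
Qed.

End Accumulator.

(** * One step of the truncated sums *)

Section TruncatedState.
Context {R : realType}.
Local Notation sigma := (@sigma R).
Variable e : R.
Hypothesis e01 : 0 < e <= 1.

Definition low (x : R3 R) : R := \1_[set x : R3 R | x.2 <= 1 - e] x.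
Definition sq1 (x : R3 R) : R := (stereo x).1 ^+ 2 - (stereo x).2 ^+ 2.
Definition sq2 (x : R3 R) : R := 2 * (stereo x).1 * (stereo x).2.
Definition cube (x : R3 R) : R := stereo_sq x * Num.sqrt (stereo_sq x).

(* The state records the sums of W, W^2 and |W|^3 over the points met so far, where W is the
   stereographic image seen as a complex number, and whether all of them avoid the cap. *)
Definition add_point (x : R3 R) (z : (R * R) * (R * R) * (R * R)) : (R * R) * (R * R) * (R * R) :=
  (((stereo x).1 + z.1.1.1, (stereo x).2 + z.1.1.2), (sq1 x + z.1.2.1, sq2 x + z.1.2.2),
   (cube x + z.2.1, low x * z.2.2)).

Lemma measurable_low : measurable_fun setT low.
Proof. by apply: measurable_indic; apply: measurable_le; meas. Qed.

Lemma measurable_add_point : measurable_fun setT (fun z => add_point z.1 z.2).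
Proof.
have ml : measurable_fun setT (fun z : R3 R * ((R * R) * (R * R) * (R * R)) => low z.1).
  by apply: (measurableT_comp measurable_low); meas.
by do 2 (apply: measurable_fun_pair => //=); try (apply: measurable_fun_pair => //=);
  rewrite /sq1 /sq2 /cube /stereo_sq /stereo/=; meas.
Qed.

Let p : R := 1 - e / 2.

Lemma integral_low : (\int[sigma]_x (low x)%:E = p%:E)%E.
Proof.
rewrite /low integral_indic//; last by apply: measurable_le; meas.
rewrite setIT; apply: sigma_low; move: e01 => /andP[? ?]; apply/andP; split; lra.
Qed.

(* The hypothesis [kN] and the invariance of sigma remove the cross term. *)
Lemma integral_low_sqr (g : R3 R -> R3 R) (k1 k2 : R3 R -> R) (b x1 x2 : R) :
  (forall h : R3 R -> \bar R, measurable_fun setT h -> (forall x, (0 <= h x)%E) ->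
     (\int[sigma]_x h (g x) = \int[sigma]_x h x)%E) ->
  measurable_fun setT k1 -> measurable_fun setT k2 ->
  (forall x, k1 (g x) = - k1 x /\ k2 (g x) = - k2 x) -> (forall x, (g x).2 = x.2) ->
  (\int[sigma]_x (low x * `|k1 x ^+ 2 + k2 x ^+ 2|)%:E <= b%:E)%E ->
  (\int[sigma]_x (low x * ((k1 x + x1) ^+ 2 + (k2 x + x2) ^+ 2))%:E <=
    (p * (x1 ^+ 2 + x2 ^+ 2) + b)%:E)%E.
Proof.
move=> hg mk1 mk2 kN g2 hb.
have l0 x : 0 <= low x by rewrite /low indicE.
have ml := measurable_low.
pose h (s : R) (x : R3 R) : R := low x * ((s * k1 x + x1) ^+ 2 + (s * k2 x + x2) ^+ 2).
have h0 s x : 0 <= h s x by rewrite mulr_ge0// addr_ge0 ?sqr_ge0.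
have mh s : measurable_fun setT (h s) by rewrite /h; meas.
have E : (\int[sigma]_x (h 1 x)%:E = \int[sigma]_x (h (-1) x)%:E)%E.
  have mE : measurable_fun setT (fun x => (h (-1) x)%:E) by apply/measurable_EFinP; exact: mh.
  have hE0 x : (0 <= (h (-1) x)%:E)%E by rewrite lee_fin.
  rewrite -(hg _ mE hE0).
  apply: eq_integral => x _; have [e1 e2] := kN x.
  by rewrite /h e1 e2 !mulrNN /low !indicE !mul1r; congr (_ * _)%:E; congr (nat_of_bool _)%:R;
    apply/idP/idP; rewrite !inE/= g2.
have -> : (\int[sigma]_x (low x * ((k1 x + x1) ^+ 2 + (k2 x + x2) ^+ 2))%:E =
    \int[sigma]_x (h 1 x)%:E)%E by apply: eq_integral => x _; rewrite /h !mul1r.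
have S : (\int[sigma]_x (h 1 x)%:E + \int[sigma]_x (h (-1) x)%:E =
   2%:E * \int[sigma]_x (low x * (x1 ^+ 2 + x2 ^+ 2) + low x * `|k1 x ^+ 2 + k2 x ^+ 2|)%:E)%E.
  rewrite -ge0_integralD//; try exact/measurable_EFinP; try (by move=> x _; rewrite lee_fin).
  rewrite -ge0_integralZl//; first last.
  - by move=> x _; rewrite lee_fin addr_ge0// mulr_ge0// addr_ge0 ?sqr_ge0.
  - by apply/measurable_EFinP; meas.
  apply: eq_integral => x _; rewrite -EFinD -EFinM; congr EFin.
  by rewrite ger0_norm ?addr_ge0 ?sqr_ge0// /h; ring.
have -> : (\int[sigma]_x (h 1 x)%:E = (2^-1)%:E * (\int[sigma]_x (h 1 x)%:E + \int[sigma]_x (h (-1) x)%:E))%E.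
  rewrite -E; set I := (\int[sigma]_x _)%E.
  have I0 : (0 <= I)%E by apply: integral_ge0 => x _; rewrite lee_fin.
  by rewrite ge0_muleDr// -ge0_muleDl ?lee_fin ?invr_ge0// -EFinD -[LHS]mul1e; congr (_%:E * _)%E; field.
rewrite S muleA -EFinM mulVf// mul1e.
under eq_integral do rewrite EFinD.
rewrite ge0_integralD//; first last.
- by apply/measurable_EFinP; meas.
- by move=> x _; rewrite lee_fin mulr_ge0.
- by apply/measurable_EFinP; meas.
- by move=> x _; rewrite lee_fin mulr_ge0// addr_ge0 ?sqr_ge0.
rewrite EFinD; apply: leeD => //.
under eq_integral do rewrite EFinM.
rewrite ge0_integralZr//; first last.
- by rewrite lee_fin addr_ge0 ?sqr_ge0.
- by move=> x _; rewrite lee_fin.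
- exact/measurable_EFinP.
by rewrite integral_low EFinM.
Qed.

Local Notation Z := ((R * R) * (R * R) * (R * R))%type.
Local Notation step := (avg_step add_point).

Let l0 x : 0 <= low x. Proof. by rewrite /low indicE. Qed.

Let p0 : 0 <= p.
Proof. by move: e01 => /andP[? ?]; rewrite /p; lra. Qed.

(** Along the chain the last component is 0 or 1; absolute values make these functions nonnegative
    on all states. *)
Definition flag (z : Z) : R := `|z.2.2|.
Definition flag_sum1 (z : Z) : R := `|z.2.2| * (z.1.1.1 ^+ 2 + z.1.1.2 ^+ 2).
Definition flag_sum2 (z : Z) : R := `|z.2.2| * (z.1.2.1 ^+ 2 + z.1.2.2 ^+ 2).
Definition flag_sum3 (z : Z) : R := `|z.2.2| * `|z.2.1|.

Lemma measurable_sq1 : measurable_fun setT sq1.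
Proof. by rewrite /sq1 /stereo/=; meas. Qed.

Lemma measurable_sq2 : measurable_fun setT sq2.
Proof. by rewrite /sq2 /stereo/=; meas. Qed.

Lemma measurable_cube : measurable_fun setT cube.
Proof. by rewrite /cube /stereo_sq /stereo/=; meas. Qed.

Let pull (k : R3 R -> R) (c b : R) : 0 <= c -> measurable_fun setT k -> (forall x, 0 <= k x) ->
  (\int[sigma]_x (low x * k x)%:E <= b%:E)%E ->
  (\int[sigma]_x (low x * c * k x)%:E <= (c * b)%:E)%E.
Proof.
move=> c0 mk k0 kb.
have -> : (\int[sigma]_x (low x * c * k x)%:E = \int[sigma]_x (c%:E * (low x * k x)%:E))%E.
  by apply: eq_integral => x _; rewrite -EFinM; congr EFin; ring.
rewrite ge0_integralZl//; first last.
- by move=> x _; rewrite lee_fin mulr_ge0.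
- by apply/measurable_EFinP; apply: measurable_funM => //; exact: measurable_low.
by rewrite EFinM lee_wpmul2l// lee_fin.
Qed.

Lemma step_flag z : step (EFin \o flag) z = (p * flag z)%:E.
Proof.
rewrite /avg_step /flag/=; under eq_integral do rewrite normrM (ger0_norm (l0 _)).
under eq_integral do rewrite EFinM.
rewrite ge0_integralZr//; first by rewrite integral_low EFinM.
- by apply/measurable_EFinP; exact: measurable_low.
- by move=> x _; rewrite lee_fin.
Qed.

Lemma step_flag_sum1 z :
  (step (EFin \o flag_sum1) z <= (p * flag_sum1 z + ln (2 / e) * flag z)%:E)%E.
Proof.
rewrite /avg_step /flag_sum1 /flag/=; under eq_integral do rewrite normrM (ger0_norm (l0 _)).
have -> : p * (`|z.2.2| * (z.1.1.1 ^+ 2 + z.1.1.2 ^+ 2)) + ln (2 / e) * `|z.2.2| =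
   `|z.2.2| * (p * (z.1.1.1 ^+ 2 + z.1.1.2 ^+ 2) + ln (2 / e)) by ring.
apply: pull => //.
- by meas; rewrite /stereo/=; meas.
- by move=> x; rewrite addr_ge0 ?sqr_ge0.
(* The half turn about the vertical axis changes the sign of W. *)
apply: (integral_low_sqr (g := rotZ pi)).
- by move=> h mh h0; apply: integral_sigma_rotZ => //; rewrite ger0_norm ?pi_ge0//; have := pi_ge0 R; lra.
- by rewrite /stereo/=; meas.
- by rewrite /stereo/=; meas.
- by move=> x; rewrite /rotZ/= cospi sinpi; split; ring.
- by [].
- by apply: truncated_moment2; move: e01 => /andP[-> ?]/=; lra.
Qed.

Lemma step_flag_sum2 z :
  (step (EFin \o flag_sum2) z <= (p * flag_sum2 z + 2 / e * flag z)%:E)%E.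
Proof.
rewrite /avg_step /flag_sum2 /flag/=; under eq_integral do rewrite normrM (ger0_norm (l0 _)).
have -> : p * (`|z.2.2| * (z.1.2.1 ^+ 2 + z.1.2.2 ^+ 2)) + 2 / e * `|z.2.2| =
   `|z.2.2| * (p * (z.1.2.1 ^+ 2 + z.1.2.2 ^+ 2) + 2 / e) by ring.
apply: pull => //.
- by have m1 := measurable_sq1; have m2 := measurable_sq2; meas.
- by move=> x; rewrite addr_ge0 ?sqr_ge0.
(* The quarter turn about the vertical axis changes the sign of W^2. *)
apply: (integral_low_sqr (g := rotZ (pi / 2))).
- move=> h mh h0; apply: integral_sigma_rotZ => //; rewrite ger0_norm ?divr_ge0 ?pi_ge0//.
  by have := pi_ge0 R; lra.
- exact: measurable_sq1.
- exact: measurable_sq2.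
- move=> x; rewrite /sq1 /sq2 /stereo /rotZ/= cos_pihalf sin_pihalf; split; ring.
- by [].
- have -> : (\int[sigma]_x (low x * `|sq1 x ^+ 2 + sq2 x ^+ 2|)%:E =
    \int[sigma]_x (\1_[set x : R3 R | (x.2 <= 1 - e)%R] x * `|stereo_sq x ^+ 2|)%:E)%E.
    apply: eq_integral => x _; congr (_ * `|_|)%:E; rewrite /sq1 /sq2 /stereo_sq; ring.
  by apply: truncated_moment4; move: e01 => /andP[-> ?]/=; lra.
Qed.

(** No cancellation is sought for the cubes, which are nonnegative on the sphere; the triangle
    inequality gives a bound of the right order. *)
Lemma step_flag_sum3 z :
  (step (EFin \o flag_sum3) z <= (p * flag_sum3 z + 2 * Num.sqrt (2 / e) * flag z)%:E)%E.
Proof.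
rewrite /avg_step /flag_sum3 /flag/=; under eq_integral do rewrite normrM (ger0_norm (l0 _)).
have -> : p * (`|z.2.2| * `|z.2.1|) + 2 * Num.sqrt (2 / e) * `|z.2.2| =
   `|z.2.2| * (p * `|z.2.1| + 2 * Num.sqrt (2 / e)) by ring.
have mc := measurable_cube; have ml := measurable_low.
apply: pull => //; first by meas.
apply: (@le_trans _ _ (\int[sigma]_x ((low x)%:E * `|z.2.1|%:E + (low x * `|cube x|)%:E))%E).
  apply: ge0_le_integral => //.
  - by move=> x _; rewrite lee_fin mulr_ge0.
  - by apply/measurable_EFinP; meas.
  - by apply: emeasurable_funD; [apply: emeasurable_funM => //|]; apply/measurable_EFinP; meas.
  - move=> x _; rewrite -EFinM -EFinD lee_fin -mulrDr ler_wpM2l// addrC; exact: ler_normD.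
rewrite ge0_integralD//; first last.
- by apply/measurable_EFinP; meas.
- by move=> x _; rewrite lee_fin mulr_ge0.
- by apply: emeasurable_funM => //; apply/measurable_EFinP; meas.
- by move=> x _; rewrite mule_ge0 ?lee_fin.
rewrite EFinD; apply: leeD.
  rewrite ge0_integralZr//; first by rewrite integral_low EFinM.
  - exact/measurable_EFinP.
  - by move=> x _; rewrite lee_fin.
by apply: truncated_moment3; move: e01 => /andP[-> ?]/=; lra.
Qed.

End TruncatedState.

(** * Probability of the conditions of the criterion at the pole *)

Section NearCritical.
Context d (T : measurableType d) (R : realType) (P : probability T R) (n : nat).
Variable V : 'I_n -> T -> R3 R.
Hypotheses (mV : forall i, measurable_fun setT (V i)) (iV : indep_family P V).
Hypothesis lawV : forall i A, measurable A -> P (V i @^-1` A) = sigma A.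
Variable k : R.
Hypotheses (k2048 : 2048 <= k) (nk : 2 * k ^+ 2 <= n%:R).

Local Notation Z := ((R * R) * (R * R) * (R * R))%type.
Local Notation K := (k ^+ 2).
Local Notation L := (ln n%:R : R).
(** The excluded cap has measure [K / n]: half of the points avoid it with probability at least
    [expR (- K)], and the sum of squares then has variance of order [n ^+ 2 / K], small compared
    with [n ^+ 2]. *)
Let e : R := 2 * K / n%:R.
Let p : R := 1 - e / 2.
Let rt : R := Num.sqrt n%:R.
Let m := n./2.
Let x0 : Z := ((0, 0), (0, 0), (0, 1)).
Let acc := gather V (add_point e) x0.
Let step := avg_step (add_point e).

Let k0 : 0 < k. Proof. by have := k2048; lra. Qed.
Let K0 : 2048 <= K. Proof. by have := k2048; nra. Qed.
Let nR : 4096 <= n%:R :> R. Proof. by apply: le_trans nk; have := K0; lra. Qed.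
Let n0 : 0 < n%:R :> R. Proof. by have := nR; lra. Qed.
Let n2 : (2 <= n)%N. Proof. by rewrite -(ler_nat R); have := nR; lra. Qed.
Let rt0 : 0 < rt. Proof. by rewrite sqrtr_gt0. Qed.
Let rt2 : rt ^+ 2 = n%:R. Proof. by rewrite sqr_sqrtr// ltW. Qed.
Let rt64 : 64 <= rt.
Proof. by rewrite -(@ler_pXn2r _ 2) ?nnegrE ?(ltW rt0)// rt2; have := nR; lra. Qed.
Let L0 : 1 / 2 <= L. Proof. exact: ln_ge_half. Qed.
Let e01 : 0 < e <= 1.
Proof. by rewrite /e divr_gt0 ?mulr_gt0 ?exprn_gt0//= ler_pdivrMr// mul1r. Qed.
Let p12 : 1 / 2 <= p <= 1.
Proof. by have := e01 => /andP[? ?]; rewrite /p; apply/andP; split; lra. Qed.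
Let e2 : 2 / e = n%:R / K.
Proof. by rewrite /e; field; rewrite !lt0r_neq0// exprn_gt0. Qed.
Let m0 : (0 < m)%N. Proof. by rewrite /m half_gt0. Qed.
Let m2 : 2 * m%:R <= n%:R :> R.
Proof.
rewrite -natrM ler_nat /m mul2n -[leqRHS]odd_double_half; exact: leq_addl.
Qed.

Local Ltac slra := have := k2048; have := K0; have := nR; have := n0; have := rt64; have := L0;
  have := p12 => /andP[? ?]; lra.

Let mst := measurable_add_point e.
Let macc r : measurable_fun setT (acc r).
Proof.
by apply: (measurable_wrtW mV (r := r)); apply: measurable_gather.
Qed.

Lemma gatherE r w : acc r w =
  ((\sum_(i <- r) (stereo (V i w)).1, \sum_(i <- r) (stereo (V i w)).2),
   (\sum_(i <- r) sq1 (V i w), \sum_(i <- r) sq2 (V i w)),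
   (\sum_(i <- r) cube (V i w), \prod_(i <- r) low e (V i w))).
Proof. by elim: r => [|i r IH]; rewrite ?big_nil// !big_cons /= -/(acc r w) IH. Qed.

Let low01 x : low e x = 0 \/ low e x = 1.
Proof. by rewrite /low indicE; case: (_ \in _); [right|left]. Qed.

Let acc_flag01 r w : (acc r w).2.2 = 0 \/ (acc r w).2.2 = 1.
Proof.
rewrite gatherE/=; elim: r => [|i r IH]; first by rewrite big_nil; right.
rewrite big_cons; have [->|->] := low01 (V i w); first by rewrite mul0r; left.
by rewrite mul1r.
Qed.

Lemma flag_low r w : (acc r w).2.2 = 1 -> forall i, i \in r -> (V i w).2 <= 1 - e.
Proof.
rewrite gatherE/= => h i ir; have [//|nl] := pselect ((V i w).2 <= 1 - e).
have h0 : \prod_(i <- r) low e (V i w) = 0.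
  by rewrite (big_rem i)//= /low indicE memNset//= mul0r.
by move: h; rewrite h0 => /eqP; rewrite eq_sym oner_eq0.
Qed.

Let mflag : measurable_fun setT (@flag R).
Proof. by rewrite /flag; meas. Qed.
Let mfs1 : measurable_fun setT (@flag_sum1 R).
Proof. by rewrite /flag_sum1; meas. Qed.
Let mfs2 : measurable_fun setT (@flag_sum2 R).
Proof. by rewrite /flag_sum2; meas. Qed.
Let mfs3 : measurable_fun setT (@flag_sum3 R).
Proof. by rewrite /flag_sum3; meas. Qed.
Let fl0 (z : Z) : 0 <= flag z. Proof. exact: normr_ge0. Qed.
Let fs10 z : 0 <= @flag_sum1 R z. Proof. by rewrite mulr_ge0// addr_ge0 ?sqr_ge0. Qed.
Let fs20 z : 0 <= @flag_sum2 R z. Proof. by rewrite mulr_ge0// addr_ge0 ?sqr_ge0. Qed.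
Let fs30 z : 0 <= @flag_sum3 R z. Proof. by rewrite mulr_ge0. Qed.

Let p0 : 0 <= p. Proof. by slra. Qed.

Let iter_flag j (c : R) z : 0 <= c ->
  iter j step (fun z => (c * flag z)%:E) z = (c * p ^+ j * flag z)%:E.
Proof.
elim: j c z => [|j IH] c z c0; first by rewrite /= expr0 mulr1.
rewrite iterSr (_ : step _ = fun z => (c * p * flag z)%:E).
  by rewrite IH ?mulr_ge0// exprS mulrA.
apply/funext => z'; rewrite /step /avg_step.
under eq_integral do rewrite EFinM.
rewrite ge0_integralZl//; first by rewrite [X in (_ * X)%E](step_flag e01) -EFinM mulrA.
- by apply/measurable_EFinP; apply: (measurableT_comp mflag); apply: (measurableT_comp mst (g := fun v => (v, z')));
    exact: measurable_fun_pair.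
- by move=> v _; rewrite lee_fin fl0.
Qed.

Let eta : R := p ^+ m.
Let eta0 : 0 < eta. Proof. by rewrite exprn_gt0//; slra. Qed.

Lemma integral_flag r : uniq r -> size r = m -> (\int[P]_w (flag (acc r w))%:E = eta%:E)%E.
Proof.
move=> ur sr; rewrite (integral_gather mV iV lawV mst x0 (f := EFin \o @flag R))// ?sr.
  have := iter_flag m x0 ler01; rewrite /step.
  have -> : (fun z : Z => (1 * flag z)%:E) = EFin \o @flag R by apply/funext => z; rewrite /= mul1r.
  by move=> ->; rewrite /flag/= normr1 mulr1 mul1r.
- exact/measurable_EFinP.
Qed.

(** The factor [eta], the probability that the points avoid the cap, makes this a bound on a
    conditional expectation. Replacing [m * p ^+ m.-1] by [n * p ^+ m] uses [m <= n / 2] and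
    [1 / 2 <= p]. *)
Let moment (H : Z -> R) (b : R) r : measurable_fun setT H -> (forall z, 0 <= H z) -> 0 <= b ->
  (forall z, (avg_step (add_point e) (EFin \o H) z <= (p * H z + b * flag z)%:E)%E) -> H x0 = 0 ->
  uniq r -> size r = m -> (\int[P]_w (H (acc r w))%:E <= (n%:R * b * eta)%:E)%E.
Proof.
move=> mH H0 b0 hH Hx0 ur sr.
rewrite (integral_gather mV iV lawV mst x0 (f := EFin \o H))//; last exact/measurable_EFinP.
have hG z : (avg_step (add_point e) (EFin \o @flag R) z <= (p * flag z)%:E)%E by rewrite step_flag.
apply: (le_trans (iter_avg_step_le mst _ _ mflag mH fl0 H0 p0 b0 hG hH)) => //.
rewrite sr Hx0 mulr0 add0r lee_fin {1}/flag/= normr1 mulr1.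
have -> : n%:R * b * eta = b * (n%:R * eta) by ring.
have -> : m%:R * b * p ^+ m.-1 = b * (m%:R * p ^+ m.-1) by ring.
rewrite ler_wpM2l// /eta -[in leRHS](prednK m0) exprS.
have : 0 <= p ^+ m.-1 by rewrite exprn_ge0.
move: m2 p12 n0; move: (p ^+ _) => x h1 /andP[h2 h3] h4 x0'.
have : n%:R / 2 * x <= n%:R * (p * x) by rewrite -mulrA ler_wpM2l ?(ltW h4)// ler_wpM2r//; slra.
apply: le_trans; rewrite ler_wpM2r//; slra.
Qed.

Let b : R := 2 * rt * Num.sqrt L.
Let b2 : b ^+ 2 = 4 * n%:R * L.
Proof. by rewrite /b !exprMn rt2 sqr_sqrtr; [ring|slra]. Qed.

(** Thresholds for Markov's inequality: relative to [eta], the three bounds fail with weight at most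
    [1 / 4], [256 / K] and [256 / k], and [2048 <= k] makes the last two at most [1 / 8]. *)
Definition good_state (z : Z) := [/\ z.2.2 = 1, z.1.1.1 ^+ 2 + z.1.1.2 ^+ 2 <= b ^+ 2,
  z.1.2.1 ^+ 2 + z.1.2.2 ^+ 2 <= (n%:R / 16) ^+ 2 & `|z.2.1| <= n%:R * rt / 128].

Lemma measurable_good_state : measurable [set z | good_state z].
Proof.
rewrite (_ : [set z | _] = ([set z : Z | z.2.2 = 1] `&` [set z : Z | z.1.1.1 ^+ 2 + z.1.1.2 ^+ 2 <= b ^+ 2]) `&`
  ([set z : Z | z.1.2.1 ^+ 2 + z.1.2.2 ^+ 2 <= (n%:R / 16) ^+ 2] `&` [set z : Z | `|z.2.1| <= n%:R * rt / 128])).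
  apply: measurableI; apply: measurableI; try by apply: measurable_le; meas.
  have mf : measurable_fun setT (fun z : Z => z.2.2) by meas.
  by have := mf measurableT _ (measurable_set1 1); rewrite setTI.
apply/seteqP; split => z /=; first by move=> [].
by move=> [[? ?] [? ?]].
Qed.

Lemma probability_good_state r : uniq r -> size r = m ->
  ((eta / 2)%:E <= P (acc r @^-1` [set z | good_state z]))%E.
Proof.
move=> ur sr; set E := _ @^-1` _.
have mE : measurable E by rewrite -[X in measurable X]setTI; exact: (macc r) measurableT _ measurable_good_state.
have b0 : 0 < b ^+ 2 by rewrite b2 !mulr_gt0//; slra.
have c20 : 0 < (n%:R / 16) ^+ 2 :> R by rewrite exprn_gt0// divr_gt0.
have c30 : 0 < n%:R * rt / 128 by rewrite divr_gt0// mulr_gt0.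
have h : ((eta)%:E <= P E + (eta / 2)%:E)%E.
  rewrite -(integral_flag ur sr).
  (* Union bound in integrated form: when the flag is 1, either the state is good or one of the
     three normalized terms is at least 1. *)
  apply: (@le_trans _ _ (\int[P]_w ((\1_E w)%:E + ((b ^+ 2)^-1 * flag_sum1 (acc r w))%:E +
    (((n%:R / 16) ^+ 2)^-1 * flag_sum2 (acc r w))%:E + ((n%:R * rt / 128)^-1 * flag_sum3 (acc r w))%:E))%E).
    apply: ge0_le_integral => //.
    - by move=> w _; rewrite lee_fin fl0.
    - by apply/measurable_EFinP; exact: (measurableT_comp mflag (macc r)).
    - apply/measurable_EFinP; apply: measurable_funD; [apply: measurable_funD; [apply: measurable_funD|]|].
      + exact: measurable_indic.
      + by apply: measurable_funM => //; exact: (measurableT_comp mfs1 (macc r)).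
      + by apply: measurable_funM => //; exact: (measurableT_comp mfs2 (macc r)).
      + by apply: measurable_funM => //; exact: (measurableT_comp mfs3 (macc r)).
    move=> w _; rewrite -!EFinD lee_fin.
    have i0 : 0 <= (\1_E w : R) by rewrite indicE.
    have t1 : 0 <= (b ^+ 2)^-1 * flag_sum1 (acc r w) by rewrite mulr_ge0// invr_ge0 ltW.
    have t2 : 0 <= ((n%:R / 16) ^+ 2)^-1 * flag_sum2 (acc r w) by rewrite mulr_ge0// invr_ge0 ltW.
    have t3 : 0 <= (n%:R * rt / 128)^-1 * flag_sum3 (acc r w) by rewrite mulr_ge0// invr_ge0 ltW.
    have [f0|f1] := acc_flag01 r w; first by rewrite {1}/flag f0 normr0 !addr_ge0.
    rewrite {1}/flag f1 normr1.
    have [g1|g1] := leP ((acc r w).1.1.1 ^+ 2 + (acc r w).1.1.2 ^+ 2) (b ^+ 2); last first.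
      suff : 1 <= (b ^+ 2)^-1 * flag_sum1 (acc r w) by slra.
      by rewrite mulrC ler_pdivlMr// mul1r /flag_sum1 f1 normr1 mul1r ltW.
    have [g2|g2] := leP ((acc r w).1.2.1 ^+ 2 + (acc r w).1.2.2 ^+ 2) ((n%:R / 16) ^+ 2); last first.
      suff : 1 <= ((n%:R / 16) ^+ 2)^-1 * flag_sum2 (acc r w) by slra.
      by rewrite mulrC ler_pdivlMr// mul1r /flag_sum2 f1 normr1 mul1r ltW.
    have [g3|g3] := leP (`|(acc r w).2.1|) (n%:R * rt / 128); last first.
      suff : 1 <= (n%:R * rt / 128)^-1 * flag_sum3 (acc r w) by slra.
      by rewrite mulrC ler_pdivlMr// mul1r /flag_sum3 f1 normr1 mul1r ltW.
    have wE : E w by split.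
    have -> : \1_E w = 1 :> R by rewrite indicE mem_set.
    slra.
  have mi : measurable_fun setT (fun w => (\1_E w)%:E : \bar R) by apply/measurable_EFinP; exact: measurable_indic.
  have ms (c : R) (H : Z -> R) : measurable_fun setT H -> measurable_fun setT (fun w => (c * H (acc r w))%:E).
    by move=> mH; apply/measurable_EFinP; apply: measurable_funM => //; exact: (measurableT_comp mH (macc r)).
  have scale_le (c : R) (H : Z -> R) (B : R) : 0 <= c -> measurable_fun setT H -> (forall z, 0 <= H z) ->
      (\int[P]_w (H (acc r w))%:E <= B%:E)%E -> (\int[P]_w (c * H (acc r w))%:E <= (c * B)%:E)%E.
    move=> c0 mH H0 hB; under eq_integral do rewrite EFinM.
    have mHa : measurable_fun setT (fun w => (H (acc r w))%:E).
      by apply/measurable_EFinP; exact: (measurableT_comp mH (macc r)).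
    rewrite EFinM ge0_integralZl//; try (by move=> w _; rewrite lee_fin).
    by rewrite lee_wpmul2l// lee_fin.
  have i0 w : (0 <= (\1_E w)%:E :> \bar R)%E by rewrite lee_fin.
  have s0 (c : R) (H : Z -> R) w : 0 <= c -> (forall z, 0 <= H z) -> (0 <= (c * H (acc r w))%:E)%E.
    by move=> c0 H0; rewrite lee_fin mulr_ge0.
  have cb0 : 0 <= (b ^+ 2)^-1 by rewrite invr_ge0 ltW.
  have cc0 : 0 <= ((n%:R / 16) ^+ 2)^-1 :> R by rewrite invr_ge0 ltW.
  have cd0 : 0 <= (n%:R * rt / 128)^-1 by rewrite invr_ge0 ltW.
  have m1' := ms (b ^+ 2)^-1 _ mfs1; have m2' := ms ((n%:R / 16) ^+ 2)^-1 _ mfs2.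
  have m3' := ms (n%:R * rt / 128)^-1 _ mfs3.
  have z1 w := s0 _ _ w cb0 fs10; have z2 w := s0 _ _ w cc0 fs20; have z3 w := s0 _ _ w cd0 fs30.
  rewrite ge0_integralD//; try (by move=> w _; rewrite !adde_ge0); try (by apply: emeasurable_funD => //; apply: emeasurable_funD).
  rewrite ge0_integralD//; try (by move=> w _; rewrite !adde_ge0); try (by apply: emeasurable_funD).
  rewrite ge0_integralD// integral_indic// setIT -(addeA (P E)) -(addeA (P E)); apply: leeD2l.
  have H1 : (\int[P]_w (flag_sum1 (acc r w))%:E <= (n%:R * L * eta)%:E)%E.
    apply: moment => //; first by slra.
    - move=> z; apply: (le_trans (step_flag_sum1 e01 z)); rewrite lee_fin lerD2l ler_wpM2r//.
      rewrite e2 ler_ln ?posrE ?divr_gt0 ?exprn_gt0// ler_pdivrMr ?exprn_gt0//.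
      by rewrite ler_peMr ?(ltW n0)//; slra.
    - by rewrite /flag_sum1/= expr0n addr0 mulr0.
  have H2 : (\int[P]_w (flag_sum2 (acc r w))%:E <= (n%:R * (n%:R / K) * eta)%:E)%E.
    apply: moment => //; first by rewrite divr_ge0 ?sqr_ge0.
    - by move=> z; rewrite -e2; exact: step_flag_sum2.
    - by rewrite /flag_sum2/= expr0n addr0 mulr0.
  have H3 : (\int[P]_w (flag_sum3 (acc r w))%:E <= (n%:R * (2 * (rt / k)) * eta)%:E)%E.
    apply: moment => //; first by rewrite mulr_ge0// divr_ge0// ltW.
    - move=> z; have := step_flag_sum3 e01 z; rewrite e2 sqrtrM ?(ltW n0)// sqrtrV ?sqr_ge0// sqrtr_sqr gtr0_norm//.
    - by rewrite /flag_sum3/= normr0 mulr0.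
  have J1 := scale_le _ _ _ cb0 mfs1 fs10 H1; have J2 := scale_le _ _ _ cc0 mfs2 fs20 H2.
  have J3 := scale_le _ _ _ cd0 mfs3 fs30 H3.
  apply: (le_trans (leeD (leeD J1 J2) J3)); rewrite -!EFinD lee_fin b2.
  have -> : (4 * n%:R * L)^-1 * (n%:R * L * eta) = eta / 4 by field; rewrite !lt0r_neq0//; slra.
  have -> : ((n%:R / 16) ^+ 2)^-1 * (n%:R * (n%:R / K) * eta) = eta * (256 / K).
    by field; rewrite !lt0r_neq0// exprn_gt0.
  have -> : (n%:R * rt / 128)^-1 * (n%:R * (2 * (rt / k)) * eta) = eta * (256 / k).
    by field; rewrite !lt0r_neq0.
  have h1 : 256 / K <= 1 / 8 by rewrite ler_pdivrMr ?exprn_gt0//; slra.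
  have h2 : 256 / k <= 1 / 8 by rewrite ler_pdivrMr//; slra.
  have := ler_wpM2l (ltW eta0) h1; have := ler_wpM2l (ltW eta0) h2; slra.
have fE : P E \is a fin_num by exact: fin_num_measure.
by move: h; rewrite -(fineK fE) -EFinD !lee_fin; slra.
Qed.

Let eta_ge : expR (- K) <= eta.
Proof.
have x1 : e / 2 <= 1 - expR (- e) by apply: expRN_half; have /andP[? ?] := e01; apply/andP; split; slra.
apply: (@le_trans _ _ (expR (- e) ^+ m)); last first.
  by rewrite lerXn2r ?nnegrE ?expR_ge0 ?p0// /p; lra.
rewrite -expRM_natl ler_expR mulrN lerN2.
have -> : K = e * (n%:R / 2) by rewrite /e; field; rewrite lt0r_neq0.
rewrite mulrC ler_wpM2l//; first by have /andP[/ltW] := e01.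
by have := m2; lra.
Qed.

(* Cells of side [sqrt n / 8] cover the box of half-width [b]. *)
Let cl : R := rt / 8.
(** The width [2 * b] of the box equals [32 * Num.sqrt L] cell sides. *)
Let M := (Num.trunc (32 * Num.sqrt L)).+1.
Let cl0 : 0 < cl. Proof. by rewrite divr_gt0. Qed.

Definition cell (c : 'I_M * 'I_M) : set Z :=
  [set z | (c.1%:R <= (z.1.1.1 + b) / cl < c.1%:R + 1 /\ c.2%:R <= (z.1.1.2 + b) / cl < c.2%:R + 1)%R].

Let measurable_cell c : measurable (cell c).
Proof.
have f1 : measurable_fun setT (fun z : Z => (z.1.1.1 + b) / cl) by meas.
have f2 : measurable_fun setT (fun z : Z => (z.1.1.2 + b) / cl) by meas.
rewrite (_ : cell c = ((fun z : Z => (z.1.1.1 + b) / cl) @^-1` `[c.1%:R, c.1%:R + 1[) `&`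
  ((fun z : Z => (z.1.1.2 + b) / cl) @^-1` `[c.2%:R, c.2%:R + 1[)).
  apply: measurableI.
    by have := f1 measurableT _ (measurable_itv `[c.1%:R, c.1%:R + 1[); rewrite setTI.
  by have := f2 measurableT _ (measurable_itv `[c.2%:R, c.2%:R + 1[); rewrite setTI.
by apply/seteqP; split => z; rewrite /cell/= !in_itv/=.
Qed.

Let M_le : (M * M)%:R <= 1156 * L.
Proof.
have sL : 0 <= Num.sqrt L by exact: sqrtr_ge0.
have sL2 : Num.sqrt L ^+ 2 = L by rewrite sqr_sqrtr//; slra.
have h1 : 1 <= 2 * Num.sqrt L.
  rewrite -(@ler_pXn2r _ 2) ?nnegrE ?mulr_ge0// expr1n exprMn sL2; slra.
have hM : M%:R <= 34 * Num.sqrt L.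
  rewrite /M -natr1; have : 0 <= 32 * Num.sqrt L by rewrite mulr_ge0.
  by move=> /truncn_itv/andP[+ _]; lra.
rewrite natrM -expr2; apply: (@le_trans _ _ ((34 * Num.sqrt L) ^+ 2)).
  by rewrite lerXn2r ?nnegrE// mulr_ge0.
by rewrite exprMn sL2; slra.
Qed.

Let in_cell z : good_state z -> exists c, cell c z.
Proof.
move=> [_ hb _ _].
have b0 : 0 < b by rewrite /b !mulr_gt0// sqrtr_gt0; slra.
have aux (x : R) : x ^+ 2 <= b ^+ 2 -> exists i : 'I_M, i%:R <= (x + b) / cl < i%:R + 1.
  move=> xb; have : `|x| <= b by rewrite -(@ler_pXn2r _ 2) ?nnegrE ?(ltW b0)// real_normK ?num_real.
  rewrite ler_norml => /andP[x1 x2].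
  have y0 : 0 <= (x + b) / cl by rewrite divr_ge0 ?(ltW cl0)//; lra.
  have y1 : (x + b) / cl <= 32 * Num.sqrt L.
    rewrite ler_pdivrMr// (_ : 32 * Num.sqrt L * cl = 2 * b); last by rewrite /cl /b; field.
    lra.
  have iM : (Num.trunc ((x + b) / cl) < M)%N by rewrite /M ltnS le_truncn.
  by exists (Ordinal iM) => /=; rewrite natr1; exact: truncn_itv.
have [h1 h2] := (sqr_ge0 z.1.1.1, sqr_ge0 z.1.1.2).
have [|i hi] := aux z.1.1.1; first by lra.
have [|j hj] := aux z.1.1.2; first by lra.
by exists (i, j).
Qed.

Let cell_inj c c' z : cell c z -> cell c' z -> c = c'.
Proof.
move=> [/andP[a1 a2] /andP[a3 a4]] [/andP[a5 a6] /andP[a7 a8]].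
have aux (i j : 'I_M) (x : R) : i%:R <= x -> x < i%:R + 1 -> j%:R <= x -> x < j%:R + 1 -> i = j.
  move=> h1 h2 h3 h4; apply/val_inj/eqP; rewrite eqn_leq; apply/andP.
  by split; rewrite -ltnS -(ltr_nat R) -[X in _ < X]natr1; lra.
by case: c c' a1 a2 a3 a4 a5 a6 a7 a8 => [i j] [i' j'] /= *; congr pair; apply: aux; eassumption.
Qed.

Let cell_close c z z' : cell c z -> cell c z' ->
  `|z.1.1.1 - z'.1.1.1| <= cl /\ `|z.1.1.2 - z'.1.1.2| <= cl.
Proof.
have aux (i x y : R) : i <= (x + b) / cl < i + 1 -> i <= (y + b) / cl < i + 1 -> `|x - y| <= cl.
  move=> /andP[h1 h2] /andP[h3 h4].
  move: h1 h3 h2 h4; do 2 (rewrite ler_pdivlMr//; move=> ?).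
  do 2 (rewrite ltr_pdivrMr//; move=> ?); rewrite ler_norml; apply/andP; split; lra.
by move=> [h1 h2] [h1' h2']; split; [exact: aux h1 h1'|exact: aux h2 h2'].
Qed.

(** Effect of the half turn on a state: the sum of W changes sign, the sums of W^2 and |W|^3 and the
    flag do not. *)
Definition mirror (z : Z) : Z := ((- z.1.1.1, - z.1.1.2), z.1.2, z.2).

Let mmirror : measurable_fun setT mirror.
Proof. by rewrite /mirror; do 2 (apply: measurable_fun_pair => //=); try (apply: measurable_fun_pair => //=); meas. Qed.

Let mirror_add x z : add_point e (rotZ pi x) (mirror z) = mirror (add_point e x z).
Proof.
have hl : low e (rotZ pi x) = low e x.
  by rewrite /low !indicE; congr (nat_of_bool _)%:R; apply/idP/idP; rewrite !inE.
rewrite /add_point hl /mirror /sq1 /sq2 /cube /stereo_sq /stereo /rotZ/= cospi sinpi.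
have s1 : - 1 * x.1.1 - 0 * x.1.2 = - x.1.1 by ring.
have s2 : 0 * x.1.1 + - 1 * x.1.2 = - x.1.2 by ring.
by rewrite s1 s2 !mulNr !sqrrN !mulrN mulNr opprK !opprD.
Qed.

Let low_state (c : 'I_M * 'I_M) : set Z := [set z | good_state z] `&` cell c.

Let measurable_low_state c : measurable (low_state c).
Proof. by apply: measurableI; [exact: measurable_good_state|exact: measurable_cell]. Qed.

Let prob_state r A : uniq r -> size r = m -> measurable A ->
  P (acc r @^-1` A) = iter m step (fun z => (\1_A z)%:E) x0.
Proof.
move=> ur sr mA; rewrite -sr -(integral_gather mV iV lawV mst x0)//; last exact/measurable_EFinP.
have mP : measurable (acc r @^-1` A) by rewrite -[X in measurable X]setTI; exact: (macc r) measurableT _ mA.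
by rewrite -[X in P X]setIT -integral_indic.
Qed.

Let prob_mirror r r' A : uniq r -> size r = m -> uniq r' -> size r' = m -> measurable A ->
  P (acc r' @^-1` (mirror @^-1` A)) = P (acc r @^-1` A).
Proof.
move=> ur sr ur' sr' mA.
have mmA : measurable (mirror @^-1` A) by rewrite -[X in measurable X]setTI; exact: mmirror.
rewrite !prob_state//.
have := iter_avg_step_sym mst (g := rotZ pi) (nu := mirror) (f := fun z => (\1_A z)%:E) m x0.
have -> : mirror x0 = x0 by rewrite /mirror /x0/= !oppr0.
apply.
- by move=> h mh h0; apply: integral_sigma_rotZ => //; rewrite ger0_norm ?pi_ge0//; have := pi_ge0 R; lra.
- exact: mirror_add.
- exact/measurable_EFinP.
- by move=> z; rewrite lee_fin.
Qed.

(** On the unit sphere, the condition [peaked] at the north pole in terms of stereographic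
    images. *)
Definition near_critical (X : 'I_n -> R3 R) :=
  [/\ (\sum_i (stereo (X i)).1) ^+ 2 + (\sum_i (stereo (X i)).2) ^+ 2 <= n%:R / 16,
      (\sum_i sq1 (X i)) ^+ 2 + (\sum_i sq2 (X i)) ^+ 2 <= (n%:R / 6) ^+ 2,
      \sum_i cube (X i) <= n%:R * Num.sqrt n%:R / 60 &
      forall i, (X i).2 <= 1 - 32 / n%:R].

(** Region for the point left over when [n] is odd: a hemisphere, together with the bound on the
    modulus that it entails on the sphere, stated so as to be available for arbitrary vectors. *)
Let B : set (R3 R) := [set x | x.2 <= 1 - 1] `&` [set x | stereo_sq x <= 1].

Let mB : measurable B.
Proof.
apply: measurableI; apply: measurable_le; first by meas.
by apply: measurable_stereo_sq; meas.
Qed.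

Let sigma_B : (2^-1%:E <= sigma B)%E.
Proof.
have h12 : 0 <= (1 : R) <= 2 by apply/andP; split; lra.
have -> : 2^-1 = 1 - 1 / 2 :> R by field.
rewrite -(sigma_low h12) -[X in (sigma X <= _)%E]setIT -integral_indic; last 2 first.
- exact: measurableT.
- by apply: measurable_le; meas.
rewrite -[X in (_ <= sigma X)%E]setIT -integral_indic//.
apply: le_integral_sigma.
- by apply/measurable_EFinP; apply: measurable_indic; apply: measurable_le; meas.
- exact/measurable_EFinP.
- by move=> y; rewrite lee_fin.
- by move=> y; rewrite lee_fin.
move=> y y1; rewrite lee_fin; have [yB|yB] := pselect (y.2 <= 1 - 1); last first.
  by rewrite indicE memNset.
rewrite !indicE !mem_set//=; split => //=.
have h0 : 0 <= 1 + y.2.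
  have p1 : dot (0, 0, - 1) (0, 0, - 1) = 1 :> R by rewrite /dot/= !mul0r !add0r mulrNN mulr1.
  by have := dot_le1 y1 p1; rewrite /dot/=; lra.
by rewrite stereo_sqE//; [rewrite ler_pdivrMr; lra|lra].
Qed.

(** For the empty list, that is for even [n], this is the sure event. *)
Let F (r : seq 'I_n) : set T := [set w | forall i, i \in r -> B (V i w)].

Let F_ge r : (size r <= 1)%N -> <<s cylinders V r >> (F r) /\ (2^-1%:E <= P (F r))%E.
Proof.
case: r => [|i [|//]] _.
  have -> : F [::] = setT by apply/seteqP; split.
  split; first by apply: sub_sigma_algebra; exact: cylindersT.
  by rewrite probability_setT lee_fin invf_le1// ler1n.
have -> : F [:: i] = V i @^-1` B.
  apply/seteqP; split => w /= h; first by apply: h; rewrite inE.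
  by move=> j; rewrite inE => /eqP->.
split; last by rewrite (lawV _ mB); exact: sigma_B.
by apply: measurable_wrt_preimage => //; apply: measurable_wrt_coord; rewrite inE.
Qed.

Let cylindersS (r r' : seq 'I_n) : {subset r <= r'} -> <<s cylinders V r >> `<=` <<s cylinders V r' >>.
Proof.
move=> rr'; apply: sub_sigma_algebra2 => _ [A [mA Ar ->]]; exists A; split => // i ir'.
by apply: Ar; apply: contra ir' => /rr'.
Qed.

Let acc_sigma r A : measurable A -> <<s cylinders V r >> (acc r @^-1` A).
Proof. by move=> mA; apply: measurable_wrt_preimage => //; exact: measurable_gather. Qed.

Let r1 := take m (enum 'I_n).
Let r2 := take m (drop m (enum 'I_n)).
Let r3 := drop m (drop m (enum 'I_n)).

Let enumE : enum 'I_n = r1 ++ (r2 ++ r3).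
Proof. by rewrite /r1 /r2 /r3 !cat_take_drop. Qed.

Let mm : (m + m <= n)%N. Proof. by rewrite addnn -[leqRHS]odd_double_half leq_addl. Qed.

Let size1 : size r1 = m.
Proof. by rewrite size_takel// size_enum_ord (leq_trans _ mm)// leq_addr. Qed.
Let size2 : size r2 = m.
Proof. by rewrite size_takel// size_drop size_enum_ord leq_subRL ?(leq_trans _ mm)// leq_addr. Qed.
Let size3 : (size r3 <= 1)%N.
Proof.
rewrite !size_drop size_enum_ord -subnDA addnn -[X in (X - _)%N]odd_double_half addnK.
by case: odd.
Qed.

Let uniq123 : uniq (r1 ++ (r2 ++ r3)). Proof. by rewrite -enumE enum_uniq. Qed.
Let uniq1 : uniq r1. Proof. by have := uniq123; rewrite cat_uniq => /andP[]. Qed.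
Let uniq2 : uniq r2.
Proof. by have := uniq123; rewrite !cat_uniq => /and3P[_ _ /andP[]]. Qed.
Let disj12 i : i \in r1 -> i \notin r2.
Proof.
have := uniq123; rewrite cat_uniq => /and3P[_ /hasPn h _] i1; apply/negP => i2.
by have := h i; rewrite mem_cat i2/= i1 => /(_ isT).
Qed.
Let disj12_3 i : i \in r1 ++ r2 -> i \notin r3.
Proof.
have := uniq123; rewrite catA cat_uniq => /and3P[_ /hasPn h _] i1; apply/negP => i2.
by have := h i i2; rewrite /= i1.
Qed.

Let sum_split (f : 'I_n -> R) :
  \sum_i f i = \sum_(i <- r1) f i + (\sum_(i <- r2) f i + \sum_(i <- r3) f i).
Proof. by rewrite -!big_cat -enumE big_enum. Qed.

Let leftover w : F r3 w ->
  [/\ `|\sum_(i <- r3) (stereo (V i w)).1| <= 1 /\ `|\sum_(i <- r3) (stereo (V i w)).2| <= 1,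
    (\sum_(i <- r3) sq1 (V i w)) ^+ 2 + (\sum_(i <- r3) sq2 (V i w)) ^+ 2 <= 1,
    `|\sum_(i <- r3) cube (V i w)| <= 1 & forall i, i \in r3 -> (V i w).2 <= 0].
Proof.
rewrite /F; case: r3 size3 => [|i [|//]] _ h.
  by rewrite !big_nil normr0 expr0n addr0 ler01.
have [/= xl q1] := h i (mem_head _ _); rewrite !big_seq1.
have q0 : 0 <= stereo_sq (V i w) by rewrite addr_ge0 ?sqr_ge0.
have le1 (x y : R) : x ^+ 2 + y ^+ 2 <= 1 -> `|x| <= 1.
  move=> xy; rewrite -(@ler_pXn2r _ 2) ?nnegrE// real_normK ?num_real// expr1n.
  by have := sqr_ge0 y; lra.
split.
- by split; [exact: le1 q1|apply: (le1 _ (stereo (V i w)).1); rewrite addrC].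
- have -> : sq1 (V i w) ^+ 2 + sq2 (V i w) ^+ 2 = stereo_sq (V i w) ^+ 2.
    by rewrite /sq1 /sq2 /stereo_sq; ring.
  by rewrite expr_le1.
- rewrite /cube ger0_norm ?mulr_ge0 ?sqrtr_ge0// mulr_ile1 ?sqrtr_ge0//.
  by rewrite -[leRHS]sqrtr1 ler_wsqrtr.
- by move=> j; rewrite inE => /eqP->; move: xl; lra.
Qed.

(** When one half and the mirror image of the other share a cell, the total is at most one cell side
    [sqrt n / 8] in each coordinate. The leftover point adds at most 1, which [64 <= sqrt n] absorbs
    into the thresholds. *)
Let near_critical_cell c w : acc r1 w \in low_state c -> mirror (acc r2 w) \in low_state c ->
  F r3 w -> near_critical (V ^~ w).
Proof.
rewrite !inE => -[g1 c1] [g2 c2] /leftover[[l1 l2] l3 l4 l5].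
have [d1 d2] := cell_close c1 c2.
have low1 := flag_low (let: And4 h _ _ _ := g1 in h).
have low2 : forall i, i \in r2 -> (V i w).2 <= 1 - e.
  by apply: flag_low; case: g2.
move: d1 d2 g1 g2; rewrite /good_state /mirror /= !gatherE/= !opprK.
rewrite /near_critical !sum_split -/rt.
set a1 := \sum_(i <- r1) _; set a2 := \sum_(i <- r2) _; set b1 := \sum_(i <- r1) _.
set b2' := \sum_(i <- r2) _.
move: l1 l2 l3 l4.
set a3 := \sum_(i <- r3) _; set b3 := \sum_(i <- r3) _.
set s1 := \sum_(i <- r3) sq1 _; set s2 := \sum_(i <- r3) sq2 _; set t3 := \sum_(i <- r3) cube _.
set p1 := \sum_(i <- r1) sq1 _; set p2 := \sum_(i <- r2) sq1 _.
set p3 := \sum_(i <- r1) sq2 _; set p4 := \sum_(i <- r2) sq2 _.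
clearbody a1 a2 a3 b1 b2' b3 s1 s2 t3 p1 p2 p3 p4.
move=> l1 l2 l3 l4 d1 d2 [_ _ gc1 gt1] [_ _ gc2 gt2].
have rtn : n%:R = rt ^+ 2 by rewrite rt2.
split.
- have h (x y z : R) : `|x + y| <= cl -> `|z| <= 1 -> (x + (y + z)) ^+ 2 <= (rt / 8 + 1) ^+ 2.
    rewrite /cl => xy z1; rewrite -[leLHS]real_normK ?num_real// lerXn2r ?nnegrE//.
      by have := rt64; lra.
    by rewrite addrA; apply: (le_trans (ler_normD _ _)); exact: lerD.
  apply: (le_trans (lerD (h _ _ _ d1 l1) (h _ _ _ d2 l2))).
  by rewrite rtn; have := rt64; nra.
- have h (x y z : R) : (x + (y + z)) ^+ 2 <= 3 * (x ^+ 2 + y ^+ 2 + z ^+ 2).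
    rewrite -subr_ge0 (_ : _ - _ = (x - y) ^+ 2 + (x - z) ^+ 2 + (y - z) ^+ 2); last by ring.
    by rewrite !addr_ge0 ?sqr_ge0.
  apply: (le_trans (lerD (h _ _ _) (h _ _ _))).
  have nn : 4096 * n%:R <= n%:R ^+ 2 :> R by rewrite expr2; apply: ler_wpM2r; [exact: (ltW n0)|exact: nR].
  have -> : (n%:R / 6) ^+ 2 = n%:R ^+ 2 / 36 :> R by field.
  move: gc1 gc2; have -> : (n%:R / 16) ^+ 2 = n%:R ^+ 2 / 256 :> R by field.
  have := nR; move: nn l3; move: (n%:R ^+ 2) => N; move=> *; lra.
- move: gt1 gt2 l4; rewrite !ler_norml => /andP[_ h1] /andP[_ h2] /andP[_ h3].
  have : 4096 <= n%:R * rt.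
    by apply: (le_trans nR); rewrite ler_peMr ?(ltW n0)//; have := rt64; lra.
  lra.
- move=> i; have : i \in enum 'I_n by rewrite mem_enum.
  have h32 : 32 / n%:R <= e.
    by apply: ler_wpM2r; [rewrite invr_ge0; exact: (ltW n0)|have := K0; lra].
  rewrite enumE !mem_cat => /or3P[/low1|/low2|/l5]; rewrite ?/=; try lra.
  by have /andP[_ e1] := e01; move=> ?; apply: (@le_trans _ _ 0) => //; lra.
Qed.

Lemma measurable_near_critical : measurable [set w | near_critical (V ^~ w)].
Proof.
set E := [set w | _].
have m1' : measurable_fun setT (fun w => \sum_i (stereo (V i w)).1).
  by apply: measurable_sum => i; have mVi := mV i; rewrite /stereo/=; meas.
have m2' : measurable_fun setT (fun w => \sum_i (stereo (V i w)).2).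
  by apply: measurable_sum => i; have mVi := mV i; rewrite /stereo/=; meas.
have m3' : measurable_fun setT (fun w => \sum_i sq1 (V i w)).
  by apply: measurable_sum => i; apply: (measurableT_comp (@measurable_sq1 R) (mV i)).
have m4' : measurable_fun setT (fun w => \sum_i sq2 (V i w)).
  by apply: measurable_sum => i; apply: (measurableT_comp (@measurable_sq2 R) (mV i)).
have m5' : measurable_fun setT (fun w => \sum_i cube (V i w)).
  by apply: measurable_sum => i; apply: (measurableT_comp (@measurable_cube R) (mV i)).
rewrite (_ : E = ([set w | (\sum_i (stereo (V i w)).1) ^+ 2 + (\sum_i (stereo (V i w)).2) ^+ 2 <= n%:R / 16] `&`
   [set w | (\sum_i sq1 (V i w)) ^+ 2 + (\sum_i sq2 (V i w)) ^+ 2 <= (n%:R / 6) ^+ 2]) `&`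
   ([set w | \sum_i cube (V i w) <= n%:R * Num.sqrt n%:R / 60] `&`
    \bigcap_(i in [set: 'I_n]) [set w | (V i w).2 <= 1 - 32 / n%:R])).
  apply: measurableI; apply: measurableI; try by apply: measurable_le; meas.
  apply: fin_bigcap_measurable => // i _; apply: measurable_le.
  by have mVi := mV i; meas.
apply/seteqP; split => w /=; first by move=> [? ? ? h]; split; split => // i _; exact: h.
by move=> [[? ?] [? h]]; split => // i; exact: h.
Qed.

(** The collisions in different cells are disjoint events. If one half falls in the cells with
    probabilities [q c], both fall in opposite cells with probability the sum of the [q c ^+ 2], and
    Cauchy-Schwarz bounds it below by the square of the sum over the number of cells. That number is
    at most [1156 * L]; the remaining factor 2 of 2312 pays for the leftover point. *)
Lemma probability_near_critical :
  (((expR (- K) / 2) ^+ 2 / (2312 * L))%:E <= P [set w | near_critical (V ^~ w)])%E.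
Proof.
set E := [set w | _].
have mls c : measurable (mirror @^-1` low_state c).
  by rewrite -[X in measurable X]setTI; exact: mmirror measurableT _ (measurable_low_state c).
pose D c := acc r1 @^-1` low_state c; pose D' c := acc r2 @^-1` (mirror @^-1` low_state c).
have [sF F12] := F_ge size3.
have mD c : measurable (D c) by apply: (sigma_cylinders_measurable mV (r := r1)); exact: (acc_sigma (r := r1) (measurable_low_state c)).
have mD' c : measurable (D' c) by apply: (sigma_cylinders_measurable mV (r := r2)); exact: (acc_sigma (r := r2) (mls c)).
have mF : measurable (F r3) by exact: (sigma_cylinders_measurable mV sF).
have PD c : P (D c `&` D' c `&` F r3) = (P (D c) * P (D c) * P (F r3))%E.
  have sD12 : <<s cylinders V (r1 ++ r2) >> (D c `&` D' c).
    apply: (@measurableI _ (g_sigma_algebraType (cylinders V (r1 ++ r2)))).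
      by apply: (cylindersS (r := r1)); [move=> i ir; rewrite mem_cat ir|exact: (acc_sigma (r := r1) (measurable_low_state c))].
    by apply: (cylindersS (r := r2)); [move=> i ir; rewrite mem_cat ir orbT|exact: (acc_sigma (r := r2) (mls c))].
  rewrite (sigma_cylinders_indep mV iV disj12_3 sD12 sF).
  rewrite (sigma_cylinders_indep mV iV disj12 (acc_sigma (r := r1) (measurable_low_state c)) (acc_sigma (r := r2) (mls c))).
  by rewrite (prob_mirror uniq1 size1 uniq2 size2 (measurable_low_state c)).
have mE0 : measurable E by exact: measurable_near_critical.
pose q c : R := fine (P (D c)).
have qE c : P (D c) = (q c)%:E by rewrite fineK// fin_num_measure.
have q0 c : 0 <= q c by rewrite fine_ge0.
pose pF : R := fine (P (F r3)).
have pFE : P (F r3) = pF%:E by rewrite fineK// fin_num_measure.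
have pF2 : 2^-1 <= pF by move: F12; rewrite pFE lee_fin.
have sumE : ((\sum_c q c * q c * pF)%:E <= P E)%E.
  rewrite -[X in (_ <= P X)%E]setIT -integral_indic// -sumEFin.
  rewrite (eq_bigr (fun c => \int[P]_w (\1_(D c `&` D' c `&` F r3) w)%:E)%E); last first.
    move=> c _; rewrite integral_indic ?setIT; last 2 first.
    - exact: measurableT.
    - by apply: measurableI => //; exact: measurableI.
    by rewrite [RHS]PD qE pFE -!EFinM.
  rewrite -ge0_integral_sum//; last first.
    by move=> c; apply/measurable_EFinP; apply: measurable_indic; apply: measurableI => //; exact: measurableI.
  apply: ge0_le_integral => //.
  - by move=> w _; apply: sume_ge0 => c _; rewrite lee_fin.
  - apply: emeasurable_sum => c; apply/measurable_EFinP; apply: measurable_indic.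
    by apply: measurableI => //; exact: measurableI.
  - by apply/measurable_EFinP; exact: measurable_indic.
  move=> w _; have [[c [[c1 c2] c3]]|nc] := pselect (exists c, (D c `&` D' c `&` F r3) w); last first.
    rewrite big1 ?lee_fin// => c _; rewrite indicE memNset// => wc.
    by apply: nc; exists c.
  rewrite (bigD1 c)//= big1 ?adde0 => [|c' cc'].
    rewrite lee_fin !indicE !mem_set//; apply: (near_critical_cell (c := c)) => //; exact/mem_set.
  rewrite indicE memNset//= => -[[d1 _] _]; move: cc'; rewrite (cell_inj (proj2 d1) (proj2 c1)).
  by rewrite eqxx.
have sumq : eta / 2 <= \sum_c q c.
  rewrite -lee_fin; apply: (le_trans (probability_good_state uniq1 size1)).
  have mG : measurable (acc r1 @^-1` [set z | good_state z]).
    by rewrite -[X in measurable X]setTI; exact: (macc r1) measurableT _ measurable_good_state.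
  rewrite -[X in P X]setIT -integral_indic// -sumEFin.
  rewrite [leRHS](eq_bigr (fun c => \int[P]_w (\1_(D c) w)%:E)%E); last first.
    by move=> c _; rewrite integral_indic// setIT -qE.
  rewrite -ge0_integral_sum//; last by move=> c; apply/measurable_EFinP; exact: measurable_indic.
  apply: ge0_le_integral => //.
  - by apply/measurable_EFinP; exact: measurable_indic.
  - by apply: emeasurable_sum => c; apply/measurable_EFinP; exact: measurable_indic.
  move=> w _; have [g|ng] := pselect (good_state (acc r1 w)); last first.
    by rewrite indicE memNset//=; apply: sume_ge0 => c _; rewrite lee_fin.
  have [c hc] := in_cell g; rewrite (bigD1 c)//=.
  rewrite [X in (_ <= X + _)%E](_ : _ = 1%E); last by rewrite indicE mem_set.
  rewrite -[leLHS]adde0; apply: leeD; first by rewrite lee_fin indicE; case: (_ \in _).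
  by apply: sume_ge0 => c' _; rewrite lee_fin.
pose N : R := (M * M)%:R.
have N0 : 0 < N by rewrite ltr0n.
have CS : (\sum_c q c) ^+ 2 / N <= \sum_c q c * q c.
  (* The mean of the [q c]; Cauchy-Schwarz is read off the sum of squared deviations from it. *)
  pose t := (\sum_c q c) / N.
  have : 0 <= \sum_c (q c - t) ^+ 2 by apply: sumr_ge0 => c _; exact: sqr_ge0.
  have -> : \sum_c (q c - t) ^+ 2 = \sum_c q c * q c - 2 * t * (\sum_c q c) + N * t ^+ 2.
    rewrite (eq_bigr (fun c => q c * q c - 2 * t * q c + t ^+ 2)); last by move=> c _; ring.
    rewrite big_split/= sumrB -mulr_sumr sumr_const card_prod !card_ord.
    by congr (_ + _); rewrite /N mulr_natl.
  have -> : N * t ^+ 2 = t * \sum_c q c by rewrite /t; field; exact: lt0r_neq0.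
  have -> : (\sum_c q c) ^+ 2 / N = t * \sum_c q c by rewrite /t; ring.
  lra.
apply: le_trans sumE; rewrite lee_fin -mulr_suml.
have NL : N <= 1156 * L := M_le.
have L0' : 0 < L by have := L0; lra.
have -> : 2312 * L = 2 * (1156 * L) by ring.
have C0 : 0 < 1156 * L by apply: mulr_gt0; [rewrite ltr0n|].
move: (1156 * L) C0 NL => C C0 NL; clearbody N.
have h1 : (expR (- K) / 2) ^+ 2 <= (\sum_c q c) ^+ 2.
  rewrite lerXn2r ?nnegrE ?divr_ge0 ?expR_ge0 ?sumr_ge0//.
  by apply: le_trans sumq; apply: ler_wpM2r; [rewrite invr_ge0|exact: eta_ge].
have h2 : (expR (- K) / 2) ^+ 2 / C <= (\sum_c q c) ^+ 2 / N.
  apply: ler_pM => //; first by rewrite invr_ge0 ltW.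
  by rewrite lef_pV2 ?posrE.
have h3 : 0 <= (expR (- K) / 2) ^+ 2 / C by rewrite divr_ge0 ?sqr_ge0// ltW.
apply: (@le_trans _ _ ((expR (- K) / 2) ^+ 2 / C * 2^-1)).
  by rewrite le_eqVlt; apply/orP; left; apply/eqP; rewrite invfM [RHS]mulrAC mulrA.
by apply: ler_pM => //; exact: le_trans h2 CS.
Qed.

End NearCritical.

(** * From probabilities at the pole to the expected number of maxima *)

Section ExpectationLower.
Context {R : realType}.
Local Notation sigma := (@sigma R).

Lemma near_critical_peaked n (v : 'I_n -> R3 R) u : (16 <= n)%N ->
  (forall i, dot (v i) (v i) = 1) -> -1 <= u.1 <= 1 ->
  near_critical (fun i => frame u (v i)) -> peaked v (sph u).
Proof.
move=> n16 v1 u1 [h1 h2 h3 h4].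
have n0 : 0 < n%:R :> R by rewrite ltr0n (leq_trans _ n16).
have E i : dot (sph u) (v i) = (frame u (v i)).2 by rewrite dotC dot_sph_frame.
have lt1 i : dot (sph u) (v i) < 1.
  by rewrite E; apply: le_lt_trans (h4 i) _; rewrite ltrBlDr ltrDl divr_gt0.
split.
- by rewrite (grad_sq_stereo v u1).
- by rewrite (hess_sq_stereo v1 u1 lt1).
- rewrite /cubic (eq_bigr (fun i => cube (frame u (v i))))// => i _.
  by rewrite (stereo_norm_sqr v1 u1 lt1).
- by move=> i; rewrite E.
Qed.

Section Random.
Context d (T : measurableType d) (P : probability T R) (n : nat).
Variable V : 'I_n -> T -> R3 R.
Hypotheses (mV : forall i, measurable_fun setT (V i)) (iV : indep_family P V).
Hypothesis lawV : forall i A, measurable A -> P (V i @^-1` A) = sigma A.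

Let good := \bigcap_(i in [set: 'I_n]) (V i @^-1` [set x | dot x x = 1]).

Let mS : measurable [set x : R3 R | dot x x = 1].
Proof.
have md : measurable_fun setT (fun y : R3 R => dot y y) by apply: measurable_dot; meas.
by have := md measurableT _ (measurable_set1 1); rewrite setTI.
Qed.

Let mgood : measurable good.
Proof.
apply: fin_bigcap_measurable => // i _.
by rewrite -[X in measurable X]setTI; exact: mV.
Qed.

Let Pgood : P good = 1%E.
Proof.
rewrite /good (iV (A := fun=> [set x | dot x x = 1]))// big1// => i _.
by rewrite lawV// sigma_unit.
Qed.

(** The product is continuous on the compact sphere and attains its maximum there. This settles the
    bounded range of [n] that [expectation_ge_large] leaves out. *)
Lemma expectation_ge1 : (0 < n)%N ->
  (1 <= \int[P]_w num_local_maxima (fun i => scale (@sphere_radius R n) (V i w)))%E.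
Proof.
move=> n0; apply: (@le_trans _ _ (\int[P]_w (cst 1%E) w)%E).
  by rewrite integral_cst//= probability_setT mule1.
apply: (le_integral_as_l mgood Pgood) => //.
move=> w gw; have v1 i : dot (V i w) (V i w) = 1 by exact: (gw i I).
have [x hx] := local_max_exists (V ^~ w).
apply: (@counting_ge1 _ R _ (scale (@sphere_radius R n) x)).
exact/(local_maxP n0 v1).
Qed.

(** The bound [c] is uniform over the positions [sph u], so by Tonelli's theorem the mean area of
    the peaked points is at least [c]; [num_local_maxima_ge] then multiplies it by [n]. *)
Lemma expectation_ge_near_critical (c : R) : (16 <= n)%N -> 0 <= c ->
  (forall u, -1 <= u.1 <= 1 -> 0 <= u.2 <= 2 * pi ->
    (c%:E <= P [set w | near_critical (fun i => frame u (V i w))])%E) ->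
  ((n%:R * c)%:E <=
   \int[P]_w num_local_maxima (fun i => scale (@sphere_radius R n) (V i w)))%E.
Proof.
move=> n16 c0 hc; have n0 : (0 < n)%N by exact: leq_trans n16.
pose E w : set (R3 R) := [set y | peaked (V ^~ w) y].
pose F w (y : R3 R) : R := \1_(E w) y.
have mE : measurable [set z : T * R3 R | peaked (V ^~ z.1) z.2].
  apply: (measurable_peaked (V := fun i (z : T * R3 R) => V i z.1)); last by meas.
  by move=> i; apply: measurableT_comp (mV i) _; meas.
have mF : measurable_fun setT (fun z : T * R3 R => F z.1 z.2).
  rewrite (_ : (fun z => _) = \1_[set z : T * R3 R | peaked (V ^~ z.1) z.2]).
    exact: measurable_indic.
  by apply/funext => z; rewrite /F !indicE; congr (nat_of_bool _)%:R; apply/idP/idP; rewrite !inE.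
have mEw w : measurable (E w).
  by apply: (measurable_peaked (V := fun i _ => V i w)) => //; meas.
have sE w : sigma (E w) = (\int[sigma]_y (F w y)%:E)%E.
  have /esym := @integral_indic _ _ R sigma setT measurableT (E w) (mEw w).
  by rewrite setIT.
have msE : measurable_fun setT (fun w => sigma (E w)).
  rewrite (_ : (fun w => _) = (fun w => \int[sigma]_y (F w y)%:E)%E); last by apply/funext => w.
  apply: (@measurable_integral_in _ _ _ _ _ sigma setT (fun w y => (F w y)%:E)) => //.
  - exact/measurable_EFinP.
  - by move=> w y; rewrite lee_fin.
apply: (@le_trans _ _ (\int[P]_w (n%:R%:E * sigma (E w)))%E); last first.
  apply: (le_integral_as_l mgood Pgood).
  - by move=> w; rewrite mule_ge0 ?lee_fin.
  - by move=> w; exact: measure_ge0.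
  - exact: emeasurable_funM.
  move=> w gw; have v1 i : dot (V i w) (V i w) = 1 by exact: (gw i I).
  exact: num_local_maxima_ge.
rewrite ge0_integralZl//.
rewrite EFinM; apply: lee_wpmul2l => //.
under eq_integral do rewrite sE.
rewrite (@tonelli_in _ _ _ _ _ P sigma setT setT (fun w y => (F w y)%:E))//; last 2 first.
- exact/measurable_EFinP.
- by move=> w y; rewrite lee_fin.
apply: (@le_trans _ _ (\int[sigma]_y (cst c%:E) y)%E).
  by rewrite integral_cst//= probability_setT mule1.
apply: le_integral_sigma => //.
- apply: (@measurable_integral_in _ _ _ _ _ P setT (fun y w => (F w y)%:E)) => //.
  + apply/measurable_EFinP; apply: (measurableT_comp mF (g := fun z : R3 R * T => (z.2, z.1))).
    exact: measurable_fun_pair.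
  + by move=> y w; rewrite lee_fin.
- by move=> y; apply: integral_ge0 => w _; rewrite lee_fin.
move=> _ /sph_surj[u [u1 u2 ->]].
pose V' i w := frame u (V i w).
have mV' i : measurable_fun setT (V' i).
  by apply: measurableT_comp (mV i); apply: measurable_frame; meas.
apply: le_trans (hc u u1 u2) _.
pose E' := [set w | near_critical (V' ^~ w)].
have mE' : measurable E' by exact: measurable_near_critical mV'.
rewrite -[X in P X]setIT -/E' -integral_indic//.
apply: (le_integral_as_l mgood Pgood).
- by move=> w; rewrite lee_fin.
- by move=> w; rewrite lee_fin.
- by apply/measurable_EFinP; exact: measurable_indic.
move=> w gw; have v1 i : dot (V i w) (V i w) = 1 by exact: (gw i I).
rewrite lee_fin /F !indicE; have [/set_mem|//] := boolP (w \in E').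
by move=> /(near_critical_peaked n16 v1 u1) h; rewrite mem_set.
Qed.

Lemma expectation_ge_large (k : R) : 2048 <= k -> 2 * k ^+ 2 <= n%:R ->
  ((n%:R * ((expR (- k ^+ 2) / 2) ^+ 2 / (2312 * ln n%:R)))%:E <=
   \int[P]_w num_local_maxima (fun i => scale (@sphere_radius R n) (V i w)))%E.
Proof.
move=> k2 nk.
have n16 : (16 <= n)%N.
  rewrite -(ler_nat R); apply: le_trans nk; have : 1 <= k by lra.
  by move=> k1; have : k <= k ^+ 2 by [rewrite ler_eXnr|]; lra.
have n0 : (0 < n)%N by exact: leq_trans n16.
apply: expectation_ge_near_critical n16 _ _.
  apply: divr_ge0; first exact: sqr_ge0.
  by apply: mulr_ge0; [exact: ler0n|rewrite ln_ge0// ler1n].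
move=> u u1 u2.
have mf : measurable_fun setT (frame u) by apply: measurable_frame; meas.
have mfA A : measurable A -> measurable (frame u @^-1` A).
  by move=> mA; rewrite -[X in measurable X]setTI; exact: mf.
apply: (probability_near_critical _ _ _ k2 nk).
- by move=> i; exact: measurableT_comp mf (mV i).
- by move=> A mA; exact: (iV (fun i => mfA _ (mA i))).
- by move=> i A mA; rewrite -(sigma_frame u1 u2 mA); exact: lawV (mfA _ mA).
Qed.

End Random.
End ExpectationLower.

Lemma ler_ratio {R : realFieldType} (n l b c C : R) : 0 < n -> 0 < l -> 0 < b -> 0 < c ->
  b / c <= C -> n / (C * l) <= n * (c / (b * l)).
Proof.
move=> n0 l0 b0 c0 hC.
rewrite ler_pM2l// -invf_div lef_pV2 ?posrE ?divr_gt0 ?mulr_gt0//; last first.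
  by apply: lt_le_trans hC; rewrite divr_gt0.
by rewrite mulrAC ler_pM2r.
Qed.

Theorem theorem4 (R : realType) :
  exists C : R, 0 < C /\
  forall n : nat, (2 <= n)%N ->
  forall (d : measure_display) (T : measurableType d) (P : probability T R)
    (L : 'I_n -> {RV P >-> R3 R}),
    mutually_independent L ->
    (forall i, has_law (L i) (@uniform_sphere R n)) ->
    ((n%:R / (C * ln n%:R))%:E
        <= \int[P]_w num_local_maxima (fun i => L i w)
        <= (C * n%:R / ln n%:R)%:E)%E.
Proof.
have [Cu Cu0 upper] := @expectation_upper R.
have [k k2048] : exists k : R, 2048 <= k by exists 2048.
pose c : R := (expR (- k ^+ 2) / 2) ^+ 2.
have c0 : 0 < c by apply/exprn_gt0/divr_gt0; [exact: expR_gt0|].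
have k2 : 0 <= k ^+ 2 by exact: sqr_ge0.
have c1 : 0 < 2312 / c by apply: divr_gt0 c0; rewrite ltr0n.
(* The three requirements on [C] serve the upper bound, the lower bound for [2 * k ^+ 2 <= n], and
   the lower bound for smaller [n]. *)
have [C [C0 C1 C2 C3]] : exists C : R, [/\ 0 < C, Cu <= C, 2312 / c <= C & 4 * k ^+ 2 <= C].
  exists (Cu + 2312 / c + 4 * k ^+ 2).
  by have := mulr_ge0 (ler0n R 4) k2; move: (2312 / c) (4 * k ^+ 2) c1 => x y x0 y0; split; lra.
exists C; split=> // n n2 d T P L indL lawL.
have n0 : (0 < n)%N by exact: leq_trans n2.
have nR0 : 0 < n%:R :> R by rewrite ltr0n.
have l2 : 1 / 2 <= ln n%:R :> R by exact: ln_ge_half.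
have l0 : 0 < ln n%:R :> R by apply: lt_le_trans l2; rewrite divr_gt0.
pose r : R := sphere_radius R n.
have r0 : r != 0 by rewrite gt_eqF// sphere_radius_gt0.
pose V i w := scale r^-1 (L i w).
have LE w : (fun i => L i w) = (fun i => scale r (V i w)).
  by apply/funext => i; rewrite /V scale_unscale.
have ms : measurable_fun setT (scale r^-1 : R3 R -> R3 R) by exact: measurable_scale.
have mV i : measurable_fun setT (V i) by apply: measurableT_comp => //.
have msA A : measurable A -> measurable (scale r^-1 @^-1` A : set (R3 R)).
  by move=> mA; rewrite -[X in measurable X]setTI; exact: ms.
have iV : indep_family P V by move=> A mA; exact: (indL _ (fun i => msA _ (mA i))).
have lV i A : measurable A -> P (V i @^-1` A) = sigma A.
  move=> mA; have := lawL i _ (msA _ mA).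
  rewrite (uniform_sphereE n0 (msA _ mA)).
  suff -> : scale (sphere_radius R n) @^-1` (scale r^-1 @^-1` A) = A by [].
  apply/seteqP; split => x; rewrite /preimage/= (_ : scale _ _ = x)//;
    by rewrite /scale/= !mulrA mulVf// !mul1r; case: x => -[].
under eq_integral do rewrite LE.
apply/andP; split; last first.
  apply: le_trans (upper _ _ P n V n2 mV iV lV) _.
  by rewrite lee_fin; apply: ler_wpM2r; [rewrite invr_ge0 ltW|apply: ler_wpM2r (ltW nR0) _ _ C1].
have [nk|nk] := leP (2 * k ^+ 2) n%:R.
  apply: le_trans (expectation_ge_large mV iV lV k2048 nk).
  rewrite lee_fin; apply: ler_ratio nR0 l0 _ c0 C2.
  by rewrite ltr0n.
(* For [n < 2 * k ^+ 2] a single local maximum suffices: [n < 4 * k ^+ 2 * (1 / 2) <= C * ln n]. *)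
apply: le_trans (expectation_ge1 mV iV lV n0).
rewrite lee_fin ler_pdivrMr ?mulr_gt0// mul1r (le_trans (ltW nk))//.
have -> : 2 * k ^+ 2 = (4 * k ^+ 2) * (1 / 2) by move: (k ^+ 2) => x; field.
by apply: ler_pM C3 l2; [exact: mulr_ge0|exact: divr_ge0].
Qed.
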